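(* Let $\Lambda$ be a ring containing a semisimple subring $E$ such that $\Lambda$ is finitely generated as a left $E$-module (so $\Lambda$ is left artinian), and let $\Omega_{\mathrm{nc}}=\Omega_{\mathrm{nc},\Lambda/E}$ be the bimodule of $E$-relative noncommutative differential $1$-forms. Then $\Lambda$ has finite global dimension if and only if the zeroth component $L_\Lambda(\Omega_{\mathrm{nc}})_0$ of the Leavitt ring $L_\Lambda(\Omega_{\mathrm{nc}})$ is von Neumann regular.
   Context: Rings are unital; modules are left unital modules. A ring $R$ is von Neumann regular if every finitely presented $R$-module is projective. Noncommutative differential forms: $\overline{\Lambda}=\Lambda/E$ is the quotient $E$-$E$-bimodule, with $\overline{a}$ the class of $a$. $\Omega_{\mathrm{nc},\Lambda/E}=\overline{\Lambda}\otimes_E\Lambda$, with right action $(\overline{a}\otimes_E x)b=\overline{a}\otimes_E xb$ and left action $b(\overline{a}\otimes_E x)=\overline{ba}\otimes_E x-\overline{b}\otimes_E ax$. It is finitely generated projective as a left $\Lambda$-module. Leavitt ring: let $R$ be a ring and $M$ an $R$-$R$-bimodule with ${}_RM$ finitely generated projective. Put $M^*=\mathrm{Hom}_R({}_RM,{}_RR)$ with $(af)(x)=f(xa)$, $(fb)(x)=f(x)b$. Choose a finite dual basis $\{\alpha_j,\alpha_j^*\}_{j\in J}$, $\alpha_j\in M$, $\alpha_j^*\in M^*$, so that $x=\sum_j\alpha_j^*(x)\alpha_j$ and $f=\sum_j\alpha_j^*f(\alpha_j)$ for all $x\in M$, $f\in M^*$; the Casimir element $c=\sum_j\alpha_j^*\otimes_R\alpha_j\in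 M^*\otimes_RM$ is independent of the choice. The Leavitt ring is $L_R(M)=T_R(M^*\oplus M)/(x\otimes_R f-f(x),\ c-1_R\mid x\in M,f\in M^* )$, where $T_R$ denotes the tensor ring; it is $\mathbb{Z}$-graded with $R$ in degree $0$, $\deg(x)=-1$ for $x\in M$ and $\deg(f)=1$ for $f\in M^*$. *)

(* Defs.v *)
From HB Require Import structures.
From mathcomp Require Import all_boot all_algebra.
From mathcomp Require Import boolp finmap monalg.

Set Implicit Arguments.
Unset Strict Implicit.
Unset Printing Implicit Defensive.

Import GRing.Theory.
Local Open Scope ring_scope.

(* Rings are pzRingType throughout, because the zero ring has to be allowed:
   the Leavitt ring of the zero bimodule is zero. *)

(* Left modules are lmodType. *)
Section Modules.
Variable R : pzRingType.

Definition surjective (U V : Type) (f : U -> V) : Prop :=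
  forall v, exists u, f u = v.

Definition projective (P : lmodType R) : Prop :=
  forall (U V : lmodType R) (g : {linear U -> V}) (f : {linear P -> V}),
    surjective g -> exists h : {linear P -> U}, forall x, g (h x) = f x.

Definition finitely_generated (M : lmodType R) : Prop :=
  exists (n : nat) (g : 'I_n -> M),
    forall x, exists c : 'I_n -> R, x = \sum_(i < n) c i *: g i.

(* There is an exact sequence R^m -> R^n -> M -> 0. *)
Definition finitely_presented (M : lmodType R) : Prop :=
  exists (m n : nat) (d : {linear 'rV[R]_m -> 'rV[R]_n})
         (p : {linear 'rV[R]_n -> M}),
    surjective p /\ (forall x, p x = 0 <-> exists y, d y = x).

Definition von_neumann_regular : Prop :=
  forall M : lmodType R, finitely_presented M -> projective M.

(* There is a projective resolution
   ... -> 0 -> P n -> ... -> P 1 -> P 0 -> M -> 0. *)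
Definition proj_dim_le (n : nat) (M : lmodType R) : Prop :=
  exists (P : nat -> lmodType R) (d : forall i, {linear P i.+1 -> P i})
         (e : {linear P 0%N -> M}),
    [/\ forall i, projective (P i),
        forall i, (n < i)%N -> forall x : P i, x = 0,
        surjective e,
        forall x, e x = 0 <-> exists y, d 0%N y = x
      & forall i x, d i x = 0 <-> exists y, d i.+1 y = x].

Definition finite_global_dimension : Prop :=
  exists n : nat, forall M : lmodType R, proj_dim_le n M.

Definition simple_submodule (V : lmodType R) (S : {pred V}) : Prop :=
  [/\ GRing.submod_closed S,
      exists2 x, x \in S & x != 0
    & forall T : {pred V}, GRing.submod_closed T -> {subset T <= S} ->
        (forall x, x \in T -> x = 0) \/ {subset S <= T}].

(* V is the (internal) direct sum of a family of simple submodules. *)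
Definition semisimple_module (V : lmodType R) : Prop :=
  exists (I : choiceType) (S : I -> {pred V}),
    [/\ forall i, simple_submodule (S i),
        forall x, exists (r : seq I) (f : I -> V),
          (forall i, f i \in S i) /\ x = \sum_(i <- r) f i
      & forall (r : seq I) (f : I -> V), uniq r -> (forall i, f i \in S i) ->
          \sum_(i <- r) f i = 0 -> forall i, i \in r -> f i = 0].

Definition semisimple_ring : Prop := semisimple_module R^o.

End Modules.

HB.mixin Record Zmodule_isRmodule (S : pzRingType) V of GRing.Zmodule V := {
  rscale : V -> S -> V;
  rscaleA : forall v a b, rscale (rscale v a) b = rscale v (a * b);
  rscale1 : forall v, rscale v 1 = v;
  rscaleDl : forall a u v, rscale (u + v) a = rscale u a + rscale v a;
  rscaleDr : forall v a b, rscale v (a + b) = rscale v a + rscale v b }.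

#[short(type="rmodType")]
HB.structure Definition Rmodule (S : pzRingType) :=
  {V of GRing.Zmodule V & Zmodule_isRmodule S V}.

Notation "v :* a" := (rscale v a) : ring_scope.

HB.mixin Record LRmodule_isBimodule (R S : pzRingType) V
    of GRing.Lmodule R V & Rmodule S V := {
  scalerAr_rscale : forall (a : R) (v : V) (b : S),
    a *: (v :* b : V) = (a *: v) :* b }.

#[short(type="bimodType")]
HB.structure Definition Bimodule (R S : pzRingType) :=
  {V of GRing.Lmodule R V & Rmodule S V & LRmodule_isBimodule R S V}.

Section RmoduleTheory.
Variables (S : pzRingType) (V : rmodType S).
Implicit Types (v : V) (a : S).

Lemma rscale0l a : (0 : V) :* a = 0.
Proof. by apply: (addrI (0 :* a)); rewrite -rscaleDl !addr0. Qed.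

Lemma rscaleNl a v : (- v) :* a = - (v :* a).
Proof. by apply: (addrI (v :* a)); rewrite -rscaleDl !subrr rscale0l. Qed.

Lemma rscaleBl a u v : (u - v) :* a = u :* a - v :* a.
Proof. by rewrite rscaleDl rscaleNl. Qed.

End RmoduleTheory.

Section ProdBimodule.
Variables (R S : pzRingType) (U V : bimodType R S).

Definition prod_rscale (p : U * V) (a : S) : U * V := (p.1 :* a, p.2 :* a).

Fact prod_rscaleA v a b :
  prod_rscale (prod_rscale v a) b = prod_rscale v (a * b).
Proof. by rewrite /prod_rscale /= !rscaleA. Qed.
Fact prod_rscale1 v : prod_rscale v 1 = v.
Proof. by rewrite /prod_rscale !rscale1; case: v. Qed.
Fact prod_rscaleDl a u v :
  prod_rscale (u + v) a = prod_rscale u a + prod_rscale v a.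
Proof. by rewrite /prod_rscale /= !rscaleDl. Qed.
Fact prod_rscaleDr v a b :
  prod_rscale v (a + b) = prod_rscale v a + prod_rscale v b.
Proof. by rewrite /prod_rscale /= !rscaleDr. Qed.

HB.instance Definition _ := Zmodule_isRmodule.Build S (U * V)%type
  prod_rscaleA prod_rscale1 prod_rscaleDl prod_rscaleDr.

Fact prod_scalerAr a (v : U * V) b :
  a *: (v :* b : U * V) = (a *: v : U * V) :* b.
Proof. by congr (_, _) => /=; rewrite scalerAr_rscale. Qed.

HB.instance Definition _ := LRmodule_isBimodule.Build R S (U * V)%type
  prod_scalerAr.

End ProdBimodule.

(* The quotient of an abelian group by the subgroup generated by the u - v,
   for u and v related by r. *)
Section ZmodQuotient.
Variables (V : zmodType) (r : V -> V -> Prop).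

Inductive zspan : V -> Prop :=
| zspan_rel u v of r u v : zspan (u - v)
| zspan0 : zspan 0
| zspanB u v of zspan u & zspan v : zspan (u - v).

Definition zker : {pred V} := fun x => `[< zspan x >].

Fact zker_zmod_closed : zmod_closed zker.
Proof.
split=> [|u v /asboolP Hu /asboolP Hv]; apply/asboolP; first exact: zspan0.
exact: zspanB.
Qed.
HB.instance Definition _ := GRing.isZmodClosed.Build V zker zker_zmod_closed.

Definition zquot : Type := {ideal_quot zker}.
HB.instance Definition _ := GRing.Zmodule.on zquot.

(* Locked, here and below, only to keep unification from unfolding quotients. *)
Fact zproj_key : unit. Proof. by []. Qed.
Definition zproj : V -> zquot :=
  locked_with zproj_key (fun v => \pi_{ideal_quot zker}%qT v).

Lemma zprojE v : zproj v = \pi_{ideal_quot zker}%qT v.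
Proof. by rewrite /zproj locked_withE. Qed.

Fact zproj_is_zmod_morphism : zmod_morphism zproj.
Proof. by move=> u v; rewrite !zprojE raddfB. Qed.
HB.instance Definition _ :=
  GRing.isZmodMorphism.Build V zquot zproj zproj_is_zmod_morphism.

Lemma zproj_eqP u v : zproj u = zproj v <-> zspan (u - v).
Proof.
split=> [/eqP|H]; first by rewrite !zprojE -Quotient.idealrBE => /asboolP.
by apply/eqP; rewrite !zprojE -Quotient.idealrBE; apply/asboolP.
Qed.

Lemma zproj_rel u v : r u v -> zproj u = zproj v.
Proof. by move=> ruv; apply/zproj_eqP/zspan_rel. Qed.

Lemma zproj_surj q : exists v, zproj v = q.
Proof. by exists (repr (q : {ideal_quot zker})); rewrite !zprojE reprK. Qed.

Section Lift.
Variables (G : zmodType) (f : V -> G).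

(* Only meaningful if f is additive and compatible with r. *)
Definition zlift : zquot -> G :=
  locked_with zproj_key (fun q => f (repr (q : {ideal_quot zker}))).

Hypotheses (fB : zmod_morphism f) (fr : forall u v, r u v -> f u = f v).

Lemma zlift_proj v : zlift (zproj v) = f v.
Proof.
have f0 : f 0 = 0 by rewrite -(subr0 0) fB subrr.
have fspan u : zspan u -> f u = 0.
  by elim=> [x y /fr e||x y _ ex _ ey]; rewrite ?fB ?e ?ex ?ey ?subrr.
rewrite /zlift locked_withE; apply/eqP; rewrite -subr_eq0 -fB.
by apply/eqP/fspan/zproj_eqP; rewrite !zprojE reprK.
Qed.

Lemma zlift_is_zmod_morphism : zmod_morphism zlift.
Proof.
move=> p q; have [[u <-] [v <-]] := (zproj_surj p, zproj_surj q).
by rewrite -raddfB !zlift_proj fB.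
Qed.

End Lift.
End ZmodQuotient.

(* Additive extension of h to the free abelian group on K. *)
Section FreeLift.
Variables (K : choiceType) (G : zmodType) (h : K -> G).

Definition zext (g : {malg int[K]}) : G := \sum_(k <- msupp g) h k *~ g@_k.

Lemma zextEw (d : {fset K}) g :
  fsubset (msupp g) d -> zext g = \sum_(k <- d) h k *~ g@_k.
Proof.
move=> le; rewrite /zext (big_fset_incl _ le) //= => x xd.
by move/mcoeff_outdom->; rewrite mulr0z.
Qed.

Lemma zextU k : zext << k >> = h k.
Proof. by rewrite (zextEw msuppU_le) big_seq_fset1 mcoeffUU mulr1z. Qed.

Fact zext_is_zmod_morphism : zmod_morphism zext.
Proof.
move=> g1 g2 /=; pose d := fsetU (msupp (g1 - g2)) (fsetU (msupp g1) (msupp g2)).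
rewrite (zextEw (fsubsetUl _ _ : fsubset (msupp (g1 - g2)) d)).
have l1 : fsubset (msupp g1) d by apply/fsubsetP=> k kg; rewrite !in_fsetU kg orbT.
have l2 : fsubset (msupp g2) d by apply/fsubsetP=> k kg; rewrite !in_fsetU kg !orbT.
rewrite (zextEw l1) (zextEw l2) -sumrB; apply/eq_bigr=> k _.
by rewrite mcoeffB mulrzBr.
Qed.
HB.instance Definition _ :=
  GRing.isZmodMorphism.Build {malg int[K]} G zext zext_is_zmod_morphism.

End FreeLift.

Lemma malgZ_ext (K : choiceType) (G : zmodType)
    (f1 f2 : {additive {malg int[K]} -> G}) :
  (forall k, f1 << k >> = f2 << k >>) -> f1 =1 f2.
Proof.
move=> eqf g; rewrite (monalgE g) !raddf_sum; apply: eq_bigr => k _.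
have ->: << g@_k *g k >> = << k >> *~ g@_k :> {malg int[K]}.
  by rewrite -(raddfMz (mkmalgU k)) intz.
by rewrite !raddfMz eqf.
Qed.

Lemma zextM (K : monomType) (B : pzRingType) (h : K -> B) :
  (forall k l, h (mmul k l) = h k * h l) ->
  {morph zext h : p q / p * q >-> p * q}.
Proof.
move=> hM p q; rewrite malgME raddf_sum mulr_suml; apply: eq_bigr => k _.
rewrite raddf_sum mulr_sumr; apply: eq_bigr => l _ /=.
have -> : << p@_k * q@_l *g mmul k l >> =
          << mmul k l >> *~ (p@_k * q@_l) :> {malg int[K]}.
  by rewrite -(raddfMz (mkmalgU _)) intz.
by rewrite raddfMz /= zextU hM mulrzAl mulrzAr -mulrzA [q@_l * _]mulrC.
Qed.

(* The tensor product over E of a right and a left E-module. *)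
Section TensorProduct.
Variables (E : pzRingType) (A : rmodType E) (B : lmodType E).

Inductive tensor_rel : {malg int[(A * B)%type]} -> {malg int[(A * B)%type]} -> Prop :=
| tensor_relDl a a' b :
    tensor_rel << (a + a', b) >> (<< (a, b) >> + << (a', b) >>)
| tensor_relDr a b b' :
    tensor_rel << (a, b + b') >> (<< (a, b) >> + << (a, b') >>)
| tensor_relM a e b :
    tensor_rel << (a :* e, b) >> << (a, e *: b) >>.

Definition tensor : Type := zquot tensor_rel.
HB.instance Definition _ := GRing.Zmodule.on tensor.

Fact tmul_key : unit. Proof. by []. Qed.
Definition tmul : A -> B -> tensor :=
  locked_with tmul_key (fun a b => zproj tensor_rel << (a, b) >>).

Lemma tmulE a b : tmul a b = zproj tensor_rel << (a, b) >>.
Proof. by rewrite /tmul locked_withE. Qed.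

Lemma tmulDl a a' b : tmul (a + a') b = tmul a b + tmul a' b.
Proof. by rewrite !tmulE (zproj_rel (tensor_relDl _ _ _)) raddfD. Qed.

Lemma tmulDr a b b' : tmul a (b + b') = tmul a b + tmul a b'.
Proof. by rewrite !tmulE (zproj_rel (tensor_relDr _ _ _)) raddfD. Qed.

Lemma tmulA a e b : tmul (a :* e) b = tmul a (e *: b).
Proof. by rewrite !tmulE; exact: zproj_rel (tensor_relM _ _ _). Qed.

Fact tmul_is_zmod_morphism a : zmod_morphism (tmul a).
Proof.
by move=> x y; apply/eqP; rewrite eq_sym subr_eq -tmulDr subrK.
Qed.
HB.instance Definition _ a :=
  GRing.isZmodMorphism.Build B tensor (tmul a) (tmul_is_zmod_morphism a).

Lemma tmulBl a a' b : tmul (a - a') b = tmul a b - tmul a' b.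
Proof. by apply/eqP; rewrite eq_sym subr_eq -tmulDl subrK. Qed.

Lemma tmul0l b : tmul 0 b = 0.
Proof. by rewrite -(subrr 0) tmulBl subrr. Qed.

Lemma tensor_ext (G : zmodType) (f1 f2 : tensor -> G) :
  zmod_morphism f1 -> zmod_morphism f2 ->
  (forall a b, f1 (tmul a b) = f2 (tmul a b)) -> f1 =1 f2.
Proof.
move=> f1B f2B eqf q; have [g <-] := zproj_surj q.
pose F1 := GRing.isZmodMorphism.Build _ _ _ f1B.
pose F2 := GRing.isZmodMorphism.Build _ _ _ f2B.
pose g1 : {additive tensor -> G} := HB.pack f1 F1.
pose g2 : {additive tensor -> G} := HB.pack f2 F2.
exact: (@malgZ_ext _ _ (g1 \o zproj tensor_rel) (g2 \o zproj tensor_rel)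
  (fun k => let: (a, b) := k in
     etrans (congr1 f1 (esym (tmulE a b)))
            (etrans (eqf a b) (congr1 f2 (tmulE a b))))).
Qed.

Section Lift.
Variables (G : zmodType) (f : A -> B -> G).

Definition balanced : Prop :=
  [/\ forall a a' b, f (a + a') b = f a b + f a' b,
      forall a b b', f a (b + b') = f a b + f a b'
    & forall a e b, f (a :* e) b = f a (e *: b)].

(* The map induced by f; only meaningful if f is balanced. *)
Definition tlift : tensor -> G := zlift (zext (fun p => f p.1 p.2)).

Hypothesis fP : balanced.

Fact tlift_rel u v :
  tensor_rel u v ->
  zext (fun p => f p.1 p.2) u = zext (fun p => f p.1 p.2) v.
Proof.
by have [fDl fDr fA] := fP; case=> [a a' b|a b b'|a e b]; rewrite ?raddfD /= !zextU /= ?fDl ?fDr ?fA.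
Qed.

Lemma tlift_tmul a b : tlift (tmul a b) = f a b.
Proof. by rewrite /tlift tmulE zlift_proj ?zextU; [|exact: raddfB|exact: tlift_rel]. Qed.

Lemma tlift_is_zmod_morphism : zmod_morphism tlift.
Proof. by apply: zlift_is_zmod_morphism; [exact: raddfB|exact: tlift_rel]. Qed.

End Lift.
End TensorProduct.

(* The quotient of a ring by the two-sided ideal generated by the u - v,
   for u and v related by r. *)
Section RingQuotient.
Variables (A : pzRingType) (r : A -> A -> Prop).

Inductive rideal : A -> Prop :=
| rideal_rel u v of r u v : rideal (u - v)
| rideal0 : rideal 0
| ridealB u v of rideal u & rideal v : rideal (u - v)
| rideal_mull a u of rideal u : rideal (a * u)
| rideal_mulr a u of rideal u : rideal (u * a).

Definition rker : {pred A} := fun x => `[< rideal x >].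

Fact rker_zmod_closed : zmod_closed rker.
Proof.
split=> [|u v /asboolP Hu /asboolP Hv]; apply/asboolP; first exact: rideal0.
exact: ridealB.
Qed.
HB.instance Definition _ := GRing.isZmodClosed.Build A rker rker_zmod_closed.

Definition rquot : Type := {ideal_quot rker}.
HB.instance Definition _ := GRing.Zmodule.on rquot.

Definition rproj : A -> rquot :=
  locked_with zproj_key (fun a => \pi_{ideal_quot rker}%qT a).

Lemma rprojE a : rproj a = \pi_{ideal_quot rker}%qT a.
Proof. by rewrite /rproj locked_withE. Qed.

Lemma rproj_eqP u v : rproj u = rproj v <-> rideal (u - v).
Proof.
split=> [/eqP|H]; first by rewrite !rprojE -Quotient.idealrBE => /asboolP.
by apply/eqP; rewrite !rprojE -Quotient.idealrBE; apply/asboolP.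
Qed.

Lemma rproj_surj q : exists v, rproj v = q.
Proof. by exists (repr (q : {ideal_quot rker})); rewrite !rprojE reprK. Qed.

Definition rquot_mul (p q : rquot) : rquot :=
  rproj (repr (p : {ideal_quot rker}) * repr (q : {ideal_quot rker})).

Fact rproj_mul u v : rquot_mul (rproj u) (rproj v) = rproj (u * v).
Proof.
have rK x : rproj (repr (rproj x : {ideal_quot rker})) = rproj x.
  by rewrite [LHS]rprojE reprK.
apply/rproj_eqP; set u' := repr _; set v' := repr _.
have -> : u' * v' - u * v = (u' - u) * v' - u * (v - v').
  by rewrite mulrBl mulrBr opprB addrA subrK.
apply: ridealB; first exact/rideal_mulr/rproj_eqP/rK.
by apply/rideal_mull/rproj_eqP; rewrite rK.
Qed.

Fact rproj_is_zmod_morphism : zmod_morphism rproj.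
Proof. by move=> u v; rewrite !rprojE raddfB. Qed.
HB.instance Definition _ :=
  GRing.isZmodMorphism.Build A rquot rproj rproj_is_zmod_morphism.

Fact rquot_mulA : associative rquot_mul.
Proof.
move=> p q s; have [u <-] := rproj_surj p; have [v <-] := rproj_surj q.
by have [w <-] := rproj_surj s; rewrite !rproj_mul mulrA.
Qed.
Fact rquot_mul1 : left_id (rproj 1) rquot_mul.
Proof. by move=> p; have [u <-] := rproj_surj p; rewrite rproj_mul mul1r. Qed.
Fact rquot_mulr1 : right_id (rproj 1) rquot_mul.
Proof. by move=> p; have [u <-] := rproj_surj p; rewrite rproj_mul mulr1. Qed.
Fact rquot_mulDl : left_distributive rquot_mul +%R.
Proof.
move=> p q s; have [u <-] := rproj_surj p; have [v <-] := rproj_surj q.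
by have [w <-] := rproj_surj s; rewrite -raddfD !rproj_mul mulrDl raddfD.
Qed.
Fact rquot_mulDr : right_distributive rquot_mul +%R.
Proof.
move=> p q s; have [u <-] := rproj_surj p; have [v <-] := rproj_surj q.
by have [w <-] := rproj_surj s; rewrite -raddfD !rproj_mul mulrDr raddfD.
Qed.

HB.instance Definition _ := GRing.Zmodule_isPzRing.Build rquot
  rquot_mulA rquot_mul1 rquot_mulr1 rquot_mulDl rquot_mulDr.

Fact rproj_is_monoid_morphism : monoid_morphism rproj.
Proof. by split=> // u v; rewrite -rproj_mul. Qed.
HB.instance Definition _ :=
  GRing.isMonoidMorphism.Build A rquot rproj rproj_is_monoid_morphism.

Lemma rproj_rel u v : r u v -> rproj u = rproj v.
Proof. by move=> ruv; apply/rproj_eqP/rideal_rel. Qed.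

End RingQuotient.

(* The dual M^* = Hom_R(M, R) of the underlying left module. *)
Section Dual.
Variables (R : pzRingType) (M : bimodType R R).

Definition dual : Type := {linear M -> R^o}.
Definition dual_linear (f : dual) : {linear M -> R^o} := f.
Definition dual_fun (f : dual) : M -> R := dual_linear f.
Coercion dual_fun : dual >-> Funclass.

Lemma dualP (f g : dual) : (f : M -> R) =1 g -> f = g.
Proof.
case: f g => f cf [g cg] eqfg; have {eqfg} efg : f = g by apply/funext.
subst g; case: cf cg => [[a1] [b1]] [[a2] [b2]].
by rewrite (Prop_irrelevance a1 a2) (Prop_irrelevance b1 b2).
Qed.

HB.instance Definition _ := gen_eqMixin dual.
HB.instance Definition _ := gen_choiceMixin dual.

Implicit Types (f g : dual) (a b : R).

Definition dual0 : dual := (\0 : {linear M -> R^o}).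
Definition dual_opp f : dual := (\- dual_linear f : {linear M -> R^o}).
Definition dual_add f g : dual :=
  (dual_linear f \+ dual_linear g : {linear M -> R^o}).

Fact dual_addA : associative dual_add.
Proof. by move=> f g h; apply: dualP => x; apply: addrA. Qed.
Fact dual_addC : commutative dual_add.
Proof. by move=> f g; apply: dualP => x; apply: addrC. Qed.
Fact dual_add0 : left_id dual0 dual_add.
Proof. by move=> f; apply: dualP => x; apply: add0r. Qed.
Fact dual_addN : left_inverse dual0 dual_opp dual_add.
Proof. by move=> f; apply: dualP => x; apply: addNr. Qed.
HB.instance Definition _ := GRing.isZmodule.Build dual
  dual_addA dual_addC dual_add0 dual_addN.

Fact dual_scale_linear a f : linear (fun x : M => f (x :* a) : R^o).
Proof.
move=> b x y; rewrite rscaleDl -scalerAr_rscale.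
exact: (linearP (dual_linear f)).
Qed.
Definition dual_scale a f : dual :=
  HB.pack_for {linear M -> R^o} (fun x : M => f (x :* a) : R^o)
    (GRing.isLinear.Build R M R^o _ _ (dual_scale_linear a f)).

Fact dual_rscale_linear f a : linear (fun x : M => f x * a : R^o).
Proof.
move=> b x y; have -> : f (b *: x + y) = b * f x + f y.
  exact: (linearP (dual_linear f)).
by rewrite mulrDl -mulrA.
Qed.
Definition dual_rscale f a : dual :=
  HB.pack_for {linear M -> R^o} (fun x : M => f x * a : R^o)
    (GRing.isLinear.Build R M R^o _ _ (dual_rscale_linear f a)).

Let dual_scaleE a f x : dual_scale a f x = f (x :* a). Proof. by []. Qed.
Let dual_rscaleE0 f a x : dual_rscale f a x = f x * a. Proof. by []. Qed.

Fact dual_scaleA a b f : dual_scale a (dual_scale b f) = dual_scale (a * b) f.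
Proof. by apply: dualP => x; rewrite !dual_scaleE rscaleA. Qed.
Fact dual_scale1 : left_id 1 dual_scale.
Proof. by move=> f; apply: dualP => x; rewrite dual_scaleE rscale1. Qed.
Fact dual_scaleDr : right_distributive dual_scale +%R.
Proof. by move=> a f g; apply: dualP. Qed.
Fact dual_scaleDl f a b : dual_scale (a + b) f = dual_scale a f + dual_scale b f.
Proof.
apply: dualP => x; rewrite dual_scaleE rscaleDr.
exact: (raddfD (dual_linear f)).
Qed.
HB.instance Definition _ := GRing.Zmodule_isLmodule.Build R dual
  dual_scaleA dual_scale1 dual_scaleDr dual_scaleDl.

Fact dual_rscaleA f a b : dual_rscale (dual_rscale f a) b = dual_rscale f (a * b).
Proof. by apply: dualP => x; rewrite !dual_rscaleE0 mulrA. Qed.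
Fact dual_rscale1 f : dual_rscale f 1 = f.
Proof. by apply: dualP => x; rewrite dual_rscaleE0 mulr1. Qed.
Fact dual_rscaleDl a f g :
  dual_rscale (f + g) a = dual_rscale f a + dual_rscale g a.
Proof. by apply: dualP => x; apply: mulrDl. Qed.
Fact dual_rscaleDr f a b :
  dual_rscale f (a + b) = dual_rscale f a + dual_rscale f b.
Proof. by apply: dualP => x; apply: mulrDr. Qed.
HB.instance Definition _ := Zmodule_isRmodule.Build R dual
  dual_rscaleA dual_rscale1 dual_rscaleDl dual_rscaleDr.

Fact dual_scalerAr a (f : dual) b : a *: (f :* b : dual) = (a *: f) :* b.
Proof. exact: dualP. Qed.
HB.instance Definition _ := LRmodule_isBimodule.Build R R dual dual_scalerAr.

Lemma dualZE a f x : (a *: f) x = f (x :* a). Proof. by []. Qed.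
Lemma dual_rscaleE f a x : (f :* a) x = f x * a. Proof. by []. Qed.

Definition dual_basis n (a : 'I_n -> M) (a' : 'I_n -> dual) : Prop :=
  (forall x : M, x = \sum_(j < n) a' j x *: a j) /\
  (forall f : dual, f = \sum_(j < n) a' j :* f (a j)).

End Dual.

(* The tensor ring of a bimodule N, presented as the ring generated by the
   elements of R and of N subject to the relations saying that R -> T_R(N) is
   a ring morphism and N -> T_R(N) is a bimodule morphism; tring_lift is its
   universal property. *)
Section TensorRing.
Variables (R : pzRingType) (N : bimodType R R).

Let F := {malg int[{fmonom (R + N)%type}]}.
Let gr (a : R) : F := << fmu (inl a) >>.
Let gn (x : N) : F := << fmu (inr x) >>.

Inductive tring_rel : F -> F -> Prop :=
| tring_relD a b : tring_rel (gr (a + b)) (gr a + gr b)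
| tring_relM a b : tring_rel (gr (a * b)) (gr a * gr b)
| tring_rel1 : tring_rel (gr 1) 1
| tring_relDn x y : tring_rel (gn (x + y)) (gn x + gn y)
| tring_relZ a x : tring_rel (gn (a *: x)) (gr a * gn x)
| tring_relZr x a : tring_rel (gn (x :* a)) (gn x * gr a).

Definition tring : Type := rquot tring_rel.
HB.instance Definition _ := GRing.PzRing.on tring.

Definition tring_of_ring (a : R) : tring := rproj tring_rel (gr a).
Definition tring_of_mod (x : N) : tring := rproj tring_rel (gn x).

Fact tring_of_ring_is_zmod_morphism : zmod_morphism tring_of_ring.
Proof.
move=> a b; have := rproj_rel (tring_relD (a - b) b).
by rewrite subrK raddfD /tring_of_ring => ->; rewrite addrK.
Qed.
Fact tring_of_ring_is_monoid_morphism : monoid_morphism tring_of_ring.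
Proof.
split=> [|a b]; first exact: etrans (rproj_rel tring_rel1) (rmorph1 _).
exact: etrans (rproj_rel (tring_relM a b)) (rmorphM _ _ _).
Qed.
HB.instance Definition _ := GRing.isZmodMorphism.Build R tring tring_of_ring
  tring_of_ring_is_zmod_morphism.
HB.instance Definition _ := GRing.isMonoidMorphism.Build R tring tring_of_ring
  tring_of_ring_is_monoid_morphism.

Fact tring_of_mod_is_zmod_morphism : zmod_morphism tring_of_mod.
Proof.
move=> a b; have := rproj_rel (tring_relDn (a - b) b).
by rewrite subrK raddfD /tring_of_mod => ->; rewrite addrK.
Qed.
HB.instance Definition _ := GRing.isZmodMorphism.Build N tring tring_of_mod
  tring_of_mod_is_zmod_morphism.

Lemma tring_of_modZ a x : tring_of_mod (a *: x) = tring_of_ring a * tring_of_mod x.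
Proof. by rewrite /tring_of_mod (rproj_rel (tring_relZ _ _)) rmorphM. Qed.

Lemma tring_of_modZr x a : tring_of_mod (x :* a) = tring_of_mod x * tring_of_ring a.
Proof. by rewrite /tring_of_mod (rproj_rel (tring_relZr _ _)) rmorphM. Qed.

Section Lift.
Variables (B : pzRingType) (f : {rmorphism R -> B}) (g : {additive N -> B}).
Hypotheses (gZ : forall a x, g (a *: x) = f a * g x)
           (gZr : forall x a, g (x :* a) = g x * f a).

Lemma tring_lift :
  exists h : {rmorphism tring -> B},
    (forall a, h (tring_of_ring a) = f a) /\ (forall x, h (tring_of_mod x) = g x).
Proof.
pose v (i : R + N) := match i with inl a => f a | inr x => g x end.
pose w (m : {fmonom (R + N)%type}) : B := \prod_(i <- (m : seq _)) v i.
have wM m n : w (mmul m n) = w m * w n by rewrite /w fmM big_cat.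
have w1 : w mone = 1 by rewrite /w fm1 big_nil.
have wU i : w (fmu i) = v i by rewrite /w fmU big_seq1.
pose H : F -> B := zext w.
have HM : {morph H : p q / p * q} by exact: zextM.
have H1 : H 1 = 1 by exact: etrans (zextU w mone) w1.
have Hgr a : H (gr a) = f a by rewrite /H zextU wU.
have Hgn x : H (gn x) = g x by rewrite /H zextU wU.
have HD : {morph H : p q / p + q} by exact: raddfD.
have HB : zmod_morphism H by exact: raddfB.
have Hr p q : tring_rel p q -> H p = H q.
  case=> [a b|a b||x y|a x|x a].
  - by rewrite HD !Hgr raddfD.
  - by rewrite HM !Hgr rmorphM.
  - by rewrite H1 Hgr rmorph1.
  - by rewrite HD !Hgn raddfD.
  - by rewrite HM Hgn Hgr Hgn gZ.
  - by rewrite HM Hgn Hgn Hgr gZr.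
have Hker p : rideal tring_rel p -> H p = 0.
  elim=> {p} [p q /Hr e||p q _ ep _ eq|a p _ ep|a p _ ep].
  - by rewrite HB e subrr.
  - by rewrite -(subrr 0) HB subrr.
  - by rewrite HB ep eq subrr.
  - by rewrite HM ep mulr0.
  - by rewrite HM ep mul0r.
pose h (t : tring) : B := H (repr (t : {ideal_quot rker tring_rel})).
have hE p : h (rproj tring_rel p) = H p.
  apply/eqP; rewrite -subr_eq0 -HB; apply/eqP/Hker/rproj_eqP.
  by rewrite [LHS]rprojE reprK.
have hB : zmod_morphism h.
  move=> s t; have [[p <-] [q <-]] := (rproj_surj s, rproj_surj t).
  by rewrite -raddfB !hE HB.
have hM : monoid_morphism h.
  split=> [|s t]; first by rewrite -(rmorph1 (rproj tring_rel)) hE.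
  have [[p <-] [q <-]] := (rproj_surj s, rproj_surj t).
  by rewrite -rmorphM !hE HM.
pose hZ := GRing.isZmodMorphism.Build tring B h hB.
pose hR := GRing.isMonoidMorphism.Build tring B h hM.
by exists (HB.pack_for {rmorphism tring -> B} h hZ hR); split=> x; apply: etrans (hE _) _.
Qed.

Lemma tring_ext (h1 h2 : {rmorphism tring -> B}) :
  (forall a, h1 (tring_of_ring a) = h2 (tring_of_ring a)) ->
  (forall x, h1 (tring_of_mod x) = h2 (tring_of_mod x)) -> h1 =1 h2.
Proof.
move=> eqr eqn t; have [p <-] := rproj_surj t.
have kM (h : {rmorphism tring -> B}) q q' :
    h (rproj tring_rel (q * q')) = h (rproj tring_rel q) * h (rproj tring_rel q').
  by rewrite !rmorphM.
apply: (@malgZ_ext _ _ (h1 \o rproj tring_rel) (h2 \o rproj tring_rel)) => -[m] /=.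
elim: m => [|i m IHm].
  have -> : << FMonom [::] >> = 1 :> F by rewrite -fmoneE.
  by rewrite !rmorph1.
have -> : << FMonom (i :: m) >> = << fmu i >> * << FMonom m >> :> F.
  by rewrite malgM_def fgmulUU mulr1 /mmul /= ?fmmulE ?fmuE.
by rewrite !kM IHm; case: i => [a|x]; [rewrite [h1 _]eqr|rewrite [h1 _]eqn].
Qed.

End Lift.
End TensorRing.

(* The Leavitt ring of a bimodule M; in the tensor ring, f + x (f in M^*, x in
   M) is the generator attached to the pair (f, x).  The Casimir element does
   not depend on the dual basis, so identifying it with 1 for every finite
   dual basis is the same as doing so for a chosen one. *)
Section Leavitt.
Variables (R : pzRingType) (M : bimodType R R).

Let T := tring (dual M * M)%type.
Let tr (a : R) : T := tring_of_ring _ a.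
Let tf (f : dual M) : T := tring_of_mod (f, 0 : M).
Let tx (x : M) : T := tring_of_mod (0 : dual M, x).

Inductive leavitt_rel : T -> T -> Prop :=
| leavitt_eval x f : leavitt_rel (tx x * tf f) (tr (f x))
| leavitt_casimir n (a : 'I_n -> M) (a' : 'I_n -> dual M) of dual_basis a a' :
    leavitt_rel (\sum_(j < n) tf (a' j) * tx (a j)) 1.

Definition leavitt : Type := rquot leavitt_rel.
HB.instance Definition _ := GRing.PzRing.on leavitt.

(* The grading induced by the degrees of the generators: leavitt_homog d is
   the component of degree d. *)
Inductive leavitt_homog : int -> leavitt -> Prop :=
| homog_ring a : leavitt_homog 0 (rproj _ (tr a))
| homog_mod x : leavitt_homog (-1) (rproj _ (tx x))
| homog_dual f : leavitt_homog 1 (rproj _ (tf f))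
| homog0 d : leavitt_homog d 0
| homogB d u v of leavitt_homog d u & leavitt_homog d v :
    leavitt_homog d (u - v)
| homogM d e u v of leavitt_homog d u & leavitt_homog e v :
    leavitt_homog (d + e) (u * v).

Definition leavitt0_pred : {pred leavitt} := fun u => `[< leavitt_homog 0 u >].

Fact leavitt0_subring_closed : subring_closed leavitt0_pred.
Proof.
split=> [|u v /asboolP Hu /asboolP Hv|u v /asboolP Hu /asboolP Hv].
- apply/asboolP; rewrite -(rmorph1 (rproj leavitt_rel)) -(rmorph1 (tring_of_ring _)).
  exact: homog_ring.
- exact/asboolP/homogB.
- by apply/asboolP; rewrite -[0]addr0; apply: homogM.
Qed.
HB.instance Definition _ :=
  GRing.isSubringClosed.Build leavitt leavitt0_pred leavitt0_subring_closed.

Record leavitt0 : predArgType :=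
  Leavitt0 { leavitt0_val : leavitt; _ : leavitt0_val \in leavitt0_pred }.
HB.instance Definition _ := [isSub for leavitt0_val].
HB.instance Definition _ := [Choice of leavitt0 by <:].
HB.instance Definition _ :=
  GRing.SubChoice_isSubPzRing.Build leavitt leavitt0_pred leavitt0
    leavitt0_subring_closed.

End Leavitt.

(* The subring of L with carrier S is the subtype E.  The modules L (as an
   E-L-bimodule) and L/E (as an E-E-bimodule) are attached to types that
   mention E, since the module structures depend on E. *)
Definition res_scalars (L : pzRingType) (S : {pred L}) (E : subPzRingType S)
  : Type := L.

Definition sub_rel (L : pzRingType) (S : {pred L}) (E : subPzRingType S)
  (a b : L) : Prop := a - b \in S.

Definition Lbar (L : pzRingType) (S : {pred L}) (E : subPzRingType S) : Type :=
  zquot (sub_rel E).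

Section Omega.
Variables (L : pzRingType) (S : {pred L}) (E : subPzRingType S).

Let valD : {morph (\val : E -> L) : a b / a + b} := raddfD _.
Let valM : {morph (\val : E -> L) : a b / a * b} := rmorphM _.
Let val_1 : (\val : E -> L) 1 = 1 := rmorph1 _.

Local Notation res_scalars := (res_scalars E).
Local Notation sub_rel := (sub_rel E).
Local Notation Lbar := (Lbar E).

HB.instance Definition _ := GRing.Zmodule.on res_scalars.

Definition res_scale (e : E) (x : res_scalars) : res_scalars := \val e * (x : L).

Fact res_scaleA d e x : res_scale d (res_scale e x) = res_scale (d * e) x.
Proof. by rewrite /res_scale valM mulrA. Qed.
Fact res_scale1 : left_id 1 res_scale.
Proof. by move=> x; rewrite /res_scale val_1 mul1r. Qed.
Fact res_scaleDr : right_distributive res_scale +%R.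
Proof. by move=> e x y; apply: mulrDr. Qed.
Fact res_scaleDl x d e : res_scale (d + e) x = res_scale d x + res_scale e x.
Proof. by rewrite /res_scale valD mulrDl. Qed.
HB.instance Definition _ := GRing.Zmodule_isLmodule.Build E res_scalars
  res_scaleA res_scale1 res_scaleDr res_scaleDl.

Definition res_rscale (x : res_scalars) (b : L) : res_scalars := (x : L) * b.
Fact res_rscaleA x a b : res_rscale (res_rscale x a) b = res_rscale x (a * b).
Proof. by rewrite /res_rscale mulrA. Qed.
Fact res_rscale1 x : res_rscale x 1 = x.
Proof. exact: mulr1. Qed.
Fact res_rscaleDl a x y : res_rscale (x + y) a = res_rscale x a + res_rscale y a.
Proof. exact: mulrDl. Qed.
Fact res_rscaleDr x a b : res_rscale x (a + b) = res_rscale x a + res_rscale x b.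
Proof. exact: mulrDr. Qed.
HB.instance Definition _ := Zmodule_isRmodule.Build L res_scalars
  res_rscaleA res_rscale1 res_rscaleDl res_rscaleDr.

Fact res_scalerAr (e : E) (x : res_scalars) (b : L) :
  e *: (x :* b : res_scalars) = (e *: x) :* b.
Proof. exact: mulrA. Qed.
HB.instance Definition _ := LRmodule_isBimodule.Build E L res_scalars res_scalerAr.

HB.instance Definition _ := GRing.Zmodule.on Lbar.
Definition bar (a : L) : Lbar := zproj sub_rel a.
HB.instance Definition _ := GRing.isZmodMorphism.Build L Lbar bar
  (@zproj_is_zmod_morphism _ sub_rel).

Let barD : {morph bar : a b / a + b} := raddfD _.
Let barB : {morph bar : a b / a - b} := raddfB _.

Lemma bar_surj (u : Lbar) : exists a, bar a = u.
Proof. exact: zproj_surj. Qed.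

Lemma bar_val (e : E) : bar (\val e) = 0.
Proof.
by rewrite -(raddf0 bar); apply: zproj_rel; rewrite /sub_rel subr0; apply: valP.
Qed.

(* A map out of L/E is given by an additive map killing E. *)
Let blift_rel (G : zmodType) (f : L -> G) :
  zmod_morphism f -> (forall e : E, f (\val e) = 0) ->
  forall a b, sub_rel a b -> f a = f b.
Proof.
move=> fB fE a b Sab; apply/eqP; rewrite -subr_eq0 -fB.
by rewrite -(SubK E Sab) fE.
Qed.

Definition bar_scale (e : E) : Lbar -> Lbar := zlift (fun a => bar (\val e * a)).
Definition bar_rscale (u : Lbar) (e : E) : Lbar := zlift (fun a => bar (a * \val e)) u.

Fact bar_scaleB (e : E) : zmod_morphism (fun a => bar (\val e * a)).
Proof. by move=> a b; rewrite mulrBr barB. Qed.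
Fact bar_rscaleB (e : E) : zmod_morphism (fun a => bar (a * \val e)).
Proof. by move=> a b; rewrite mulrBl barB. Qed.

Lemma bar_scale_bar (e : E) a : bar_scale e (bar a) = bar (\val e * a).
Proof.
apply: zlift_proj; first exact: bar_scaleB.
by apply: blift_rel => [|d]; [exact: bar_scaleB|rewrite -valM bar_val].
Qed.
Lemma bar_rscale_bar a (e : E) : bar_rscale (bar a) e = bar (a * \val e).
Proof.
apply: (zlift_proj (f := fun a => bar (a * \val e))); first exact: bar_rscaleB.
by apply: blift_rel => [|d]; [exact: bar_rscaleB|rewrite -valM bar_val].
Qed.

Let barE := (bar_scale_bar, bar_rscale_bar, valD, valM, val_1, mul1r, mulr1,
             mulrDl, mulrDr, mulrA, raddfD bar).

Fact bar_scaleA d e u : bar_scale d (bar_scale e u) = bar_scale (d * e) u.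
Proof. by have [a <-] := bar_surj u; rewrite !barE. Qed.
Fact bar_scale1 : left_id 1 bar_scale.
Proof. by move=> u; have [a <-] := bar_surj u; rewrite !barE. Qed.
Fact bar_scaleDr : right_distributive bar_scale +%R.
Proof.
move=> e u v; have [[a <-] [b <-]] := (bar_surj u, bar_surj v).
by rewrite -raddfD !barE.
Qed.
Fact bar_scaleDl u d e : bar_scale (d + e) u = bar_scale d u + bar_scale e u.
Proof. by have [a <-] := bar_surj u; rewrite !barE. Qed.
HB.instance Definition _ := GRing.Zmodule_isLmodule.Build E Lbar
  bar_scaleA bar_scale1 bar_scaleDr bar_scaleDl.

Fact bar_rscaleA u d e : bar_rscale (bar_rscale u d) e = bar_rscale u (d * e).
Proof. by have [a <-] := bar_surj u; rewrite !barE. Qed.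
Fact bar_rscale1 u : bar_rscale u 1 = u.
Proof. by have [a <-] := bar_surj u; rewrite !barE. Qed.
Fact bar_rscaleDl e u v : bar_rscale (u + v) e = bar_rscale u e + bar_rscale v e.
Proof.
have [[a <-] [b <-]] := (bar_surj u, bar_surj v).
by rewrite -raddfD !barE.
Qed.
Fact bar_rscaleDr u d e : bar_rscale u (d + e) = bar_rscale u d + bar_rscale u e.
Proof. by have [a <-] := bar_surj u; rewrite !barE. Qed.
HB.instance Definition _ := Zmodule_isRmodule.Build E Lbar
  bar_rscaleA bar_rscale1 bar_rscaleDl bar_rscaleDr.

Fact bar_scalerAr (d : E) (u : Lbar) (e : E) :
  d *: (u :* e : Lbar) = (d *: u) :* e.
Proof.
have [a <-] := bar_surj u; rewrite /GRing.scale /rscale /=.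
by rewrite !barE.
Qed.
HB.instance Definition _ := LRmodule_isBimodule.Build E E Lbar bar_scalerAr.

(* Omega_nc = L/E (x)_E L as an L-L-bimodule; see OmegaZ and Omega_rscale for
   the two actions. *)
Definition Omega : Type := tensor Lbar res_scalars.
HB.instance Definition _ := GRing.Zmodule.on Omega.

Definition omega (u : Lbar) (x : L) : Omega := tmul u (x : res_scalars).

Let omegaDl u v x : omega (u + v) x = omega u x + omega v x.
Proof. exact: tmulDl. Qed.
Let omegaDr u x y : omega u (x + y) = omega u x + omega u y.
Proof. exact: tmulDr. Qed.
Let omegaBl u v x : omega (u - v) x = omega u x - omega v x.
Proof. exact: tmulBl. Qed.
Let omegaBr u x y : omega u (x - y) = omega u x - omega u y.
Proof. exact: raddfB. Qed.
Let omegaA a (e : E) x : omega (bar (a * \val e)) x = omega (bar a) (\val e * x).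
Proof. by rewrite -bar_rscale_bar; apply: tmulA. Qed.

Let Omega_ext (G : zmodType) (f1 f2 : Omega -> G) :
  zmod_morphism f1 -> zmod_morphism f2 ->
  (forall a x, f1 (omega (bar a) x) = f2 (omega (bar a) x)) -> f1 =1 f2.
Proof.
move=> f1B f2B eqf; apply: tensor_ext => // u x.
by have [a <-] := bar_surj u; apply: eqf.
Qed.

Let subrACA (G : zmodType) (p p' q q' : G) :
  (p - p') - (q - q') = (p - q) - (p' - q').
Proof. by rewrite !opprD !opprK addrACA. Qed.

Let subrDACA (G : zmodType) (p p' q q' : G) :
  (p + p') - (q + q') = (p - q) + (p' - q').
Proof. by rewrite opprD addrACA. Qed.

Definition Omega_scale_gen (b : L) (u : Lbar) (x : L) : Omega :=
  zlift (fun a => omega (bar (b * a)) x - omega (bar b) (a * x)) u.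
Definition Omega_scale (b : L) : Omega -> Omega :=
  tlift (Omega_scale_gen b : Lbar -> res_scalars -> Omega).
Definition Omega_rscale (w : Omega) (b : L) : Omega :=
  tlift (fun (u : Lbar) (x : res_scalars) => omega u ((x : L) * b)) w.

Fact Omega_scale_genB b x :
  zmod_morphism (fun a => omega (bar (b * a)) x - omega (bar b) (a * x)).
Proof.
move=> a a'; rewrite mulrBr barB omegaBl mulrBl omegaBr.
exact: subrACA.
Qed.

Lemma Omega_scale_gen_bar b a x :
  Omega_scale_gen b (bar a) x = omega (bar (b * a)) x - omega (bar b) (a * x).
Proof.
apply: (zlift_proj (f := fun a => omega (bar (b * a)) x - omega (bar b) (a * x))).
  exact: Omega_scale_genB.
apply: blift_rel => [|e]; first exact: Omega_scale_genB.
by rewrite omegaA subrr.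
Qed.

Fact Omega_scale_balanced b :
  balanced (Omega_scale_gen b : Lbar -> res_scalars -> Omega).
Proof.
split=> [u v x|u x y|u e x].
- have [[a <-] [a' <-]] := (bar_surj u, bar_surj v).
  rewrite -raddfD !Omega_scale_gen_bar mulrDr mulrDl raddfD omegaDl omegaDr.
  by rewrite opprD addrACA.
- have [a <-] := bar_surj u.
  by rewrite !Omega_scale_gen_bar mulrDr !omegaDr opprD addrACA.
- have [a <-] := bar_surj u.
  have -> : (bar a :* e) = bar (a * \val e) by apply: bar_rscale_bar.
  by rewrite !Omega_scale_gen_bar mulrA omegaA mulrA.
Qed.

Fact Omega_rscale_balanced b :
  balanced (fun (u : Lbar) (x : res_scalars) => omega u ((x : L) * b)).
Proof.
split=> [u v x|u x y|u e x]; first exact: omegaDl.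
  by rewrite -omegaDr -mulrDl.
have [a <-] := bar_surj u.
have -> : (bar a :* e) = bar (a * \val e) by apply: bar_rscale_bar.
by rewrite omegaA mulrA.
Qed.

Fact Omega_scaleE b a x :
  Omega_scale b (omega (bar a) x) = omega (bar (b * a)) x - omega (bar b) (a * x).
Proof.
exact: etrans (tlift_tmul (Omega_scale_balanced b) _ _) (Omega_scale_gen_bar b a x).
Qed.
Fact Omega_rscaleE u x b : Omega_rscale (omega u x) b = omega u (x * b).
Proof. exact: (tlift_tmul (Omega_rscale_balanced b)). Qed.

Fact Omega_scaleB b : zmod_morphism (Omega_scale b).
Proof. by apply: tlift_is_zmod_morphism; exact: Omega_scale_balanced. Qed.
Fact Omega_rscaleB b : zmod_morphism (Omega_rscale^~ b).
Proof. by apply: tlift_is_zmod_morphism; exact: Omega_rscale_balanced. Qed.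
Let Omega_rscaler b w := Omega_rscale w b.
HB.instance Definition _ b :=
  GRing.isZmodMorphism.Build Omega Omega (Omega_scale b) (Omega_scaleB b).
HB.instance Definition _ b :=
  GRing.isZmodMorphism.Build Omega Omega (Omega_rscaler b) (Omega_rscaleB b).

Fact Omega_scaleA b c w : Omega_scale b (Omega_scale c w) = Omega_scale (b * c) w.
Proof.
apply: (@Omega_ext _ (Omega_scale b \o Omega_scale c) (Omega_scale (b * c))) w;
  [exact: raddfB|exact: raddfB|move=> a x /=].
rewrite (Omega_scaleE c) Omega_scaleB !Omega_scaleE !mulrA opprB addrA.
by rewrite subrK.
Qed.
Fact Omega_scale1 : left_id 1 Omega_scale.
Proof.
apply: Omega_ext; [exact: raddfB|by []|move=> a x].
rewrite Omega_scaleE mul1r -val_1 bar_val /omega tmul0l subr0 //.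
Qed.
Fact Omega_scaleDr : right_distributive Omega_scale +%R.
Proof. by move=> b v w; apply: raddfD. Qed.
Fact Omega_scaleDl w b c : Omega_scale (b + c) w = Omega_scale b w + Omega_scale c w.
Proof.
apply: (@Omega_ext _ (Omega_scale (b + c)) (Omega_scale b \+ Omega_scale c)) w;
  [exact: raddfB|exact: raddfB|move=> a x /=].
by rewrite !Omega_scaleE mulrDl !barD !omegaDl; exact: subrDACA.
Qed.
HB.instance Definition _ := GRing.Zmodule_isLmodule.Build L Omega
  Omega_scaleA Omega_scale1 Omega_scaleDr Omega_scaleDl.

Fact Omega_rscaleA w b c :
  Omega_rscale (Omega_rscale w b) c = Omega_rscale w (b * c).
Proof.
apply: (@Omega_ext _ (Omega_rscaler c \o Omega_rscaler b) (Omega_rscaler (b * c))) w;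
  [exact: raddfB|exact: raddfB|move=> a x /=].
by rewrite /Omega_rscaler (Omega_rscaleE (bar a) x b) !Omega_rscaleE mulrA.
Qed.
Fact Omega_rscale1 w : Omega_rscale w 1 = w.
Proof.
apply: (@Omega_ext _ (Omega_rscaler 1) id) w; [exact: raddfB|by []|move=> a x /=].
by rewrite /Omega_rscaler Omega_rscaleE mulr1.
Qed.
Fact Omega_rscaleDl b v w :
  Omega_rscale (v + w) b = Omega_rscale v b + Omega_rscale w b.
Proof. exact: (raddfD (Omega_rscaler b)). Qed.
Fact Omega_rscaleDr w b c :
  Omega_rscale w (b + c) = Omega_rscale w b + Omega_rscale w c.
Proof.
apply: (@Omega_ext _ (Omega_rscaler (b + c))
                     (Omega_rscaler b \+ Omega_rscaler c)) w;
  [exact: raddfB|exact: raddfB|move=> a x /=].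
by rewrite /Omega_rscaler !Omega_rscaleE mulrDr omegaDr.
Qed.
HB.instance Definition _ := Zmodule_isRmodule.Build L Omega
  Omega_rscaleA Omega_rscale1 Omega_rscaleDl Omega_rscaleDr.

Lemma OmegaZ b a x :
  b *: omega (bar a) x = omega (bar (b * a)) x - omega (bar b) (a * x).
Proof. exact: Omega_scaleE. Qed.

Lemma OmegaZr u x b : omega u x :* b = omega u (x * b).
Proof. exact: Omega_rscaleE. Qed.

Fact Omega_scalerAr (b : L) (w : Omega) (c : L) :
  b *: (w :* c : Omega) = (b *: w) :* c.
Proof.
apply: (@Omega_ext _ (Omega_scale b \o Omega_rscaler c)
                     (Omega_rscaler c \o Omega_scale b)) w;
  [exact: raddfB|exact: raddfB|move=> a x /=].
by rewrite /Omega_rscaler Omega_rscaleE !Omega_scaleE Omega_rscaleB !Omega_rscaleE mulrA.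
Qed.
HB.instance Definition _ := LRmodule_isBimodule.Build L L Omega Omega_scalerAr.

End Omega.

(* Main.v *)
(* As E is semisimple, F X = Omega (x)_L X = L/E (x)_E X is an exact functor of
   the L-module X, and 0 -> F X -> L (x)_E X -> X -> 0 is exact with projective
   middle term; so X has projective dimension at most n iff F^n X is projective.

   In the Leavitt ring, right multiplication by an element of degree 0 induces an
   endomorphism of F^k L for all large k.  Elements of L that vanish in the
   Leavitt ring act as zero on F^n L for all large n, because the Leavitt ring
   acts from the right on the germs at infinity of sequences in prod_n F^n L
   (the relation c = 1 fails only at n = 0).

   If all F^n X are projective, then for an endomorphism h of F^k L the map
   F^n h has projective cokernel F^n (coker h), hence is von Neumann regular, and
   so is the element of degree 0 it comes from.

   Conversely, let g_1, ..., g_m generate the Jacobson radical J as a left ideal.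
   Regularity gives e in the left ideal of L_0 generated by the g_i with
   g_i e = g_i for all i, and the endomorphism induced by e exhibits F^n (L/J) as
   a retract of F^n L for some n.  Every L-module has a finite filtration with
   quotients killed by J, which are retracts of direct sums of copies of L/J; so
   F^n X is projective for every X with this same n. *)
Require Import Defs.
From HB Require Import structures.
From mathcomp Require Import all_boot all_algebra.
From mathcomp Require Import boolp finmap monalg zify.
From mathcomp Require classical_sets.

Set Implicit Arguments.
Unset Strict Implicit.
Unset Printing Implicit Defensive.

Import GRing.Theory.
Local Open Scope ring_scope.

(** * Submodules, quotients and projective modules *)

(** The degree 0 part of the Leavitt ring is, mathematically, the colimit of the rings [End(F^k L)]
    along [F]. Building that colimit would need a normal form for elements of a ring given by
    generators and relations, so two weaker facts replace it: every homogeneous element acts on long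
    words through some linear map ([representable]), and an endomorphism of [N k] all of whose words
    vanish is killed by a power of [F] ([lv_word_ker]). The second fact cannot be sharpened to
    injectivity of [L] into the Leavitt ring: if [Omega = 0], the Casimir element is an empty sum
    and the Leavitt ring is zero. This is why identities between endomorphisms are recovered only
    after a power of [F]. Semisimplicity of [E] enters through quasi-inverses of [E]-linear maps.
    Since [F] is defined on all [E]-linear maps, these splittings survive it, and exactness of [F]
    follows from identities between maps. *)

Lemma linear_exists (R : pzRingType) (U V : lmodType R) (f : U -> V) :
  linear f -> exists g : {linear U -> V}, g =1 f.
Proof.
move=> fL.
by exists (HB.pack_for {linear U -> V} f (GRing.isLinear.Build R U V *:%R f fL)).
Qed.

(** Prop-valued, so that kernels, images and ideals cut out by existential statements qualify as
    they stand; [submod_pred] passes to booleans classically when a module type is needed. *)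
Definition is_submod (R : pzRingType) (V : lmodType R) (N : V -> Prop) : Prop :=
  N 0 /\ forall a u v, N u -> N v -> N (a *: u + v).

Section SubmodTheory.
Variables (R : pzRingType) (V : lmodType R) (N : V -> Prop).
Hypothesis HN : is_submod N.

Lemma submod0 : N 0. Proof. by case: HN. Qed.
Lemma submodP a u v : N u -> N v -> N (a *: u + v).
Proof. by case: HN => _; apply. Qed.
Lemma submodZ a u : N u -> N (a *: u).
Proof. by move=> Nu; rewrite -[_ *: _]addr0; apply: submodP => //; apply: submod0. Qed.
Lemma submodD u v : N u -> N v -> N (u + v).
Proof. by move=> Nu Nv; rewrite -[u]scale1r; apply: submodP. Qed.
Lemma submodN u : N u -> N (- u).
Proof. by rewrite -scaleN1r; apply: submodZ. Qed.
Lemma submodB u v : N u -> N v -> N (u - v).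
Proof. by move=> Nu Nv; apply: submodD => //; apply: submodN. Qed.
Lemma submod_sum (I : Type) (r : seq I) (f : I -> V) :
  (forall i, N (f i)) -> N (\sum_(i <- r) f i).
Proof. by move=> Nf; elim/big_ind: _ => //; [exact: submod0|exact: submodD]. Qed.
End SubmodTheory.

Section Submodule.
Variables (R : pzRingType) (V : lmodType R) (N : V -> Prop).

Definition submod_pred : {pred V} := fun x => `[< N x >].

Record subm (HN : is_submod N) : predArgType :=
  Subm { subm_val : V; _ : subm_val \in submod_pred }.

Variable HN : is_submod N.
Fact submod_pred_closed : GRing.submod_closed submod_pred.
Proof.
split=> [|a u v /asboolP Nu /asboolP Nv]; apply/asboolP; first exact: submod0.
exact: submodP.
Qed.
HB.instance Definition _ := [isSub of subm HN for @subm_val HN].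
HB.instance Definition _ := [Choice of subm HN by <:].
HB.instance Definition _ :=
  GRing.SubChoice_isSubLmodule.Build R V submod_pred (subm HN) submod_pred_closed.

Definition subm_incl : {linear subm HN -> V} := val.

Lemma subm_inclP v : N v <-> exists x, subm_incl x = v.
Proof.
split=> [Nv|[x <-]]; last by apply/asboolP; exact: (valP x).
by exists (Sub v (introT (asboolP _) Nv)); exact: SubK.
Qed.
Lemma subm_incl_inj : injective subm_incl. Proof. exact: val_inj. Qed.
End Submodule.

Section QuotientModule.
Variables (R : pzRingType) (V : lmodType R) (N : V -> Prop).

Definition quot_rel (u v : V) := N (u - v).
(** [HN] is an argument of the type so that the module structure can be inferred from the type
    alone. *)
Definition quotm (HN : is_submod N) : Type := zquot quot_rel.

Variable HN : is_submod N.
Local Notation Q := (quotm HN).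
HB.instance Definition _ := GRing.Zmodule.on Q.

Let pr (v : V) : Q := zproj quot_rel v.
Let prB : zmod_morphism pr. Proof. exact: (raddfB (zproj quot_rel)). Qed.
Let prD : {morph pr : u v / u + v}. Proof. exact: (raddfD (zproj quot_rel)). Qed.
Definition quot_scale (a : R) : Q -> Q := zlift (fun v => pr (a *: v)).

Fact quot_scaleE a v : quot_scale a (pr v) = pr (a *: v).
Proof.
apply: zlift_proj => [u w|u w Nuw]; first by rewrite scalerBr prB.
apply: zproj_rel; rewrite /quot_rel -scalerBr; exact: submodZ.
Qed.
Let pr_surj (q : Q) : exists v, pr v = q. Proof. exact: zproj_surj. Qed.

Fact quot_scaleA a b q : quot_scale a (quot_scale b q) = quot_scale (a * b) q.
Proof. by have [v <-] := pr_surj q; rewrite !quot_scaleE scalerA. Qed.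
Fact quot_scale1 : left_id 1 quot_scale.
Proof. by move=> q; have [v <-] := pr_surj q; rewrite quot_scaleE scale1r. Qed.
Fact quot_scaleDr : right_distributive quot_scale +%R.
Proof.
move=> a p q; have [[u <-] [v <-]] := (pr_surj p, pr_surj q).
by rewrite -prD !quot_scaleE scalerDr prD.
Qed.
Fact quot_scaleDl q a b : quot_scale (a + b) q = quot_scale a q + quot_scale b q.
Proof. by have [v <-] := pr_surj q; rewrite !quot_scaleE scalerDl prD. Qed.
HB.instance Definition _ := GRing.Zmodule_isLmodule.Build R Q
  quot_scaleA quot_scale1 quot_scaleDr quot_scaleDl.

Definition quot_proj (v : V) : Q := zproj quot_rel v.
Fact quot_proj_linear : linear quot_proj.
Proof. by move=> a u v; rewrite [LHS]prD -quot_scaleE. Qed.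
HB.instance Definition _ := GRing.isLinear.Build R V Q *:%R quot_proj quot_proj_linear.

Lemma quot_proj_surj : surjective quot_proj. Proof. exact: zproj_surj. Qed.

Lemma quot_proj_eq0 v : quot_proj v = 0 <-> N v.
Proof.
split=> [e|Nv].
  have /zproj_eqP : zproj quot_rel v = zproj quot_rel 0 by rewrite [LHS]e raddf0.
  rewrite subr0; elim=> // [|u w _ Nu _ Nw]; [exact: submod0|exact: submodB].
by rewrite -[RHS](linear0 quot_proj); apply: zproj_rel; rewrite /quot_rel subr0.
Qed.
End QuotientModule.

Lemma ker_submod (R : pzRingType) (U V : lmodType R) (f : {linear U -> V}) :
  is_submod (fun x => f x = 0).
Proof. by split=> [|a u v fu fv]; rewrite ?linear0 // linearP fu fv scaler0 addr0. Qed.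

Lemma im_submod (R : pzRingType) (U V : lmodType R) (f : {linear U -> V}) :
  is_submod (fun y => exists x, f x = y).
Proof.
split=> [|a u v [x <-] [y <-]]; first by exists 0; rewrite linear0.
by exists (a *: x + y); rewrite linearP.
Qed.

Section Factorisation.
Variable R : pzRingType.
Implicit Types U V W P Q A B C : lmodType R.

Lemma factor_inj U V W (i : {linear U -> V}) (f : {linear W -> V}) :
  injective i -> (forall w, exists u, i u = f w) ->
  exists g : {linear W -> U}, forall w, i (g w) = f w.
Proof.
move=> inj_i fP; have [g gE] := choice fP.
have gL : linear g by move=> a u v; apply: inj_i; rewrite linearP !gE linearP.
by have [h hE] := linear_exists gL; exists h => w; rewrite hE gE.
Qed.

Lemma factor_surj U V W (p : {linear U -> V}) (f : {linear U -> W}) :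
  surjective p -> (forall u, p u = 0 -> f u = 0) ->
  exists g : {linear V -> W}, forall u, g (p u) = f u.
Proof.
move=> /choice [s sP] fP.
have eqf u u' : p u = p u' -> f u = f u'.
  move=> e; apply/eqP; rewrite -subr_eq0 -raddfB; apply/eqP/fP.
  by rewrite linearB e subrr.
have gL : linear (fun v => f (s v)).
  by move=> a u v; rewrite -linearP; apply: eqf; rewrite linearP !sP.
by have [h hE] := linear_exists gL; exists h => u; rewrite hE; apply: eqf; rewrite sP.
Qed.

Lemma projective_retract P Q (r : {linear Q -> P}) (i : {linear P -> Q}) :
  (forall x, r (i x) = x) -> projective Q -> projective P.
Proof.
move=> ri projQ U V g f gS; have [h hE] := projQ U V g (f \o r) gS.
by exists (h \o i) => x; rewrite /= hE /= ri.
Qed.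

Lemma projective_split U P (p : {linear U -> P}) :
  projective P -> surjective p -> exists s : {linear P -> U}, forall x, p (s x) = x.
Proof. by move=> projP pS; exact: (projP U P p idfun pS). Qed.

Lemma projective_free n : projective 'rV[R]_n.
Proof.
move=> U V g f gS; have [s sP] := choice gS.
pose h (x : 'rV[R]_n) := \sum_(j < n) x 0 j *: s (f (delta_mx 0 j)).
have hL : linear h.
  move=> a u v; rewrite /h scaler_sumr -big_split /=; apply: eq_bigr => j _.
  by rewrite !mxE scalerDl scalerA.
have [h' h'E] := linear_exists hL; exists h' => x.
rewrite h'E linear_sum {2}(row_sum_delta x) linear_sum; apply: eq_bigr => j _.
by rewrite !linearZ sP.
Qed.

Lemma projective_regular : projective R^o.
Proof.
move=> U V g f gS; have [s sP] := gS (f 1).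
have [h hE] := linear_exists (f := fun x : R^o => (x : R) *: s)
  (fun a u v => etrans (scalerDl _ _ _) (congr1 (+%R^~ _) (esym (scalerA _ _ _)))).
by exists h => x; rewrite hE linearZ sP -linearZ /= /GRing.scale /= mulr1.
Qed.

Lemma projective_prod P Q : projective P -> projective Q -> projective (P * Q)%type.
Proof.
move=> projP projQ U V g f gS.
have i1L : linear (fun x : P => (x, 0 : Q)).
  by move=> a u v; congr (_, _); rewrite /= scaler0 addr0.
have i2L : linear (fun y : Q => (0 : P, y)).
  by move=> a u v; congr (_, _); rewrite /= scaler0 addr0.
have [[i1 i1E] [i2 i2E]] := (linear_exists i1L, linear_exists i2L).
have [h1 h1E] := projP U V g (f \o i1) gS.
have [h2 h2E] := projQ U V g (f \o i2) gS.
have hL : linear (fun z : (P * Q)%type => h1 z.1 + h2 z.2).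
  by move=> a u v; rewrite /= !linearP scalerDr addrACA.
have [h hE] := linear_exists hL; exists h => -[x y].
rewrite hE linearD h1E h2E /= i1E i2E -linearD; congr (f _).
by congr (_, _); rewrite /= ?addr0 ?add0r.
Qed.

Definition short_exact A B C (i : A -> B) (p : B -> C) : Prop :=
  [/\ injective i, surjective p & forall b, p b = 0 <-> exists a, i a = b].

Lemma projective_ext A B C (i : {linear A -> B}) (p : {linear B -> C}) :
  short_exact i p -> projective A -> projective C -> projective B.
Proof.
move=> [inj_i pS kerp] projA projC.
have [s sE] := projective_split projC pS.
have [r rE] : exists r : {linear B -> A}, forall b, i (r b) = b - s (p b).
  apply: (factor_inj (f := (idfun \- (s \o p)) : {linear B -> B})) => // b.
  by apply/kerp; rewrite /= linearB /= sE subrr.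
have inL : linear (fun b => (r b, p b)) by move=> a u v; rewrite !linearP.
have outL : linear (fun z : (A * C)%type => i z.1 + s z.2).
  by move=> a u v; rewrite /= !linearP scalerDr addrACA.
have [[k kE] [q qE]] := (linear_exists inL, linear_exists outL).
apply: (@projective_retract _ _ q k) (projective_prod projA projC) => x.
by rewrite qE kE /= rE subrK.
Qed.

End Factorisation.

(** * Projective dimension by splicing short exact sequences *)

Section ProjDim.
Variable R : pzRingType.
Implicit Types X Q A : lmodType R.

Lemma rV0_eq0 (x : 'rV[R]_0) : x = 0. Proof. by apply/rowP => -[]. Qed.

Lemma proj_dim_le0 X : projective X -> proj_dim_le 0 X.
Proof.
move=> projX.
pose P i : lmodType R := if i is 0 then X else 'rV[R]_0.
pose d i : {linear P i.+1 -> P i} := \0.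
exists P, d, (idfun : {linear X -> X}); split.
- by case=> [|i] //=; apply: projective_free.
- by case=> [|i] // _ x; apply: rV0_eq0.
- by move=> x; exists x.
- by move=> x; split=> [e|[y <-]] //; exists 0; exact: esym e.
- by move=> i x; split=> // _; exists 0; rewrite [RHS]rV0_eq0.
Qed.

Lemma projective_of_proj_dim_le0 X : proj_dim_le 0 X -> projective X.
Proof.
move=> [P [d [e [projP P0 eS kere _]]]].
have inj_e : injective e.
  move=> x y exy; apply/eqP; rewrite -subr_eq0; apply/eqP.
  have /kere [z <-] : e (x - y) = 0 by rewrite linearB exy subrr.
  by rewrite (P0 1%N _ z) // linear0.
have [r rE] := factor_inj (f := idfun) inj_e eS.
exact: (@projective_retract _ _ _ e r) rE (projP 0).
Qed.

Lemma proj_dim_leS n A Q X (i : {linear A -> Q}) (p : {linear Q -> X}) :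
  short_exact i p -> projective Q -> proj_dim_le n A -> proj_dim_le n.+1 X.
Proof.
move=> [inj_i pS kerp] projQ [P [d [e [projP P0 eS kere kerd]]]].
pose P' j : lmodType R := if j is k.+1 then P k else Q.
pose d' j : {linear P' j.+1 -> P' j} :=
  match j return {linear P' j.+1 -> P' j} with 0 => i \o e | k.+1 => d k end.
exists P', d', p; split=> //.
- by case.
- by case=> [|j] //= lt x; apply: P0.
- move=> x; rewrite kerp; split=> [[a <-]|[y <-]]; last by exists (e y).
  by have [y <-] := eS a; exists y.
- case=> [|j] x; last exact: kerd.
  rewrite -kere; split=> /= [|->]; last by rewrite linear0.
  by rewrite -(linear0 i) => /inj_i.
Qed.

Lemma proj_dim_leS_inv n X : proj_dim_le n.+1 X ->
  exists (A Q : lmodType R) (i : {linear A -> Q}) (p : {linear Q -> X}),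
    [/\ short_exact i p, projective Q & proj_dim_le n A].
Proof.
move=> [P [d [e [projP P0 eS kere kerd]]]].
have HN := ker_submod e.
exists (subm HN), (P 0), (subm_incl HN), e; split=> //.
  by split=> // [|b]; [exact: subm_incl_inj|exact: (subm_inclP HN)].
have [e' e'E] : exists e' : {linear P 1 -> subm HN}, forall x, subm_incl HN (e' x) = d 0 x.
  apply: factor_inj; first exact: subm_incl_inj.
  by move=> w; apply/(subm_inclP HN)/kere; exists w.
exists (fun i => P i.+1), (fun i => d i.+1), e'; split=> //.
- by move=> i lt x; apply: P0.
- move=> v; have /kere [y dy] : e (subm_incl HN v) = 0.
    by apply/(subm_inclP HN); exists v.
  by exists y; apply: subm_incl_inj; rewrite e'E.
- move=> x; rewrite -kerd -e'E; split=> [->|]; first by rewrite linear0.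
  by rewrite -(linear0 (subm_incl HN)) => /subm_incl_inj.
Qed.

End ProjDim.

(** * Semisimple modules *)

Section Semisimple.
Variable R : pzRingType.
Implicit Types U V : lmodType R.

(* The submodule R u is zero or simple. *)
Definition simple_elt U (u : U) : Prop :=
  forall b : R, b *: u = 0 \/ exists c : R, c *: (b *: u) = u.

(** A plain sum instead of a direct one: it passes from the ring to every module over it, and it
    suffices for finding complements. *)
Definition sum_of_simples U : Prop := forall u : U,
  exists (n : nat) (s : 'I_n -> U), (forall i, simple_elt (s i)) /\ u = \sum_i s i.

(** Zorn gives [C] maximal among the submodules meeting [N] in zero. If a simple [u] were outside
    [C + N], then [R u] would meet [C + N] in zero, so [C + R u] would still meet [N] in zero. *)
Lemma complement_exists U (N : U -> Prop) : sum_of_simples U -> is_submod N ->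
  exists C, [/\ is_submod C, forall u, C u -> N u -> u = 0
    & forall u, exists v w, [/\ C v, N w & u = v + w]].
Proof.
move=> ssU HN.
(* [P] omits [0] from the closure conditions so that the union of the empty chain satisfies it;
   maximality then puts [0] into [C]. *)
pose P (C : classical_sets.set U) :=
  (forall a u v, C u -> C v -> C (a *: u + v)) /\ (forall u, C u -> N u -> u = 0).
have [|C [[CP CN] maxC]] := @classical_sets.Zorn_bigcup U P.
  move=> F FP Ftot; split=> [a u v [X FX Xu] [Y FY Yv]|u [X FX Xu]]; last first.
    by case: (FP _ FX) => _; apply.
  case: (Ftot _ _ FX FY) => [XY|YX].
    by exists Y => //; case: (FP _ FY) => + _; apply=> //; apply: XY.
  by exists X => //; case: (FP _ FX) => + _; apply=> //; apply: YX.
have C0 : C 0.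
  apply: contrapT => nC0; apply: (maxC (fun u => C u \/ u = 0)).
    by split=> [u Cu|/(_ 0)]; [left|move=> sub; apply/nC0/sub; right].
  split=> [a u v [Cu|->] [Cv|->]|u [Cu|->]//].
  - by left; apply: CP.
  - rewrite addr0; case: (EM (C (a *: u))); first by left.
    move=> nCau; left; exfalso; apply: nC0.
    by have := CP (-1) _ _ Cu Cu; rewrite scaleN1r addNr.
  - by rewrite scaler0 add0r; left.
  - by rewrite scaler0 add0r; right.
  - exact: CN.
have HC : is_submod C by [].
have simpleCN u : simple_elt u -> exists v w, [/\ C v, N w & u = v + w].
  move=> su; apply: contrapT => nCN.
  have key c b n : C c -> N n -> c + b *: u = n -> b *: u = 0.
    move=> Cc Nn e; case: (su b) => // -[d du]; exfalso; apply: nCN.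
    exists (d *: (- c)), (d *: n); split; [|exact: submodZ|].
      by apply: submodZ => //; apply: submodN.
    by rewrite -scalerDr -e addKr du.
  apply: (maxC (fun x => exists c b, C c /\ x = c + b *: u)).
    split=> [x Cx|/(_ u) sub]; first by exists x, 0; rewrite scale0r addr0.
    apply: nCN; exists u, 0; split; [|exact: submod0|by rewrite addr0].
    by apply: sub; exists 0, 1; rewrite scale1r add0r.
  split=> [a x y [c [b [Cc ->]]] [c' [b' [Cc' ->]]]|x [c [b [Cc xE]]] Nx].
    exists (a *: c + c'), (a * b + b'); split; first exact: CP.
    by rewrite scalerDr scalerDl scalerA addrACA.
  have bu0 := key _ _ _ Cc Nx (esym xE).
  by move: xE; rewrite bu0 addr0 => xE; apply: CN => //; rewrite xE.
exists C; split=> // u; have [n [s [ss ->]]] := ssU u.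
elim/big_ind: _ => [|x y [v [w [Cv Nw ->]]] [v' [w' [Cv' Nw' ->]]]|i _].
- by exists 0, 0; rewrite addr0; split=> //; apply: submod0.
- by exists (v + v'), (w + w'); rewrite addrACA; split=> //; apply: submodD.
- exact: simpleCN.
Qed.

(* Linear maps between semisimple modules are von Neumann regular, so
   injections and surjections split. *)
Lemma quasi_inverse U V (g : {linear U -> V}) :
  sum_of_simples U -> sum_of_simples V ->
  exists s : {linear V -> U}, forall u, g (s (g u)) = g u.
Proof.
move=> ssU ssV.
have HK := ker_submod g.
have HI := im_submod g.
have [C [HC CK UC]] := complement_exists ssU HK.
have [D [HD DI VD]] := complement_exists ssV HI.
(* The quasi-inverse sends [v] to the unique [u] in the complement [C] of the kernel such that
   [v - g u] lies in the complement [D] of the image. *)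
have sP v : exists u, C u /\ D (v - g u).
  have [d [w [Dd [u <-] ->]]] := VD v; have [c [k [Cc gk0 ->]]] := UC u.
  by exists c; rewrite linearD gk0 addr0 addrK.
have s_uniq v u u' : C u -> C u' -> D (v - g u) -> D (v - g u') -> u = u'.
  move=> Cu Cu' Du Du'; apply/eqP; rewrite -subr_eq0; apply/eqP.
  apply: CK; first exact: submodB.
  apply: DI; last by exists (u - u').
  have -> : g (u - u') = (v - g u') - (v - g u).
    by rewrite linearB opprB [RHS]addrC addrA subrK.
  exact: submodB.
have [s sE] := choice sP.
have sL : linear s.
  move=> a v w; have [[Cv Dv] [Cw Dw]] := (sE v, sE w).
  apply: (s_uniq (a *: v + w)); [by case: (sE (a *: v + w))|exact: submodP| |].
    by case: (sE (a *: v + w)).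
  by rewrite linearP opprD addrACA -scalerBr; apply: submodP.
have [s' s'E] := linear_exists sL; exists s' => u; rewrite s'E.
apply/eqP; rewrite eq_sym -subr_eq0; apply/eqP/DI; first by case: (sE (g u)).
by exists (u - s (g u)); rewrite linearB.
Qed.

End Semisimple.

(** Write [1] as a sum of elements [f i] of simple left ideals; then [u] is the sum of the
    [f i *: u], and the map from the simple ideal onto the multiples of [f i *: u] makes each of
    these simple or zero. *)
Lemma semisimple_sum_of_simples (R : pzRingType) (U : lmodType R) :
  semisimple_ring R -> sum_of_simples U.
Proof.
move=> [I [S [simpS sumS _]]] u.
have [r [f [fS f1]]] := sumS (1 : R).
exists (size r), (fun k => (f (tnth (in_tuple r) k) : R) *: u); split; last first.
  rewrite -scaler_suml -(big_tuple _ _ (in_tuple r) xpredT (fun i => f i)) -f1.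
  by rewrite scale1r.
move=> k b; move: (tnth _ k) => i {k}.
have [Scl _ Smin] := simpS i.
pose T : {pred R^o} := fun x => `[< exists c : R, x = c * (b * f i) >].
have Tcl : GRing.submod_closed T.
  split=> [|a x y /asboolP [c ->] /asboolP [c' ->]]; apply/asboolP.
    by exists 0; rewrite mul0r.
  by exists (a * c + c'); rewrite mulrDl -mulrA.
have TS : {subset T <= S i}.
  move=> x /asboolP [c ->]; case: Scl => S0 SP.
  have := SP (c * b) _ _ (fS i) S0; rewrite addr0 /GRing.scale /= -mulrA; exact.
case: (Smin T Tcl TS) => [T0|ST].
  left; rewrite scalerA (_ : b * f i = 0) ?scale0r //; apply: T0.
  by apply/asboolP; exists 1; rewrite mul1r.
have /asboolP [c e] := ST _ (fS i).
by right; exists c; rewrite !scalerA -mulrA -e.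
Qed.

(** * Von Neumann regular rings *)

Section VonNeumann.
Variable S : pzRingType.

Definition mx_regular m n (A : 'M[S]_(m, n)) : Prop := exists X, A *m X *m A = A.

(** McCoy's trick: a quasi-inverse [Y] of the defect [A - A X A] corrects the approximate
    quasi-inverse [X]. It allows rows and columns to be cleared one at a time. *)
Lemma mx_regular_mccoy m n (A : 'M[S]_(m, n)) (X : 'M_(n, m)) :
  mx_regular (A - A *m X *m A) -> mx_regular A.
Proof.
move=> [Y e]; exists (X + (1%:M - X *m A) *m Y *m (1%:M - A *m X)).
have e1 : A *m (1%:M - X *m A) = A - A *m X *m A by rewrite mulmxBr mulmx1 mulmxA.
have e2 : (1%:M - A *m X) *m A = A - A *m X *m A by rewrite mulmxBl mul1mx.
rewrite mulmxDr mulmxDl; set U := 1%:M - X *m A in e1 *; set V := 1%:M - _ in e2 *.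
have -> : A *m (U *m Y *m V) *m A = (A *m U) *m Y *m (V *m A) by rewrite !mulmxA.
by rewrite e1 e2 e addrC subrK.
Qed.

Lemma mx_regular_col0 m n (A : 'M[S]_(m, n)) (c : 'M_(m, 1)) :
  c = 0 -> mx_regular A -> mx_regular (row_mx c A).
Proof.
move=> -> [X AX]; exists (col_mx (0 : 'M_(1, m)) X).
by rewrite mul_row_col mul0mx add0r mul_mx_row mulmx0 AX.
Qed.

Lemma mx_regular_row0 m n (A : 'M[S]_(m, n)) (c : 'M_(1, n)) :
  c = 0 -> mx_regular A -> mx_regular (col_mx c A).
Proof.
move=> -> [X AX]; exists (row_mx (0 : 'M_(n, 1)) X).
by rewrite -mulmxA mul_row_col mul0mx add0r mul_col_mx mul0mx mulmxA AX.
Qed.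

Hypothesis regS : forall a : S, exists x, a * x * a = a.

Lemma mx_regular_col m (A : 'M[S]_(m, 1)) : mx_regular A.
Proof.
elim: m A => [|m IHm] A; first by exists 0; rewrite mulmx0 mul0mx [RHS]flatmx0.
rewrite -[A](@vsubmxK _ 1 m); set a := usubmx _; set B := dsubmx _.
have [x ax] := regS (a 0 0); move: a B ax => a B ax.
apply: (@mx_regular_mccoy _ _ _ (row_mx x%:M 0)).
rewrite -mulmxA mul_row_col mul0mx addr0 mul_col_mx opp_col_mx add_col_mx.
apply: mx_regular_row0 => //; apply/matrixP => i j.
by rewrite !ord1 mul_scalar_mx !mxE big_ord1 mxE mulrA ax subrr.
Qed.

Lemma regular_mx m n (A : 'M[S]_(m, n)) : mx_regular A.
Proof.
elim: n A => [|n IHn] A; first by exists 0; rewrite mulmx0 mul0mx [RHS]thinmx0.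
rewrite -[A](@hsubmxK _ m 1 n); set c := lsubmx _; set B := rsubmx _.
have [y cy] := mx_regular_col c.
apply: (@mx_regular_mccoy _ _ _ (col_mx y 0)).
rewrite mul_row_col mulmx0 addr0 mul_mx_row opp_row_mx add_row_mx.
by apply: mx_regular_col0; rewrite ?cy ?subrr.
Qed.

(** If [D X D = D], then [v - v X D] vanishes on the row space of [D], so it factors through the
    cokernel [M] and gives a section of [p]. *)
Lemma regular_von_neumann : von_neumann_regular S.
Proof.
move=> M [m [n [d [p [pS kerp]]]]].
have [X DX] := regular_mx (lin1_mx d); set D := lin1_mx d in DX.
have fL : linear (fun v : 'rV[S]_n => v - v *m X *m D).
  move=> a u v; rewrite !mulmxDl -!scalemxAl scalerBr opprD.
  by rewrite addrACA.
have [f fE] := linear_exists fL.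
have [|s sE] := factor_surj (f := f) pS.
  move=> u /kerp [y <-]; rewrite fE -mul_rV_lin1 -/D.
  by rewrite -!mulmxA (mulmxA D) DX subrr.
apply: (projective_retract (r := p) (i := s)) => [x|]; last exact: projective_free.
have [v <-] := pS x; rewrite sE fE linearB (_ : p (v *m X *m D) = 0) ?subr0 //.
by apply/kerp; exists (v *m X); rewrite mul_rV_lin1.
Qed.

End VonNeumann.

(** The quotient of [S] by the left ideal of the [g j] is finitely presented, hence a direct summand
    of [S]. Subtracting from [1] the section of its class gives an element of the ideal; right
    multiplication by it fixes [g i] because [g i] dies in the quotient. *)
Lemma von_neumann_local_unit (S : pzRingType) m (g : 'I_m -> S) :
  von_neumann_regular S ->
  exists y : 'I_m -> S, forall i, g i * (\sum_j y j * g j) = g i.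
Proof.
move=> vnS.
have dL : linear (fun y : 'rV[S]_m => (\sum_j y 0 j * g j)%:M : 'rV[S]_1).
  move=> a u v; rewrite scale_scalar_mx -raddfD; congr (_%:M).
  rewrite mulr_sumr -big_split; apply: eq_bigr => j _.
  by rewrite !mxE mulrDl -mulrA.
have [d dE] := linear_exists dL.
have HN := im_submod d.
pose p : {linear 'rV[S]_1 -> quotm HN} := @quot_proj _ _ _ HN.
have [|s sE] := @projective_split _ _ _ p _ (@quot_proj_surj _ _ _ HN).
  apply: vnS; exists m, 1%N, d, p; split; first exact: quot_proj_surj.
  by move=> x; apply: quot_proj_eq0.
have /(quot_proj_eq0 HN) [y dy] : p (1%:M - s (p 1%:M)) = 0.
  by rewrite linearB sE subrr.
exists (y 0) => i.
have pg : p (g i)%:M = 0.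
  apply/(quot_proj_eq0 HN); exists (delta_mx 0 i); rewrite dE.
  rewrite (bigD1 i) //= big1 ?addr0 ?mxE ?eqxx ?mul1r // => j /negPf ne.
  by rewrite mxE ne andbF mul0r.
have : g i *: d y = g i *: 1%:M.
  by rewrite dy scalerBr -!linearZ /= scale_scalar_mx mulr1 pg linear0 subr0.
by rewrite dE !scale_scalar_mx mulr1 => /(congr1 (fun A : 'M[S]_1 => A 0 0)); rewrite !mxE !mulr1n.
Qed.

(** * The relative syzygy functor *)

Section ZmodMorphism.
Variables (U V : zmodType) (f : U -> V).
Hypothesis fB : zmod_morphism f.
Lemma zmod_morphism0 : f 0 = 0. Proof. by rewrite -(subrr 0) fB subrr. Qed.
Lemma zmod_morphismN x : f (- x) = - f x.
Proof. by rewrite -sub0r fB zmod_morphism0 sub0r. Qed.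
Lemma zmod_morphismD x y : f (x + y) = f x + f y.
Proof. by rewrite -[y in LHS]opprK fB zmod_morphismN opprK. Qed.
End ZmodMorphism.

(** Restriction of scalars. It is convertible to [X], so plain functions can be read over [L] or
    over [E], while the type records [E] for inference. *)
Definition restr (L : pzRingType) (S : {pred L}) (E : subPzRingType S)
  (X : lmodType L) : Type := X.

Section Restriction.
Variables (L : pzRingType) (S : {pred L}) (E : subPzRingType S) (X : lmodType L).
Local Notation Y := (restr E X).
HB.instance Definition _ := GRing.Zmodule.on Y.

Definition restr_scale (e : E) (x : Y) : Y := \val e *: (x : X).
Fact restr_scaleA d e x : restr_scale d (restr_scale e x) = restr_scale (d * e) x.
Proof. by rewrite /restr_scale rmorphM scalerA. Qed.
Fact restr_scale1 : left_id 1 restr_scale.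
Proof. by move=> x; rewrite /restr_scale rmorph1 scale1r. Qed.
Fact restr_scaleDr : right_distributive restr_scale +%R.
Proof. by move=> e x y; apply: scalerDr. Qed.
Fact restr_scaleDl x d e : restr_scale (d + e) x = restr_scale d x + restr_scale e x.
Proof. by rewrite /restr_scale raddfD scalerDl. Qed.
HB.instance Definition _ := GRing.Zmodule_isLmodule.Build E Y
  restr_scaleA restr_scale1 restr_scaleDr restr_scaleDl.
End Restriction.

(* The relative syzygy [L/E (x)_E X] of [X]; it is [Omega (x)_L X]. *)
Definition syz (L : pzRingType) (S : {pred L}) (E : subPzRingType S)
  (X : lmodType L) : Type := tensor (Lbar E) (restr E X).

Section Syzygy.
Variables (L : pzRingType) (S : {pred L}) (E : subPzRingType S).
Implicit Types X Y Z W : lmodType L.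
Local Notation F := (syz E).
Local Notation bar := (bar E).

HB.instance Definition _ X := GRing.Zmodule.on (F X).

(** The generator [bar a (x) x], indexed by [a] in [L] so that computations need no representatives
    of classes. *)
Definition stm X (a : L) (x : X) : F X := @tmul E (Lbar E) (restr E X) (bar a) x.

Lemma stmDl X a b (x : X) : stm (a + b) x = stm a x + stm b x.
Proof. by rewrite /stm raddfD; apply: tmulDl. Qed.
Lemma stmBl X a b (x : X) : stm (a - b) x = stm a x - stm b x.
Proof. by rewrite /stm raddfB; apply: tmulBl. Qed.
Lemma stmDr X a (x y : X) : stm a (x + y) = stm a x + stm a y.
Proof. exact: tmulDr. Qed.
Lemma stmBr X a (x y : X) : stm a (x - y) = stm a x - stm a y.
Proof. exact: (raddfB (@tmul E (Lbar E) (restr E X) (bar a))). Qed.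
Lemma stm0r X a : stm a (0 : X) = 0.
Proof. exact: (raddf0 (@tmul E (Lbar E) (restr E X) (bar a))). Qed.
Lemma stmA X a (e : E) (x : X) : stm (a * \val e) x = stm a (\val e *: x).
Proof.
have e1 : @rscale E (Lbar E) (bar a) e = bar (a * \val e) by exact: bar_rscale_bar.
by rewrite /stm -e1; apply: tmulA.
Qed.
Lemma stm_val X (e : E) (x : X) : stm (\val e) x = 0.
Proof. by rewrite /stm bar_val; apply: tmul0l. Qed.
Lemma stm1 X (x : X) : stm 1 x = 0.
Proof. by rewrite -(rmorph1 (\val : E -> L)) stm_val. Qed.

Lemma syz_ext X (G : zmodType) (f1 f2 : F X -> G) :
  zmod_morphism f1 -> zmod_morphism f2 ->
  (forall a x, f1 (stm a x) = f2 (stm a x)) -> f1 =1 f2.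
Proof.
move=> f1B f2B eqf; apply: tensor_ext => // u x.
by have [a <-] := bar_surj u; apply: eqf.
Qed.

(** A form of [syz_ext]: the projection modulo the subgroup [P] agrees with the zero map on
    generators. *)
Lemma syz_ind X (P : F X -> Prop) : P 0 -> (forall u v, P u -> P v -> P (u - v)) ->
  (forall a x, P (stm a x)) -> forall w, P w.
Proof.
move=> P0 PB Pstm w; pose r (u v : F X) := P (u - v).
have rP u : zspan r u -> P u by elim=> // x y _ Px _ Py; exact: PB.
rewrite -[w]subr0; apply/rP/zproj_eqP.
apply: (@syz_ext _ _ (zproj r) (fun _ => zproj r 0)) => [u v|u v|a x].
- exact: raddfB.
- by rewrite raddf0 subrr.
- by apply: zproj_rel; rewrite /r subr0.
Qed.

Definition syz_balanced X (G : zmodType) (f : L -> X -> G) : Prop :=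
  [/\ forall x, zmod_morphism (f ^~ x), forall a, zmod_morphism (f a),
      forall (e : E) x, f (\val e) x = 0
    & forall a (e : E) x, f (a * \val e) x = f a (\val e *: x)].

Lemma syz_lift X (G : zmodType) (f : L -> X -> G) : syz_balanced f ->
  exists h : F X -> G, zmod_morphism h /\ forall a x, h (stm a x) = f a x.
Proof.
move=> [fBl fBr fE fA].
pose f' (u : Lbar E) (x : restr E X) : G := zlift (f ^~ x) u.
have f'E a x : f' (bar a) x = f a x.
  apply: (zlift_proj (f := f ^~ x)) => [|b c bc]; first exact: fBl.
  by apply/eqP; rewrite -subr_eq0 -fBl -(SubK E bc) fE.
have f'P : balanced f'.
  split=> [u v x|u x y|u e x].
  - have [[a <-] [b <-]] := (bar_surj u, bar_surj v).
    by rewrite -raddfD !f'E (zmod_morphismD (fBl x)).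
  - by have [a <-] := bar_surj u; rewrite !f'E zmod_morphismD.
  - have [a <-] := bar_surj u.
    have -> : @rscale E (Lbar E) (bar a) e = bar (a * \val e) by exact: bar_rscale_bar.
    by rewrite !f'E fA.
exists (tlift f'); split; first exact: tlift_is_zmod_morphism.
by move=> a x; rewrite [LHS]tlift_tmul.
Qed.

(** Inside [L (x)_E X], the element [stm a x] is [a (x) x - 1 (x) a x]; the formula is what left
    multiplication by [b] does to this difference. *)
Fact syz_scale_exists X (b : L) : exists h : F X -> F X, zmod_morphism h /\
  forall a x, h (stm a x) = stm (b * a) x - stm b (a *: x).
Proof.
apply: syz_lift; split=> [x a c|a x y|e x|a e x].
- by rewrite mulrBr stmBl scalerBl stmBr !opprD !opprK addrACA.
- by rewrite scalerBr !stmBr !opprD !opprK addrACA.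
- by rewrite stmA subrr.
- by rewrite mulrA stmA scalerA.
Qed.
Definition syz_scale X (b : L) : F X -> F X := sval (cid (syz_scale_exists X b)).
Fact syz_scaleB X b : zmod_morphism (@syz_scale X b).
Proof. by rewrite /syz_scale; case: cid => h []. Qed.
Fact syz_scaleE X b a (x : X) :
  syz_scale b (stm a x) = stm (b * a) x - stm b (a *: x).
Proof. by rewrite /syz_scale; case: cid => h []. Qed.
HB.instance Definition _ X b :=
  GRing.isZmodMorphism.Build (F X) (F X) (@syz_scale X b) (@syz_scaleB X b).

Fact syz_scaleA X b c (w : F X) : syz_scale b (syz_scale c w) = syz_scale (b * c) w.
Proof.
apply: (@syz_ext X _ (@syz_scale X b \o @syz_scale X c) (@syz_scale X (b * c))) w;
  [exact: raddfB|exact: raddfB|move=> a x /=].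
by rewrite (syz_scaleE c) syz_scaleB !syz_scaleE !mulrA !scalerA opprB addrA subrK.
Qed.
Fact syz_scale1 X : left_id 1 (@syz_scale X).
Proof.
apply: syz_ext; [exact: raddfB|by []|move=> a x].
by rewrite syz_scaleE mul1r stm1 subr0.
Qed.
Fact syz_scaleDr X : right_distributive (@syz_scale X) +%R.
Proof. by move=> b v w; apply: raddfD. Qed.
Fact syz_scaleDl X (w : F X) b c : syz_scale (b + c) w = syz_scale b w + syz_scale c w.
Proof.
apply: (@syz_ext X _ (@syz_scale X (b + c)) (@syz_scale X b \+ @syz_scale X c)) w;
  [exact: raddfB|exact: raddfB|move=> a x /=].
by rewrite !syz_scaleE mulrDl !stmDl opprD addrACA.
Qed.
HB.instance Definition _ X := GRing.Zmodule_isLmodule.Build L (F X)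
  (@syz_scaleA X) (@syz_scale1 X) (@syz_scaleDr X) (@syz_scaleDl X).

Lemma stmZ X b a (x : X) : b *: stm a x = stm (b * a) x - stm b (a *: x).
Proof. exact: syz_scaleE. Qed.

(* [X * F X] is [L (x)_E X], with [(x, 0)] in the role of [1 (x) x]. *)
Definition ext (X : lmodType L) : Type := (X * F X)%type.
HB.instance Definition _ X := GRing.Zmodule.on (ext X).
Definition ext_scale X (b : L) (z : ext X) : ext X :=
  (b *: z.1, b *: z.2 + stm b z.1).
Fact ext_scaleA X a b (z : ext X) : ext_scale a (ext_scale b z) = ext_scale (a * b) z.
Proof.
case: z => x w; rewrite /ext_scale /= !scalerDr !scalerA stmZ; congr (_, _).
by rewrite -addrA subrK.
Qed.
Fact ext_scale1 X : left_id 1 (@ext_scale X).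
Proof. by case=> x w; rewrite /ext_scale /= !scale1r stm1 addr0. Qed.
Fact ext_scaleDr X : right_distributive (@ext_scale X) +%R.
Proof.
move=> b [x w] [y v]; rewrite /ext_scale /= !scalerDr stmDr.
by congr (_, _); rewrite /= addrACA.
Qed.
Fact ext_scaleDl X (z : ext X) b c : ext_scale (b + c) z = ext_scale b z + ext_scale c z.
Proof.
case: z => x w; rewrite /ext_scale /= !scalerDl stmDl.
by congr (_, _); rewrite /= addrACA.
Qed.
HB.instance Definition _ X := GRing.Zmodule_isLmodule.Build L (ext X)
  (@ext_scaleA X) (@ext_scale1 X) (@ext_scaleDr X) (@ext_scaleDl X).

Lemma ext_ses X : exists (i : {linear F X -> ext X}) (p : {linear ext X -> X}),
  short_exact i p.
Proof.
have iL : linear (fun w : F X => (0, w) : ext X).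
  move=> a u v; congr (_, _); first by rewrite /= scaler0 addr0.
  by rewrite /= stm0r addr0.
have pL : linear (fun z : ext X => z.1) by [].
have [[i iE] [p pE]] := (linear_exists iL, linear_exists pL).
exists i, p; split=> [u v|x|[x w]]; first by rewrite !iE => -[].
  by exists (x, 0); rewrite pE.
rewrite pE /=; split=> [->|[u]]; first by exists w; rewrite iE.
by rewrite iE => -[].
Qed.

Definition elinear X Y (f : X -> Y) : Prop :=
  zmod_morphism f /\ forall (e : E) x, f (\val e *: x) = \val e *: f x.

Lemma elinear_linear X Y (f : {linear X -> Y}) : elinear f.
Proof. by split=> [|e x]; [exact: linearB|exact: linearZ]. Qed.

Lemma elinearP X Y (f : X -> Y) :
  elinear f -> exists g : {linear restr E X -> restr E Y}, g =1 f.
Proof.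
move=> [fB fE]; apply: linear_exists => e x y.
by rewrite [LHS](zmod_morphismD fB); congr (_ + _); apply: fE.
Qed.

Lemma elinear_of X Y (g : {linear restr E X -> restr E Y}) : elinear (g : X -> Y).
Proof. by split=> [|e x]; [exact: (linearB g)|exact: (linearZ_LR g)]. Qed.

Hypothesis ssE : semisimple_ring E.

(** Linear maps out of [L (x)_E X] are the same as [E]-linear maps out of [X], and over the
    semisimple [E] these lift along surjections. *)
Lemma projective_ext_mod X : projective (ext X).
Proof.
move=> U V g f gS.
have ss Y : sum_of_simples (restr E Y) by apply: semisimple_sum_of_simples.
have [g' g'E] := elinearP (elinear_linear g).
have [s sE] := quasi_inverse g' (ss _) (ss _).
have inX : elinear (fun x : X => f (x, 0)).
  split=> [x y|e x]; first by rewrite -linearB; congr (f (_, _)); rewrite subr0.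
  rewrite -linearZ; congr (f (_, _)).
  by rewrite /= scaler0 add0r stm_val.
have [ph phE] := elinearP inX.
have [h0 [h0B h0E] gh0] : exists2 h0 : X -> U, elinear h0 & forall x, g (h0 x) = f (x, 0).
  exists (s \o ph); first exact: elinear_of.
  by move=> x; have [u gu] := gS (f (x, 0)); rewrite -g'E /= phE -gu -g'E sE.
(* As [stm a x] stands for [a (x) x - 1 (x) a x], its image is forced by [h0]. *)
have [|H [HB HE]] := @syz_lift X U (fun a x => a *: h0 x - h0 (a *: x)).
  split=> [x a b|a x y|e x|a e x].
  - by rewrite !scalerBl h0B !opprD !opprK addrACA.
  - by rewrite scalerBr !h0B scalerBr !opprD !opprK addrACA.
  - by rewrite h0E subrr.
  - by rewrite -scalerA -h0E !scalerA.
have HZ b w : H (b *: w) = b *: H w.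
  apply: (@syz_ext X _ (fun w => H (b *: w)) (fun w => b *: H w)) w => [u v|u v|a x].
  - by rewrite scalerBr HB.
  - by rewrite HB scalerBr.
  - rewrite stmZ HB !HE scalerBr !scalerA opprB addrA subrK //.
have hL : linear (fun z : ext X => h0 z.1 + H z.2).
  move=> b [x w] [y v] /=; rewrite !(zmod_morphismD HB) (zmod_morphismD h0B) HZ HE.
  rewrite scalerDr addrACA; congr (_ + _).
  by rewrite addrCA [X in _ + X]addrC subrK addrC.
have [h hE] := linear_exists hL; exists h => -[x w]; rewrite hE linearD gh0 /=.
have -> : g (H w) = f (0, w).
  apply: (@syz_ext X _ (g \o H) (fun w => f (0, w))) w => [u v|u v|a y] /=.
  - by rewrite HB linearB.
  - by rewrite -linearB; congr (f (_, _)); rewrite subr0.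
  - rewrite HE linearB linearZ !gh0 -linearZ -linearB; congr (f (_, _)).
      by rewrite /= subrr.
    by rewrite /= scaler0 add0r subr0.
by rewrite -linearD; congr (f (_, _)); rewrite ?addr0 ?add0r.
Qed.
End Syzygy.

(** * Functoriality and exactness of the relative syzygy *)

Section SyzygyFunctor.
Variables (L : pzRingType) (S : {pred L}) (E : subPzRingType S).
Implicit Types X Y Z W A B C : lmodType L.
Local Notation F := (syz E).
Local Notation elinear := (elinear E).
Local Notation stm := (stm E).

(* Only meaningful if [f] is [E]-linear. *)
Definition syz_map X Y (f : X -> Y) : F X -> F Y :=
  tlift (fun (u : Lbar E) (x : restr E X) => tmul u (f x : restr E Y)).

Lemma linear_elinear X Y (f : X -> Y) : linear f -> elinear f.
Proof.
move=> fL; have [g gE] := linear_exists fL.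
by have -> : f = g by [apply/funext => x; rewrite gE]; exact: elinear_linear.
Qed.

Fact syz_map_balanced X Y (f : X -> Y) : elinear f ->
  balanced (fun (u : Lbar E) (x : restr E X) => tmul u (f x : restr E Y)).
Proof.
move=> fE; have [g gE] := elinearP fE.
have {fE gE} -> : f = g by apply/funext => x; rewrite gE.
split=> [u v x|u x y|u e x]; first exact: tmulDl.
  by rewrite [g _](linearD g); apply: tmulDr.
by have -> : g (e *: x) = e *: g x by [exact: (linearZ_LR g)]; exact: tmulA.
Qed.

Lemma syz_mapE X Y (f : X -> Y) a x : elinear f -> syz_map f (stm a x) = stm a (f x).
Proof. by move=> /syz_map_balanced fb; rewrite /syz_map [LHS]tlift_tmul. Qed.

Lemma syz_mapB X Y (f : X -> Y) : elinear f -> zmod_morphism (syz_map f).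
Proof. by move=> fE; apply: tlift_is_zmod_morphism; apply: syz_map_balanced. Qed.

Lemma syz_map_linear X Y (f : X -> Y) : linear f -> linear (syz_map f).
Proof.
move=> fL; have fE := linear_elinear fL; have fB := syz_mapB fE.
move=> a u v; rewrite (zmod_morphismD fB); congr (_ + _).
apply: (@syz_ext _ _ E X _ (fun u => syz_map f (a *: u)) (fun u => a *: syz_map f u)) u.
- by move=> u w; rewrite scalerBr fB.
- by move=> u w; rewrite fB scalerBr.
- move=> b x; rewrite stmZ fB !syz_mapE // stmZ.
  by have [g gE] := linear_exists fL; rewrite -!gE linearZ.
Qed.

Lemma syz_map_id X w : syz_map (id : X -> X) w = w.
Proof.
apply: (@syz_ext _ _ E X _ (syz_map id) id) w => //; first exact/syz_mapB/linear_elinear.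
by move=> a x; rewrite syz_mapE //; exact/linear_elinear.
Qed.

Lemma syz_map_comp X Y Z (f : X -> Y) (g : Y -> Z) w : elinear f -> elinear g ->
  syz_map (g \o f) w = syz_map g (syz_map f w).
Proof.
move=> fE gE; have gfE : elinear (g \o f).
  by case: fE gE => [fB fZ] [gB gZ]; split=> [x y|e x] /=; rewrite ?fB ?gB ?fZ ?gZ.
apply: (@syz_ext _ _ E X _ (syz_map (g \o f)) (syz_map g \o syz_map f)) w.
- exact: syz_mapB.
- by move=> u v /=; rewrite !syz_mapB.
- by move=> a x /=; rewrite !syz_mapE.
Qed.

Lemma syz_map_sum (I : Type) (r : seq I) X Y (f : I -> X -> Y) w :
  (forall i, elinear (f i)) ->
  syz_map (fun x => \sum_(i <- r) f i x) w = \sum_(i <- r) syz_map (f i) w.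
Proof.
move=> fE; have sE : elinear (fun x => \sum_(i <- r) f i x).
  split=> [x y|e x]; first by rewrite -sumrB; apply: eq_bigr => i _; case: (fE i).
  by rewrite scaler_sumr; apply: eq_bigr => i _; case: (fE i).
apply: (@syz_ext _ _ E X _ _ (fun w => \sum_(i <- r) syz_map (f i) w)) w.
- exact: syz_mapB.
- by move=> u v; rewrite -sumrB; apply: eq_bigr => i _; rewrite syz_mapB.
- move=> a x; rewrite syz_mapE //.
  rewrite (big_morph (stm a) (@stmDr _ _ E Y a) (stm0r E Y a)).
  by apply: eq_bigr => i _; rewrite syz_mapE.
Qed.

Lemma syz_map0 X Y w : syz_map (fun _ : X => 0 : Y) w = 0.
Proof.
have -> : (fun _ : X => 0 : Y) = fun x => \sum_(i < 0) (fun=> 0 : Y) x.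
  by apply/funext => x; rewrite big_ord0.
by rewrite (@syz_map_sum _ _ X Y (fun _ _ => 0)) ?big_ord0 // => -[].
Qed.

Fixpoint isyz (n : nat) X : lmodType L := if n is k.+1 then F (isyz k X) else X.

Fixpoint isyz_map n X Y (f : X -> Y) : isyz n X -> isyz n Y :=
  if n is k.+1 return isyz n X -> isyz n Y then syz_map (@isyz_map k _ _ f) else f.
Arguments isyz_map n {X Y} f w.

(** An equality of modules; it is rewritten only in statements about a module as a whole, such as
    projectivity, so no elements are transported. *)
Lemma isyzS n X : isyz n (F X) = F (isyz n X).
Proof. by elim: n => //= n ->. Qed.

Lemma isyzD m n X : isyz m (isyz n X) = isyz (m + n) X.
Proof. by elim: m => //= m ->. Qed.

Lemma isyz_map_linear n X Y (f : X -> Y) : linear f -> linear (isyz_map n f).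
Proof. by move=> fL; elim: n => //= n IHn; apply: syz_map_linear. Qed.

Lemma isyz_map_id n X w : isyz_map n (id : X -> X) w = w.
Proof.
elim: n w => //= n IHn w; rewrite -[RHS]syz_map_id; congr (syz_map _ w).
exact/funext.
Qed.

Lemma isyz_map0 n X Y w : isyz_map n (fun _ : X => 0 : Y) w = 0.
Proof.
elim: n w => //= n IHn w; rewrite -[RHS](@syz_map0 (isyz n X) (isyz n Y) w).
by congr (syz_map _ w); apply/funext.
Qed.

Lemma isyz_map_comp n X Y Z (f : X -> Y) (g : Y -> Z) w : linear f -> linear g ->
  isyz_map n (g \o f) w = isyz_map n g (isyz_map n f w).
Proof.
move=> fL gL; elim: n w => //= n IHn w.
rewrite -syz_map_comp; try exact/linear_elinear/isyz_map_linear.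
by congr (syz_map _ w); apply/funext.
Qed.

Lemma isyz_map_sum n (I : Type) (r : seq I) X Y (f : I -> X -> Y) w :
  (forall i, linear (f i)) ->
  isyz_map n (fun x => \sum_(i <- r) f i x) w = \sum_(i <- r) isyz_map n (f i) w.
Proof.
move=> fL; elim: n w => //= n IHn w; rewrite -syz_map_sum.
  by congr (syz_map _ w); apply/funext.
by move=> i; exact/linear_elinear/isyz_map_linear.
Qed.

Lemma isyz_retract n X Y (r : {linear Y -> X}) (i : {linear X -> Y}) :
  (forall x, r (i x) = x) -> projective (isyz n Y) -> projective (isyz n X).
Proof.
move=> ri; have rL : linear r by exact: linearP.
have iL : linear i by exact: linearP.
have [r' r'E] := linear_exists (isyz_map_linear (n := n) rL).
have [i' i'E] := linear_exists (isyz_map_linear (n := n) iL).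
apply: (@projective_retract _ _ _ r' i') => x.
rewrite r'E i'E -isyz_map_comp // -[RHS]isyz_map_id; congr (isyz_map n _ x).
exact/funext.
Qed.

Hypothesis ssE : semisimple_ring E.

Lemma restr_quasi_inverse X Y (g : X -> Y) : elinear g ->
  exists2 s : Y -> X, elinear s & forall x, g (s (g x)) = g x.
Proof.
move=> gE; have ss Z : sum_of_simples (restr E Z) by apply: semisimple_sum_of_simples.
have [g' g'E] := elinearP gE; have [s sE] := quasi_inverse g' (ss _) (ss _).
by exists s => [|x]; [exact: elinear_of|rewrite -!g'E sE].
Qed.

Lemma elinear_comp X Y Z (f : X -> Y) (g : Y -> Z) :
  elinear f -> elinear g -> elinear (g \o f).
Proof.
by move=> [fB fZ] [gB gZ]; split=> [x y|e x] /=; rewrite ?fB ?gB ?fZ ?gZ.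
Qed.

Lemma syz_inj X Y (f : X -> Y) : elinear f -> injective f -> injective (syz_map f).
Proof.
move=> fE finj; have [s sE fs] := restr_quasi_inverse fE.
apply: (can_inj (g := syz_map s)) => w; rewrite -syz_map_comp // -[RHS]syz_map_id.
by congr (syz_map _ w); apply/funext => x; apply: finj; rewrite /= fs.
Qed.

Lemma syz_surj X Y (f : X -> Y) : elinear f -> surjective f -> surjective (syz_map f).
Proof.
move=> fE fS; have [s sE fs] := restr_quasi_inverse fE.
move=> w; exists (syz_map s w); rewrite -syz_map_comp // -[RHS]syz_map_id.
by congr (syz_map _ w); apply/funext => y; have [x <-] := fS y; rewrite /= fs.
Qed.

(** Quasi-inverses [s] of [g] and [t] of [f] give [b = f (t (b - s (g b))) + s (g b)] on [B]. This
    is an identity between [E]-linear maps, so the additive functor [F] preserves it. *)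
Lemma syz_exact A B C (f : A -> B) (g : B -> C) : elinear f -> elinear g ->
  (forall b, g b = 0 <-> exists a, f a = b) ->
  forall w, syz_map g w = 0 <-> exists v, syz_map f v = w.
Proof.
move=> fE gE kerg w; have [s sE gs] := restr_quasi_inverse gE.
have [t tE ft] := restr_quasi_inverse fE.
split=> [gw0|[v <-]].
- have [gB _] := gE; have [fB fZ] := fE; have [sB sZ] := sE; have [tB tZ] := tE.
  have uE : elinear (fun b => t (b - s (g b))).
    split=> [x y|e x]; first by rewrite -tB gB sB !opprD !opprK addrACA.
    by have [_ gZ] := gE; rewrite gZ sZ -scalerBr tZ.
  exists (syz_map (fun b => t (b - s (g b))) w).
  have split_id b : b = \sum_(k : bool) (if k then f (t (b - s (g b))) else s (g b)).
    rewrite big_bool /=; have [a fa] : exists a, f a = b - s (g b).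
      by apply/kerg; rewrite gB gs subrr.
    by rewrite -fa ft fa subrK.
  rewrite -syz_map_comp // -[RHS]syz_map_id.
  pose h (k : bool) b : B := if k then f (t (b - s (g b))) else s (g b).
  have -> : (id : B -> B) = fun b => \sum_(k : bool) h k b by exact/funext.
  rewrite syz_map_sum; last by case; [exact: (elinear_comp uE fE)|exact: (elinear_comp gE sE)].
  rewrite big_bool /= {2}/h (_ : syz_map (h false) w = 0) ?addr0 //.
  by rewrite [LHS](@syz_map_comp _ _ _ g s) // gw0 (zmod_morphism0 (syz_mapB sE)).
- rewrite -syz_map_comp // -[RHS](syz_map0 C v); congr (syz_map _ v).
  by apply/funext => a; apply/kerg; exists a.
Qed.

Lemma isyz_exact n A B C (f : A -> B) (g : B -> C) : linear f -> linear g ->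
  (forall b, g b = 0 <-> exists a, f a = b) ->
  forall w, isyz_map n g w = 0 <-> exists v, isyz_map n f v = w.
Proof.
move=> fL gL kerg; elim: n => //= n IHn w.
by apply: syz_exact => //; exact/linear_elinear/isyz_map_linear.
Qed.

Lemma isyz_surj n X Y (f : X -> Y) : linear f -> surjective f ->
  surjective (isyz_map n f).
Proof.
move=> fL fS; elim: n => //= n IHn.
by apply: syz_surj => //; exact/linear_elinear/isyz_map_linear.
Qed.

Lemma isyz_ses n A B C (i : {linear A -> B}) (p : {linear B -> C}) :
  short_exact i p ->
  exists (i' : {linear isyz n A -> isyz n B}) (p' : {linear isyz n B -> isyz n C}),
    short_exact i' p'.
Proof.
move=> [inj_i pS kerp].
have iL : linear i by exact: linearP.
have pL : linear p by exact: linearP.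
have [i' i'E] := linear_exists (isyz_map_linear (n := n) iL).
have [p' p'E] := linear_exists (isyz_map_linear (n := n) pL).
exists i', p'; split.
- have {i'E} -> : (i' : _ -> _) = isyz_map n i by exact/funext.
  elim: n {i' p' p'E} => //= n IHn.
  by apply: syz_inj => //; exact/linear_elinear/isyz_map_linear.
- by move=> y; have [x <-] := isyz_surj (n := n) pL pS y; exists x; rewrite p'E.
- move=> b; rewrite p'E (isyz_exact (n := n) iL pL kerp).
  by split=> -[a <-]; exists a; rewrite i'E.
Qed.

(* Schanuel: with lifts [h : ext Y -> B] and [g : B -> ext Y] of the two
   covers of [Y], the module [F Y] is a retract of [A * ext Y]. *)
Lemma syz_projective A B Y (i : {linear A -> B}) (q : {linear B -> Y}) :
  short_exact i q -> projective A -> projective B -> projective (F Y).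
Proof.
move=> [inj_i qS kerq] projA projB.
have [j [mu [inj_j muS kermu]]] := ext_ses E Y.
have projP : projective (ext E Y) by exact: projective_ext_mod.
have [h hE] := projB _ _ mu q muS.
have [g gE] := projP _ _ q mu qS.
have [r rE] : exists r : {linear F Y -> A}, forall z, i (r z) = g (j z).
  apply: (factor_inj (f := g \o j)) => // z; apply/kerq.
  by rewrite /= gE; apply/kermu; exists z.
(* Both [z.2 - h (g z.2)] and [h (i z.1)] die in [Y], so [out] lands in [F Y]; on [(r z, j z)] the
   correction terms cancel because [i (r z) = g (j z)]. *)
have outL : linear (fun z : (A * ext E Y)%type => z.2 - h (g z.2) + h (i z.1)).
  by move=> a u v; rewrite /= !linearP !scalerDr [X in X + _]addrACA [LHS]addrACA.
have [out outE] := linear_exists outL.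
have [k kE] : exists k : {linear (A * ext E Y)%type -> F Y}, forall z, j (k z) = out z.
  apply: factor_inj => // z; apply/kermu; rewrite outE linearD linearB !hE gE subrr add0r.
  by apply/kerq; exists z.1.
have inL : linear (fun z => (r z, j z)) by move=> a u v; rewrite !linearP.
have [n nE] := linear_exists inL.
apply: (@projective_retract _ _ _ k n) (projective_prod projA projP) => z.
by apply: inj_j; rewrite kE outE nE /= rE subrK.
Qed.

Lemma syz_projective1 Y : projective Y -> projective (F Y).
Proof.
move=> projY; pose i : {linear 'rV[L]_0 -> Y} := \0.
apply: (@syz_projective _ _ _ i idfun) projY => //; last exact: projective_free.
split=> [x y _|y|b]; first by rewrite (rV0_eq0 x) (rV0_eq0 y).
  by exists y.
by split=> [e|[a <-]//]; exists 0; rewrite linear0; exact: esym e.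
Qed.

Lemma isyz_projective n Y : projective Y -> projective (isyz n Y).
Proof. by move=> projY; elim: n => //= n IHn; apply: syz_projective1. Qed.

Lemma proj_dim_isyz n X : proj_dim_le n X <-> projective (isyz n X).
Proof.
elim: n X => [|n IHn] X.
  by split; [exact: projective_of_proj_dim_le0|exact: proj_dim_le0].
split=> [/proj_dim_leS_inv [A [Q [i [p [ses projQ /IHn projA]]]]]|projX] /=.
  (* In the sequence [F^n A -> F^n Q -> F^n X] the first two terms are projective, so one more
     syzygy of the third is projective. *)
  have [i' [p' ses']] := isyz_ses n ses.
  by apply: syz_projective ses' projA _; apply: isyz_projective.
have [i [p ses]] := ext_ses E X.
apply: (proj_dim_leS ses); first exact: projective_ext_mod.
by apply/IHn; rewrite isyzS.
Qed.

End SyzygyFunctor.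

Arguments syz_map {L S} E {X Y} f w.
Arguments isyz_map {L S} E n {X Y} f w.

(** * Direct sums *)

(** Finitely supported functions from [I] to [A], carried by the monoid algebra type. *)
Definition dsum (L : pzRingType) (I : choiceType) (A : lmodType L) : Type :=
  {malg A[I]}.

Section DirectSumModule.
Variables (L : pzRingType) (I : choiceType) (A : lmodType L).
Local Notation D := (dsum I A).
HB.instance Definition _ := GRing.Zmodule.on D.

Definition dsum_coef (i : I) (d : D) : A := mcoeff i (d : {malg A[I]}).
Definition dsum_scale (a : L) (d : D) : D :=
  [malg k in msupp (d : {malg A[I]}) => a *: dsum_coef k d].

Fact dsum_scaleE a d i : dsum_coef i (dsum_scale a d) = a *: dsum_coef i d.
Proof.
rewrite {1}/dsum_coef mcoeffE; case: ifPn => // /mcoeff_outdom.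
by rewrite /dsum_coef => ->; rewrite scaler0.
Qed.
Fact dsum_coefD i (d e : D) : dsum_coef i (d + e) = dsum_coef i d + dsum_coef i e.
Proof. exact: mcoeffD. Qed.
Fact dsum_eqP (d e : D) : (forall i, dsum_coef i d = dsum_coef i e) -> d = e.
Proof. by move=> /malgP. Qed.
Fact dsum_scaleA a b d : dsum_scale a (dsum_scale b d) = dsum_scale (a * b) d.
Proof. by apply: dsum_eqP => i; rewrite !dsum_scaleE scalerA. Qed.
Fact dsum_scale1 : left_id 1 dsum_scale.
Proof. by move=> d; apply: dsum_eqP => i; rewrite dsum_scaleE scale1r. Qed.
Fact dsum_scaleDr : right_distributive dsum_scale +%R.
Proof.
by move=> a d e; apply: dsum_eqP => i; rewrite !(dsum_scaleE, dsum_coefD) scalerDr.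
Qed.
Fact dsum_scaleDl d a b : dsum_scale (a + b) d = dsum_scale a d + dsum_scale b d.
Proof. by apply: dsum_eqP => i; rewrite !(dsum_scaleE, dsum_coefD) scalerDl. Qed.
HB.instance Definition _ := GRing.Zmodule_isLmodule.Build L D
  dsum_scaleA dsum_scale1 dsum_scaleDr dsum_scaleDl.

Definition dsum_in (i : I) (a : A) : D := << a *g i >>.

Lemma dsum_in_linear i : linear (dsum_in i).
Proof.
move=> a x y; apply: dsum_eqP => j; rewrite dsum_coefD dsum_scaleE /dsum_coef.
by rewrite !mcoeffU; case: eqP => //; rewrite !mulr0n scaler0 addr0.
Qed.
End DirectSumModule.

Section Coproduct.
Variables (L : pzRingType) (I : choiceType).
Implicit Types A Y W : lmodType L.

(** The universal property is asked of additive maps: for fixed [a] the map [x -> stm a x] is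
    additive but not [L]-linear, and it has to be factored for the property to pass through [syz].
    Linear factorisations follow by uniqueness. *)
Definition is_coproduct A Y (inj : I -> A -> Y) : Prop :=
  [/\ forall i, linear (inj i),
      forall (G : zmodType) (h : I -> A -> G), (forall i, zmod_morphism (h i)) ->
        exists2 H : Y -> G, zmod_morphism H & forall i a, H (inj i a) = h i a
    & forall (G : zmodType) (f g : Y -> G), zmod_morphism f -> zmod_morphism g ->
        (forall i a, f (inj i a) = g (inj i a)) -> f =1 g].

Lemma coproduct_lift A Y (inj : I -> A -> Y) W (h : I -> {linear A -> W}) :
  is_coproduct inj -> exists H : {linear Y -> W}, forall i a, H (inj i a) = h i a.
Proof.
move=> [injL lift uniq]; have [|H HB HE] := lift W (fun i => h i).
  by move=> i; exact: linearB.
have HL : linear H.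
  move=> a u v; rewrite (zmod_morphismD HB); congr (_ + _).
  apply: (uniq _ (fun u => H (a *: u)) (fun u => a *: H u)) => [x y|x y|i x].
  - by rewrite scalerBr HB.
  - by rewrite HB scalerBr.
  have -> : a *: inj i x = inj i (a *: x).
    by have [g gE] := linear_exists (injL i); rewrite -!gE linearZ.
  by rewrite !HE linearZ.
by have [g gE] := linear_exists HL; exists g => i a; rewrite gE.
Qed.

Lemma coproduct_projective A Y (inj : I -> A -> Y) :
  is_coproduct inj -> projective A -> projective Y.
Proof.
move=> cop projA U V g f gS; have [injL _ uniq] := cop.
have liftP i : exists h : {linear A -> U}, forall a, g (h a) = f (inj i a).
  have [j jE] := linear_exists (injL i).
  by have [h hE] := projA _ _ g (f \o j) gS; exists h => a; rewrite hE /= jE.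
have [h hE] := choice liftP.
have [H HE] := coproduct_lift h cop; exists H.
apply: (uniq _ (g \o H) f) => [x y|x y|i a] /=; try by rewrite !linearB.
by rewrite HE hE.
Qed.
End Coproduct.

Lemma dsum_coproduct (L : pzRingType) (I : choiceType) (A : lmodType L) :
  is_coproduct (@dsum_in L I A).
Proof.
split=> [|G h hB|G f g fB gB eqfg d]; first exact: dsum_in_linear.
  have h0 i : h i 0 = 0 by exact: zmod_morphism0.
  pose H (d : dsum I A) : G := \sum_(k <- msupp (d : {malg A[I]})) h k (dsum_coef k d).
  have HEw (s : {fset I}) d : fsubset (msupp (d : {malg A[I]})) s ->
      H d = \sum_(k <- s) h k (dsum_coef k d).
    move=> le; rewrite /H (big_fset_incl _ le) //= => k ks.
    by rewrite /dsum_coef => /mcoeff_outdom ->.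
  exists H => [d e|i a].
    pose s := fsetU (msupp (d - e : {malg A[I]}))
      (fsetU (msupp (d : {malg A[I]})) (msupp (e : {malg A[I]}))).
    rewrite !(HEw s).
    - by rewrite -sumrB; apply: eq_bigr => k _; rewrite [dsum_coef k (d - e)]mcoeffB hB.
    - by apply/fsubsetP => k kd; rewrite !in_fsetU kd !orbT.
    - by apply/fsubsetP => k kd; rewrite !in_fsetU kd !orbT.
    - by apply/fsubsetP => k kd; rewrite !in_fsetU kd.
  rewrite (HEw (fset1 i)); last exact: msuppU_le.
  by rewrite big_seq_fset1 /dsum_coef [mcoeff _ _]mcoeffUU.
have sum_f (F : dsum I A -> G) : zmod_morphism F ->
    F d = \sum_(k <- msupp (d : {malg A[I]})) F (dsum_in k (dsum_coef k d)).
  move=> FB; rewrite {1}[d]monalgE.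
  exact: (big_morph F (zmod_morphismD FB) (zmod_morphism0 FB)).
by rewrite !sum_f //; apply: eq_bigr => k _.
Qed.

Section SyzygyCoproduct.
Variables (L : pzRingType) (S : {pred L}) (E : subPzRingType S) (I : choiceType).
Implicit Types A Y W : lmodType L.

Lemma syz_coproduct A Y (inj : I -> A -> Y) : is_coproduct inj ->
  is_coproduct (fun i => syz_map E (inj i)).
Proof.
move=> [injL lift uniq]; split=> [i|G h hB|G f g fB gB eqfg].
- exact: syz_map_linear.
- have fibreP a : exists Ha : Y -> G, zmod_morphism Ha /\
      forall i x, Ha (inj i x) = h i (stm E a x).
    have [|Ha HaB HaE] := lift G (fun i x => h i (stm E a x)).
      by move=> i x y; rewrite stmBr hB.
    by exists Ha.
  have [H HP] := choice fibreP.
  have HB a : zmod_morphism (H a) by case: (HP a).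
  have HE a i x : H a (inj i x) = h i (stm E a x) by case: (HP a).
  have [|K [KB KE]] := @syz_lift _ _ E Y G H.
    split=> [y a b|a|e y|a e y]; last 1 first.
    + apply: (uniq _ (H (a * \val e)) (fun y => H a (\val e *: y))) => // [u v|i x].
        by rewrite scalerBr HB.
      have -> : \val e *: inj i x = inj i (\val e *: x).
        by have [g gE] := linear_exists (injL i); rewrite -!gE linearZ.
      by rewrite !HE stmA.
    + apply: (uniq _ (H (a - b)) (fun y => H a y - H b y)) => // [u v|i x].
        by rewrite !HB !opprD !opprK addrACA.
      by rewrite !HE stmBl hB.
    + exact: HB.
    + apply: (uniq _ (H (\val e)) (fun _ => 0)) => // [u v|i x]; first by rewrite subrr.
      by rewrite HE stm_val zmod_morphism0.
  exists K => // i w.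
  apply: (@syz_ext _ _ E A _ (fun w => K (syz_map E (inj i) w)) (h i)) w => //.
    by move=> u v; rewrite syz_mapB //; exact: linear_elinear.
  by move=> a x; rewrite syz_mapE ?KE ?HE //; exact: linear_elinear.
- apply: (@syz_ext _ _ E Y) => // a; apply: (uniq _ (f \o stm E a) (g \o stm E a)).
  + by move=> u v; rewrite /= stmBr fB.
  + by move=> u v; rewrite /= stmBr gB.
  move=> i x /=; rewrite -(@syz_mapE _ _ E _ _ (inj i)) ?eqfg //.
  exact: linear_elinear.
Qed.

Lemma isyz_coproduct n A Y (inj : I -> A -> Y) : is_coproduct inj ->
  is_coproduct (fun i => isyz_map E n (inj i)).
Proof. by move=> cop; elim: n => //= n IHn; apply: syz_coproduct. Qed.

End SyzygyCoproduct.

(** * Left ideals and the Jacobson radical *)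

Section Length.
Variables (R : pzRingType) (V : lmodType R).
Implicit Types (ws : seq V) (W : V -> Prop).

Fixpoint lspan ws (x : V) : Prop :=
  if ws is w :: ws' then exists a v, lspan ws' v /\ x = a *: w + v else x = 0.

Lemma lspan_submod ws : is_submod (lspan ws).
Proof.
elim: ws => [|w ws IHws]; split=> //=.
- by move=> a u v -> ->; rewrite scaler0 addr0.
- by exists 0, 0; split; [exact: submod0|rewrite scale0r addr0].
- move=> a u v [b [u' [Hu ->]]] [c [v' [Hv ->]]].
  exists (a * b + c), (a *: u' + v'); split; first exact: submodP.
  by rewrite scalerDr scalerDl scalerA addrACA.
Qed.

Lemma lspan_mem ws x : x \in ws -> lspan ws x.
Proof.
elim: ws => //= w ws IHws; rewrite in_cons => /orP[/eqP ->|/IHws Hx].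
  by exists 1, 0; split; [exact: submod0 (lspan_submod ws)|rewrite scale1r addr0].
by exists 0, x; rewrite scale0r add0r.
Qed.

(* Counts the layers of the filtration of [lspan ws] that [W] meets. *)
Fixpoint len ws W : nat :=
  if ws is w :: ws' then `[< exists v, lspan ws' v /\ W (w + v) >] + len ws' W else 0.

Lemma len_size ws W : (len ws W <= size ws)%N.
Proof. by elim: ws => //= w ws; case: asboolP => _; [rewrite ltnS|move/leqW]. Qed.

(** Nested submodules of equal length meet the same layers. In a layer met by both, subtracting an
    element of [W] pushes an element of [W'] into the next layer; in a layer met by neither,
    simplicity of [w] leaves it with no component there. *)
Lemma len_strict ws W W' : {in ws, forall w, simple_elt w} ->
  is_submod W -> is_submod W' -> (forall x, W x -> W' x) ->
  (len ws W' <= len ws W)%N -> forall x, lspan ws x -> W' x -> W x.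
Proof.
move=> + HW HW' sub; have mono us : (len us W <= len us W')%N.
  elim: us => //= u us IH; apply: leq_add => //.
  by case: asboolP => // -[v [Hv Wv]]; case: asboolP => // -[]; exists v; split=> //; apply: sub.
elim: ws => [_ _ x -> _|w ws IHws simp /=]; first exact: submod0.
have {}IHws : (len ws W' <= len ws W)%N -> forall x, lspan ws x -> W' x -> W x.
  by apply: IHws => u uws; apply: simp; rewrite in_cons uws orbT.
have Hspan := lspan_submod ws.
case: asboolP => [mW'|nmW']; case: asboolP => [[v' [Hv' Wv']]|nmW] le x [a [v [Hv ->]]] W'x.
- have W'd : W' (v - a *: v').
    have -> : v - a *: v' = (a *: w + v) - a *: (w + v').
      by rewrite scalerDr opprD addrACA subrr add0r.
    by apply: submodB => //; apply: submodZ => //; apply: sub.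
  have -> : a *: w + v = a *: (w + v') + (v - a *: v').
    by rewrite scalerDr -addrA [_ + (v - _)]addrC subrK.
  apply: submodP => //; apply: IHws => //; apply: submodB => //.
  exact: submodZ.
- by move: le; rewrite add0n add1n ltnNge mono.
- by exfalso; apply: nmW'; exists v'; split=> //; apply: sub.
- case: (simp w _ a) => [|aw0|[c caw]]; first by rewrite in_cons eqxx.
    by move: W'x; rewrite aw0 add0r => W'v; apply: IHws.
  exfalso; apply: nmW'; exists (c *: v); split; first exact: submodZ.
  by rewrite -{1}caw -scalerDr; apply: submodZ.
Qed.
End Length.

Section ChainConditions.
Variable L : pzRingType.
Local Notation ideal I := (@is_submod L L^o I).

Definition left_artinian : Prop := forall P : (L -> Prop) -> Prop,
  (forall I, P I -> ideal I) -> (exists I, P I) ->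
  exists2 I, P I & forall I', P I' -> (forall x, I' x -> I x) -> forall x, I x -> I' x.

Definition left_noetherian : Prop := forall P : (L -> Prop) -> Prop,
  (forall I, P I -> ideal I) -> (exists I, P I) ->
  exists2 I, P I & forall I', P I' -> (forall x, I x -> I' x) -> forall x, I' x -> I x.

Lemma nat_min (T : Type) (P : T -> Prop) (l : T -> nat) :
  (exists x, P x) -> exists2 x, P x & forall y, P y -> (l x <= l y)%N.
Proof.
move=> [x0 Px0].
have ex : exists n, `[< exists2 x, P x & l x = n >] by exists (l x0); apply/asboolP; exists x0.
case: (ex_minnP ex) => n /asboolP [x Px <-] minx; exists x => // y Py.
by apply: minx; apply/asboolP; exists y.
Qed.

Lemma chain_conditions (l : (L -> Prop) -> nat) (N : nat) :
  (forall I, (l I <= N)%N) ->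
  (forall I I', ideal I -> ideal I' -> (forall x, I x -> I' x) ->
     (l I' <= l I)%N -> forall x, I' x -> I x) ->
  left_artinian /\ left_noetherian.
Proof.
move=> lN strict; split=> P PI exP.
  have [I PI0 minI] := nat_min l exP; exists I => // I' PI' sub.
  by apply: strict => //; [exact: PI|exact: PI|exact: minI].
have [I PI0 minI] := nat_min (fun I => N - l I)%N exP; exists I => // I' PI' sub.
apply: strict => //; [exact: PI|exact: PI|].
by have := minI _ PI'; rewrite leq_sub2lE.
Qed.
End ChainConditions.

(** * The Jacobson radical of a left artinian ring *)

Section Radical.
Variable L : pzRingType.
Local Notation ideal I := (@is_submod L L^o I).
Implicit Types I m : L -> Prop.

(** Maximality in the form [m + L b = L] for every [b] outside [m]. *)
Definition left_maximal m : Prop :=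
  [/\ ideal m, ~ m 1 & forall b, ~ m b -> exists c, m (1 - c * b)].

(* The Jacobson radical; the factor [b] makes it visibly two-sided. *)
Definition jrad (a : L) : Prop := forall m, left_maximal m -> forall b, m (a * b).

Lemma idealM I a b : ideal I -> I b -> I (a * b).
Proof. by move=> HI; apply: (submodZ HI). Qed.

Lemma jrad_ideal : ideal jrad.
Proof.
split=> [m [HI _ _] b|a u v Ju Jv m Hm b]; first by rewrite mul0r; apply: (submod0 HI).
have [HI _ _] := Hm; rewrite mulrDl -mulrA.
by apply: (submodD HI); [apply: idealM => //; apply: Ju|apply: Jv].
Qed.

Lemma jradMr a b : jrad a -> jrad (a * b).
Proof. by move=> Ja m Hm c; rewrite -mulrA; apply: Ja. Qed.

Lemma jrad_sub m a : left_maximal m -> jrad a -> m a.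
Proof. by move=> Hm /(_ m Hm 1); rewrite mulr1. Qed.

(** If [x * d] is outside the maximal [m], the left ideal of all [a] with [a * d] in [m] is again
    maximal and misses [x]. So [jrad] is the intersection of the maximal left ideals in spite of the
    extra factor in its definition. *)
Lemma jrad_separate x : ~ jrad x -> exists2 m, left_maximal m & ~ m x.
Proof.
move=> nJ; apply: contrapT => nex; apply: nJ => m Hm d; apply: contrapT => nmxd.
have [HI _ mmax] := Hm; apply: nex; exists (fun a => m (a * d)) => //; split.
- split=> [|a u v mu mv]; first by rewrite mul0r; apply: (submod0 HI).
  by rewrite mulrDl -mulrA; apply: (submodP HI).
- by rewrite mul1r => md; apply: nmxd; apply: idealM.
- move=> b /mmax [c mc]; exists (d * c).
  have -> : (1 - d * c * b) * d = d * (1 - c * (b * d)).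
    by rewrite mulrBl mulrBr mul1r mulr1 !mulrA.
  exact: idealM.
Qed.

Hypothesis artL : left_artinian L.

Definition simple_mod_jrad (s : L) : Prop :=
  forall b, jrad (b * s) \/ exists c, jrad (c * (b * s) - s).

Definition socle_mod_jrad (x : L) : Prop := exists (n : nat) (s : 'I_n -> L),
  (forall i, simple_mod_jrad (s i)) /\ jrad (x - \sum_i s i).

Lemma simple_mod_jradM b s : simple_mod_jrad s -> simple_mod_jrad (b * s).
Proof.
move=> ss d; case: (ss (d * b)) => [H|[c H]]; first by left; rewrite mulrA.
right; exists (b * c); rewrite (_ : _ - _ = b * (c * (d * b * s) - s)).
  exact: idealM jrad_ideal H.
by rewrite mulrBr !mulrA.
Qed.

(** Take [I] minimal among the left ideals inside [K] and strictly above [J]. For [y] in [I] outside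
    [J], if [b y] is outside [J] then [J + L b y] is such an ideal too, so it contains [y]. *)
Lemma simple_mod_jrad_exists K : ideal K -> (forall x, jrad x -> K x) ->
  (exists2 x, K x & ~ jrad x) -> exists x, [/\ K x, ~ jrad x & simple_mod_jrad x].
Proof.
move=> HK JK [x Kx nJx].
pose P I := [/\ ideal I, forall x, jrad x -> I x, forall x, I x -> K x
  & exists2 x, I x & ~ jrad x].
have [|I [HI JI IK [y Iy nJy]] minI] :=
    artL (P := P) (fun I PI => let: And4 HI _ _ _ := PI in HI).
  by exists K; split=> //; exists x.
exists y; split=> // [|b]; first exact: IK.
case: (EM (jrad (b * y))) => nJ; [by left|right].
have HJ := jrad_ideal.
suff [c Jc] : exists c, jrad (y - c * (b * y)).
  by exists c; rewrite -opprB; apply: (submodN HJ).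
have sub z : (exists c, jrad (z - c * (b * y))) -> I z.
  move=> [c Jz]; rewrite -(subrK (c * (b * y)) z).
  by apply: (submodD HI); [exact: JI|do 2 apply: idealM => //].
apply: (minI (fun z => exists c, jrad (z - c * (b * y)))) Iy => //; split.
- split=> [|a u v [c Hc] [d Hd]].
    by exists 0; rewrite mul0r subrr; apply: (submod0 HJ).
  exists (a * c + d); rewrite mulrDl opprD addrACA -mulrA -mulrBr.
  exact: (submodP HJ).
- by move=> z Jz; exists 0; rewrite mul0r subr0.
- by move=> z /sub /IK.
- by exists (b * y) => //; exists 1; rewrite mul1r subrr; apply: (submod0 HJ).
Qed.

(* The complement of the socle of [L/J] is cut down by one maximal left ideal at
   a time. *)
Lemma one_socle_mod_jrad : socle_mod_jrad 1.
Proof.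
have HJ := jrad_ideal.
pose P K := [/\ ideal K, forall x, jrad x -> K x
  & exists k n (s : 'I_n -> L),
      [/\ K k, forall i, simple_mod_jrad (s i) & 1 = k + \sum_i s i]].
have [|K [HK JK [k [n [s [Kk ss e]]]]] minK] :=
    artL (P := P) (fun I PI => let: And3 HI _ _ := PI in HI).
  exists (fun _ => True); split=> //; exists 1, 0%N, (fun _ => 0); split=> //.
    by move=> i b; left; rewrite mulr0; apply: (submod0 HJ).
  by rewrite big_ord0 addr0.
have [KJ|/existsNP [z /not_implyP [Kz nJz]]] := EM (forall x, K x -> jrad x).
  by exists n, s; split=> //; rewrite e addrK; apply: KJ.
have [|x [Kx nJx sx]] := simple_mod_jrad_exists HK JK; first by exists z.
have [m Hm nmx] := jrad_separate nJx.
have [Hmi _ mmax] := Hm.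
have [c mc] := mmax _ nmx.
exfalso; apply: nmx; suff sub : forall u, K u -> K u /\ m u by case: (sub _ Kx).
apply: minK => [|u []//]; split.
- split=> [|a u v [Ku mu] [Kv mv]]; first by split; [exact: (submod0 HK)|exact: (submod0 Hmi)].
  by split; [exact: (submodP HK)|exact: (submodP Hmi)].
- by move=> u Ju; split; [exact: JK|exact: jrad_sub Ju].
(* Since [1 - c x] lies in [m], the new component [k (1 - c x)] lies in both [K] and [m]; the
   remainder [k c x] is simple or zero modulo [J] and joins the [s i] at index 0. *)
exists (k - k * c * x), n.+1, (fun i => oapp s (k * c * x) (unlift ord0 i)); split.
- split; first by apply: (submodB HK) => //; apply: idealM.
  rewrite (_ : _ - _ = k * (1 - c * x)); first exact: idealM.
  by rewrite mulrBr mulr1 mulrA.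
- by move=> i; case: unliftP => [j _|_] //=; apply: simple_mod_jradM.
rewrite big_ord_recl unlift_none /= addrA subrK e; congr (_ + _).
by apply: eq_bigr => i _; rewrite liftK.
Qed.

Lemma killed_sum_of_simples (U : lmodType L) :
  (forall a (u : U), jrad a -> a *: u = 0) -> sum_of_simples U.
Proof.
move=> JU u; have [n [s [ss J1]]] := one_socle_mod_jrad.
exists n, (fun i => s i *: u); split=> [i b|]; last first.
  rewrite -scaler_suml; apply/eqP; rewrite -subr_eq0 -{1}[u]scale1r -scalerBl.
  by rewrite JU.
case: (ss i b) => [H|[c H]]; [left|right; exists c]; first by rewrite scalerA JU.
by apply/eqP; rewrite !scalerA -subr_eq0 -scalerBl -mulrA JU.
Qed.

(** Choose [I'] minimal strictly above [I]. For [x] in [I'] outside [I], minimality makes the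
    annihilator of [x] modulo [I] a maximal left ideal, which contains [J]. *)
Lemma jrad_lower I : ideal I -> ~ I 1 -> exists I', [/\ ideal I',
  forall x, I x -> I' x, exists2 x, I' x & ~ I x
  & forall a x, jrad a -> I' x -> I (a * x)].
Proof.
move=> HI nI1.
pose P I' := [/\ ideal I', forall x, I x -> I' x & exists2 x, I' x & ~ I x].
have [|I' [HI' II' [y I'y nIy]] minI'] := artL (P := P) (fun I PI => let: And3 HI _ _ := PI in HI).
  by exists (fun _ => True); split=> //; exists 1.
exists I'; split=> //; first by exists y.
move=> a x Ja I'x; have [Ix|nIx] := EM (I x); first exact: idealM.
have key b : ~ I (b * x) -> exists c, I (x - c * (b * x)).
  move=> nIbx; apply: (minI' (fun z => exists c, I (z - c * (b * x)))) => //.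
  - split.
    + split=> [|d u v [c Hc] [c' Hc']].
        by exists 0; rewrite mul0r subrr; apply: (submod0 HI).
      exists (d * c + c'); rewrite mulrDl opprD addrACA -mulrA -mulrBr.
      exact: (submodP HI).
    + by move=> z Iz; exists 0; rewrite mul0r subr0.
    + by exists (b * x) => //; exists 1; rewrite mul1r subrr; apply: (submod0 HI).
  - move=> z [c Iz]; rewrite -(subrK (c * (b * x)) z).
    by apply: (submodD HI'); [exact: II'|do 2 apply: idealM => //].
have Hm : left_maximal (fun b => I (b * x)).
  split; last 2 first.
  - by rewrite mul1r.
  - by move=> b /key [c Hc]; exists c; rewrite mulrBl mul1r -mulrA.
  split=> [|b u v Iu Iv]; first by rewrite mul0r; apply: (submod0 HI).
  by rewrite mulrDl -mulrA; apply: (submodP HI).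
exact: (jrad_sub Hm Ja).
Qed.

End Radical.

(** * From [L/J] to all modules *)

Section LocalGlobal.
Variables (L : pzRingType) (S : {pred L}) (E : subPzRingType S).
Hypotheses (ssE : semisimple_ring E) (fgE : finitely_generated (res_scalars E)).
Local Notation ideal I := (@is_submod L L^o I).
Local Notation LE := (res_scalars E).

Lemma ideal_res (I : L -> Prop) : ideal I -> @is_submod E LE I.
Proof. by move=> HI; split=> [|e u v Iu Iv]; [exact: (submod0 HI)|exact: (submodP HI)]. Qed.

(** With [1] a sum of simple elements [s i] of [E], the products [s i *: g j] span [L] over [E] and
    are simple or zero. Counting layers bounds chains of [E]-submodules, in particular of left
    ideals. *)
Lemma chain_conditions_res : left_artinian L /\ left_noetherian L.
Proof.
have [n [g gP]] := fgE.
have [k [s [ss s1]]] := semisimple_sum_of_simples (U := E^o) ssE 1.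
pose ws : seq LE := [seq s p.1 *: g p.2 | p <- enum {: 'I_k * 'I_n}].
have simp : {in ws, forall w, simple_elt w}.
  move=> w /mapP [[i j] _ ->] /= e; case: (ss i e) => [H|[c H]].
    by left; have {}H : e * s i = 0 := H; rewrite scalerA H scale0r.
  by right; exists c; have {}H : c * (e * s i) = s i := H; rewrite !scalerA -mulrA H.
have Hws := lspan_submod ws.
have full x : lspan ws x.
  have [c ->] := gP x; apply: (submod_sum Hws) => j; apply: (submodZ Hws).
  rewrite -[g j]scale1r s1 scaler_suml; apply: (submod_sum Hws) => i.
  by apply: lspan_mem; apply/mapP; exists (i, j); rewrite ?mem_enum.
apply: (@chain_conditions _ (len ws) (size ws)) => [I|I I' HI HI' sub le x I'x].
  exact: len_size.
exact: (len_strict simp (ideal_res HI) (ideal_res HI') sub le).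
Qed.

Let artL : left_artinian L. Proof. by case: chain_conditions_res. Qed.
Let noethL : left_noetherian L. Proof. by case: chain_conditions_res. Qed.

(** An [E]-linear complement of [I] projects the generators of [L] over [E] to generators of [I]. *)
Lemma ideal_fg (I : L -> Prop) : ideal I -> exists (n : nat) (g : 'I_n -> L),
  (forall i, I (g i)) /\ forall x, I x -> exists c : 'I_n -> L, x = \sum_i c i * g i.
Proof.
move=> HI; have [n [g gP]] := fgE.
have [C [HC CI VC]] := complement_exists
  (semisimple_sum_of_simples (U := LE) ssE) (ideal_res HI).
have /choice [h hP] j : exists h : L, I h /\ C (g j - h).
  by have [v [w [Cv Iw ->]]] := VC (g j); exists w; rewrite addrK.
exists n, h; split=> [i|x Ix]; first by case: (hP i).
have [c xE] := gP x; exists (fun i => \val (c i)).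
apply/eqP; rewrite -subr_eq0; apply/eqP; apply: CI; last first.
  apply: (submodB HI) => //; apply: (submod_sum HI) => i.
  by apply: (idealM _ HI); case: (hP i).
rewrite xE -sumrB; apply: (submod_sum HC) => i.
have -> : c i *: g i - \val (c i) * h i = c i *: (g i - h i : LE).
  by rewrite scalerBr.
by apply: (submodZ HC); case: (hP i).
Qed.

Local Notation top := (quotm (jrad_ideal L)).

(** Every [u] is the image of [1] under a map from [L/J], so [U] is a quotient of copies of [L/J]
    indexed by [U] itself. Both modules are killed by [J], hence semisimple, so the quotient map
    splits; [F^n] preserves the direct sum and the retraction. *)
Lemma killed_projective n (U : lmodType L) :
  (forall a (u : U), jrad a -> a *: u = 0) ->
  projective (isyz E n top) -> projective (isyz E n U).
Proof.
move=> JU projB; pose D := dsum U top.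
have ptop (u : U) : exists h : {linear top -> U},
    forall a, h (quot_proj (jrad_ideal L) a) = (a : L) *: u.
  have fL : linear (fun a : L^o => (a : L) *: u).
    by move=> a b c; rewrite scalerDl -scalerA.
  have [f fE] := linear_exists fL.
  have [|h hE] := factor_surj (f := f) (@quot_proj_surj _ _ _ (jrad_ideal L)).
    by move=> a /quot_proj_eq0 Ja; rewrite fE JU.
  by exists h => a; rewrite hE fE.
have [h hE] := choice ptop.
have [H HE] := coproduct_lift h (@dsum_coproduct L U top).
have JD a (d : D) : jrad a -> a *: d = 0.
  move=> Ja; apply: dsum_eqP => i; rewrite [LHS]dsum_scaleE.
  have [b <-] := quot_proj_surj (HN := jrad_ideal L) (dsum_coef i d).
  rewrite -linearZ (_ : dsum_coef i 0 = 0); last exact: mcoeff0.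
  apply/quot_proj_eq0; exact: jradMr.
have [s sE] := quasi_inverse H (killed_sum_of_simples artL JD) (killed_sum_of_simples artL JU).
apply: (isyz_retract (r := H) (i := s)) => [u|].
  have <- : H (dsum_in u (quot_proj (jrad_ideal L) 1)) = u by rewrite HE hE scale1r.
  exact: sE.
apply: coproduct_projective projB; apply: isyz_coproduct; exact: dsum_coproduct.
Qed.

Section IdealAction.
Variables (I : L -> Prop) (U : lmodType L).

Inductive ideal_act : U -> Prop :=
| ideal_act0 : ideal_act 0
| ideal_actD a u v of I a & ideal_act v : ideal_act (a *: u + v).

Lemma ideal_act_submod : ideal I -> is_submod ideal_act.
Proof.
move=> HI; split=> [|a u v]; first exact: ideal_act0.
elim=> [|b w u' Ib _ IHu] Hv; first by rewrite scaler0 add0r.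
rewrite scalerDr scalerA -addrA; apply: ideal_actD; last exact: IHu.
exact: (idealM _ HI).
Qed.
End IdealAction.

Lemma ideal_act_sub (I I' : L -> Prop) (U : lmodType L) (u : U) :
  (forall x, I x -> I' x) -> ideal_act I u -> ideal_act I' u.
Proof.
by move=> sub; elim=> [|a w v Ia _ IH]; [exact: ideal_act0|exact: ideal_actD (sub _ Ia) IH].
Qed.

(* Climbs from [I = 0] to [I = L], keeping [F^n (I U)] projective for all [U]:
   there is [I'] above [I] with [J I'] inside [I], so [J] kills [I' U / I U]. *)
Lemma top_projective_global n : projective (isyz E n top) ->
  forall U : lmodType L, projective (isyz E n U).
Proof.
move=> projB.
pose P I := ideal I /\ forall (U : lmodType L) (HI : is_submod (@ideal_act I U)),
  projective (isyz E n (subm HI)).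
have [||I [HI projI] maxI] := noethL (P := P); first by move=> I [].
  exists (fun x => x = 0); split=> [|U HI].
    by split=> [|a u v -> ->] //; rewrite scaler0 addr0.
  have r0 (x : subm HI) : x = 0.
    apply: subm_incl_inj; rewrite linear0.
    have /(subm_inclP HI) : exists y, subm_incl HI y = subm_incl HI x by exists x.
    by elim=> // a u v -> _ ->; rewrite scale0r addr0.
  apply: (@isyz_retract _ _ _ n _ 'rV[L]_0 \0 \0) => [x|]; first by rewrite (r0 x).
  by apply: isyz_projective => //; apply: projective_free.
have I1 : I 1.
  apply: contrapT => nI1.
  have [I' [HI' sub [x I'x nIx] JI']] := jrad_lower artL HI nI1.
  apply/nIx/(maxI I') => //; split=> // U HA'.
  have HA : is_submod (@ideal_act I U) by exact: ideal_act_submod.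
  have [i iE] : exists i : {linear subm HA -> subm HA'},
      forall a, subm_incl HA' (i a) = subm_incl HA a.
    apply: factor_inj; first exact: subm_incl_inj.
    move=> a; apply/(subm_inclP HA')/(ideal_act_sub sub).
    by apply/(subm_inclP HA); exists a.
  have HN := im_submod i.
  pose p : {linear subm HA' -> quotm HN} := @quot_proj _ _ _ HN.
  have ses : short_exact i p.
    split=> [a b e||v]; last exact: quot_proj_eq0.
      by apply: (@subm_incl_inj _ _ _ HA); rewrite -!iE e.
    exact: quot_proj_surj.
  have [i' [p' ses']] := isyz_ses ssE n ses.
  apply: (projective_ext ses'); first exact: projI.
  apply: killed_projective => // a q Ja.
  have [v <-] := quot_proj_surj q; rewrite -linearZ.
  apply/(quot_proj_eq0 HN).
  have /(subm_inclP HA) [y yE] : ideal_act I (subm_incl HA' (a *: v)).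
    have /(subm_inclP HA') : exists y, subm_incl HA' y = subm_incl HA' v by exists v.
    rewrite linearZ_LR; elim=> [|b u w I'b _ IH]; first by rewrite scaler0; apply: ideal_act0.
    by rewrite scalerDr scalerA; apply: ideal_actD => //; apply: JI'.
  by exists y; apply: (@subm_incl_inj _ _ _ HA'); rewrite iE.
move=> U; have HA : is_submod (@ideal_act I U) by exact: ideal_act_submod.
have [r rE] : exists r : {linear U -> subm HA}, forall u, subm_incl HA (r u) = u.
  apply: (factor_inj (f := idfun)); first exact: subm_incl_inj.
  move=> u; apply/(subm_inclP HA); rewrite -[u]addr0 -[u]scale1r.
  by apply: ideal_actD => //; apply: ideal_act0.
by apply: (isyz_retract (r := subm_incl HA) (i := r)) => //; apply: projI.
Qed.

End LocalGlobal.

(** * The Leavitt ring *)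

Section LeavittGenerators.
Variables (R : pzRingType) (M : bimodType R R).
Local Notation N := (dual M * M)%type.
Local Notation LV := (leavitt M).
Local Notation pr := (rproj (@leavitt_rel R M)).

Definition lv_ring (a : R) : LV := pr (tring_of_ring N a).
Definition lv_mod (x : M) : LV := pr (tring_of_mod ((0 : dual M, x) : N)).
Definition lv_dual (f : dual M) : LV := pr (tring_of_mod ((f, 0 : M) : N)).

Lemma lv_ringB : zmod_morphism lv_ring.
Proof. by move=> a b; rewrite /lv_ring !raddfB. Qed.
Lemma lv_ringM a b : lv_ring (a * b) = lv_ring a * lv_ring b.
Proof. by rewrite /lv_ring !rmorphM. Qed.
Lemma lv_ring1 : lv_ring 1 = 1. Proof. by rewrite /lv_ring !rmorph1. Qed.

Lemma lv_modB : zmod_morphism lv_mod.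
Proof.
move=> x y; rewrite /lv_mod.
have -> : ((0, x - y) : N) = (0, x) - (0, y) by congr (_, _); rewrite /= subr0.
by rewrite (raddfB (@tring_of_mod R N)) raddfB.
Qed.
Lemma lv_modZ a x : lv_mod (a *: x) = lv_ring a * lv_mod x.
Proof.
rewrite /lv_mod; have -> : ((0, a *: x) : N) = a *: (0, x) by congr (_, _); rewrite /= scaler0.
by rewrite tring_of_modZ rmorphM.
Qed.
Lemma lv_modZr x a : lv_mod (x :* a) = lv_mod x * lv_ring a.
Proof.
rewrite /lv_mod; have -> : ((0, x :* a) : N) = (0, x) :* a by congr (_, _); rewrite /= rscale0l.
by rewrite tring_of_modZr rmorphM.
Qed.
Lemma lv_eval x f : lv_mod x * lv_dual f = lv_ring (f x).
Proof. by rewrite /lv_mod /lv_dual -rmorphM; exact: rproj_rel (leavitt_eval x f). Qed.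
Lemma lv_casimir n (a : 'I_n -> M) (a' : 'I_n -> dual M) : dual_basis a a' ->
  \sum_j lv_dual (a' j) * lv_mod (a j) = 1.
Proof.
move=> /leavitt_casimir /rproj_rel; rewrite rmorph1 rmorph_sum => <-.
by apply: eq_bigr => j _; rewrite -rmorphM.
Qed.

End LeavittGenerators.

(** * [Omega] as the syzygy of the regular module *)

Section OmegaSyzygy.
Variables (L : pzRingType) (S : {pred L}) (E : subPzRingType S).
Local Notation M := (Omega E).

Lemma omega_rscale a (e : E) x :
  omega (@rscale E (Lbar E) (bar E a) e) x = omega (bar E a) (\val e * x).
Proof. exact: tmulA. Qed.

(** [Omega E] and [syz E L^o] are one tensor product formed from two encodings of [L] as a left
    [E]-module, [res_scalars E] and [restr E L^o]; an explicit isomorphism keeps the encodings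
    apart. *)
Lemma Omega_of_syz_exists : exists k : {linear syz E L^o -> M},
  forall a b, k (stm E a (b : L^o)) = omega (bar E a) b.
Proof.
have [|k [kB kE]] := @syz_lift _ _ E L^o M (fun a b => omega (bar E a) b).
  split=> [x a b|a x y|e x|a e x].
  - by rewrite raddfB; apply: tmulBl.
  - exact: (raddfB (@tmul E (Lbar E) (res_scalars E) (bar E a))).
  - by rewrite bar_val; apply: tmul0l.
  - have <- : @rscale E (Lbar E) (bar E a) e = bar E (a * \val e) by exact: bar_rscale_bar.
    exact: omega_rscale.
have kL : linear k.
  move=> b u v; rewrite (zmod_morphismD kB); congr (_ + _).
  apply: (@syz_ext _ _ E L^o _ (fun u => k (b *: u)) (fun u => b *: k u)) u => [x y|x y|a x].
  - by rewrite scalerBr kB.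
  - by rewrite kB scalerBr.
  - by rewrite stmZ kB !kE OmegaZ.
by have [g gE] := linear_exists kL; exists g => a b; rewrite gE.
Qed.

Definition Omega_of_syz : {linear syz E L^o -> M} := sval (cid Omega_of_syz_exists).
Lemma Omega_of_syzE a b : Omega_of_syz (stm E a (b : L^o)) = omega (bar E a) b.
Proof. by rewrite /Omega_of_syz; case: cid. Qed.

Fact syz_of_Omega_exists : exists k : {linear M -> syz E L^o},
  cancel Omega_of_syz k /\ cancel k Omega_of_syz.
Proof.
pose f (u : Lbar E) (x : res_scalars E) : syz E L^o := @tmul E (Lbar E) (restr E L^o) u x.
have fP : balanced f.
  by split=> [u v x|u x y|u e x]; [exact: tmulDl|exact: tmulDr|exact: tmulA].
have kB := tlift_is_zmod_morphism fP.
have K1 : cancel Omega_of_syz (tlift f).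
  move=> w; apply: (@syz_ext _ _ E L^o _ (tlift f \o Omega_of_syz) id) w => // [u v|a x] /=.
    by rewrite linearB kB.
  by rewrite Omega_of_syzE; exact: tlift_tmul.
have K2 : cancel (tlift f) Omega_of_syz.
  move=> w; apply: (@tensor_ext E (Lbar E) (res_scalars E) _ (Omega_of_syz \o tlift f) id) w
    => // [u v|u x] /=; first by rewrite kB linearB.
  by rewrite tlift_tmul //; have [a <-] := bar_surj u; exact: Omega_of_syzE.
have kL : linear (tlift f : M -> syz E L^o).
  by move=> a u v; rewrite -[in LHS](K2 u) -[in LHS](K2 v) -linearP K1.
have [k kE] := linear_exists kL; exists k.
by split=> w; rewrite kE.
Qed.
Definition syz_of_Omega : {linear M -> syz E L^o} := sval (cid syz_of_Omega_exists).
Lemma Omega_of_syzK : cancel Omega_of_syz syz_of_Omega.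
Proof. by rewrite /syz_of_Omega; case: cid => k []. Qed.
Lemma syz_of_OmegaK : cancel syz_of_Omega Omega_of_syz.
Proof. by rewrite /syz_of_Omega; case: cid => k []. Qed.

Hypotheses (ssE : semisimple_ring E) (fgE : finitely_generated (res_scalars E)).

Lemma Omega_projective : projective M.
Proof.
apply: (projective_retract (r := Omega_of_syz) (i := syz_of_Omega)).
  exact: syz_of_OmegaK.
by apply: syz_projective1 => //; apply: projective_regular.
Qed.

(* [Omega] is spanned by the [d x = bar x (x) 1], and
   [bar a (x) x = d (a x) - a d x]. *)
Lemma Omega_dual_basis : exists (n : nat) (a : 'I_n -> M) (a' : 'I_n -> dual M),
  dual_basis a a'.
Proof.
have [n [g gP]] := fgE; exists n; pose a j : M := omega (bar E (g j : L)) 1; exists a.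
pose span (w : M) := exists c : 'I_n -> L, w = \sum_j c j *: a j.
have spanB u v : span u -> span v -> span (u - v).
  move=> [c ->] [d ->]; exists (fun j => c j - d j); rewrite -sumrB.
  by apply: eq_bigr => j _; rewrite scalerBl.
have spanZ b u : span u -> span (b *: u).
  move=> [c ->]; exists (fun j => b * c j); rewrite scaler_sumr.
  by apply: eq_bigr => j _; rewrite scalerA.
have span_d x : span (omega (bar E x) 1).
  have [c xE] := gP (x : res_scalars E); exists (fun j => \val (c j)).
  have aE (e : E) y : \val e *: omega (bar E y) 1 = omega (bar E (\val e * y)) 1.
    by rewrite OmegaZ bar_val [X in _ - X]tmul0l subr0.
  rewrite [in LHS]xE (big_morph (fun y : L => omega (bar E y) 1) (id1 := 0) (op1 := +%R)).
  - by apply: eq_bigr => j _; rewrite aE.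
  - by move=> y z; rewrite raddfD; apply: tmulDl.
  - by rewrite raddf0; apply: tmul0l.
have HN : is_submod span.
  split=> [|b u v Hu Hv]; first by exists (fun _ => 0); rewrite big1 // => j _; rewrite scale0r.
  by rewrite -[v]opprK; apply: spanB; [exact: spanZ|rewrite -scaleN1r; exact: spanZ].
have span_all w : span w.
  rewrite -[w]syz_of_OmegaK; apply/(quot_proj_eq0 HN).
  apply: (@syz_ext _ _ E L^o _ (@quot_proj _ _ _ HN \o Omega_of_syz) (fun _ => 0))
    => [u v|u v|b x] /=.
  - by rewrite !linearB.
  - by rewrite subrr.
  rewrite Omega_of_syzE; apply/(quot_proj_eq0 HN).
  have -> : omega (bar E b) x = omega (bar E (b * x)) 1 - b *: omega (bar E x) 1.
    by rewrite OmegaZ mulr1 opprB addrC subrK.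
  by apply: spanB; [exact: span_d|exact/spanZ/span_d].
have pL : linear (fun v : 'rV[L]_n => \sum_j v 0 j *: a j).
  move=> b u v; rewrite scaler_sumr -big_split; apply: eq_bigr => j _ /=.
  by rewrite !mxE scalerDl scalerA.
have [p pE] := linear_exists pL.
have [|s sE] := projective_split (p := p) Omega_projective.
  by move=> w; have [c ->] := span_all w; exists (\row_j c j); rewrite pE;
     apply: eq_bigr => j _; rewrite mxE.
have /choice [a' a'E] j : exists f : dual M, forall w, f w = s w 0 j.
  have fL : linear (fun w => s w 0 j : L^o) by move=> b u v; rewrite linearP !mxE.
  by have [f fE] := linear_exists fL; exists f.
have basis (x : M) : x = \sum_j a' j x *: a j.
  by rewrite -[LHS]sE pE; apply: eq_bigr => j _; rewrite a'E.
exists a'; split=> // f; apply: dualP => x; rewrite {1}(basis x).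
have -> : (\sum_j a' j :* f (a j) : dual M) x = \sum_j a' j x * f (a j).
  by rewrite (big_morph (fun g : dual M => g x) (id1 := 0) (op1 := +%R)).
rewrite [LHS](linear_sum (dual_linear f)); apply: eq_bigr => j _.
exact: (linearZ_LR (dual_linear f)).
Qed.
End OmegaSyzygy.

(** A projective cokernel makes the image of [h] a direct summand. The projection onto it lifts
    through [h] because [P] is projective, and the lift is a quasi-inverse. *)
Lemma linear_regular (R : pzRingType) (P C : lmodType R) (h : {linear P -> P})
    (p : {linear P -> C}) :
  projective P -> projective C -> surjective p ->
  (forall x, p x = 0 <-> exists y, h y = x) ->
  exists g : {linear P -> P}, forall x, h (g (h x)) = h x.
Proof.
move=> projP projC pS kerp; have [s sE] := projective_split projC pS.
have HN := im_submod h.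
have [h' h'E] : exists h' : {linear P -> subm HN}, forall x, subm_incl HN (h' x) = h x.
  apply: factor_inj; first exact: subm_incl_inj.
  by move=> x; apply/(subm_inclP HN); exists x.
have [e eE] : exists e : {linear P -> subm HN}, forall x, subm_incl HN (e x) = x - s (p x).
  apply: (factor_inj (f := idfun \- (s \o p))); first exact: subm_incl_inj.
  by move=> x; apply/(subm_inclP HN)/kerp; rewrite /= linearB sE subrr.
have h'S : surjective h'.
  move=> y; have /(subm_inclP HN) [x hx] : exists z, subm_incl HN z = subm_incl HN y by exists y.
  by exists x; apply: subm_incl_inj; rewrite h'E.
have [g gE] := projP _ _ h' e h'S; exists g => x.
rewrite -h'E gE eE (_ : p (h x) = 0) ?linear0 ?subr0 ?addr0 //.
by apply/kerp; exists x.
Qed.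

(** * Additive endomorphisms and iterated syzygies *)

Record aend (V : zmodType) : Type :=
  Aend { aend_fun :> V -> V; aendB : zmod_morphism aend_fun }.

(* Endomorphisms act on the right: [f * g] is [f] followed by [g]. *)
Section AdditiveEndomorphisms.
Variable V : zmodType.
Local Notation A := (aend V).
Implicit Types f g h : A.

Lemma aendP f g : f =1 g -> f = g.
Proof.
case: f g => f fB [g gB] /= /funext e; subst g; congr Aend; exact: Prop_irrelevance.
Qed.

HB.instance Definition _ := gen_eqMixin A.
HB.instance Definition _ := gen_choiceMixin A.

Fact aend0_proof : zmod_morphism (fun _ : V => 0 : V).
Proof. by move=> x y; rewrite subrr. Qed.
Fact aend_opp_proof f : zmod_morphism (fun x => - f x).
Proof. by move=> x y; rewrite aendB !opprD. Qed.
Fact aend_add_proof f g : zmod_morphism (fun x => f x + g x).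
Proof. by move=> x y; rewrite !aendB opprD addrACA. Qed.
Fact aend1_proof : zmod_morphism (fun x : V => x). Proof. by []. Qed.
Fact aend_mul_proof f g : zmod_morphism (fun x => g (f x)).
Proof. by move=> x y; rewrite !aendB. Qed.

Definition aend0 : A := Aend aend0_proof.
Definition aend_opp f : A := Aend (aend_opp_proof f).
Definition aend_add f g : A := Aend (aend_add_proof f g).
Definition aend1 : A := Aend aend1_proof.
Definition aend_mul f g : A := Aend (aend_mul_proof f g).

Fact aend_addA : associative aend_add.
Proof. by move=> f g h; apply: aendP => x; apply: addrA. Qed.
Fact aend_addC : commutative aend_add.
Proof. by move=> f g; apply: aendP => x; apply: addrC. Qed.
Fact aend_add0 : left_id aend0 aend_add.
Proof. by move=> f; apply: aendP => x; apply: add0r. Qed.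
Fact aend_addN : left_inverse aend0 aend_opp aend_add.
Proof. by move=> f; apply: aendP => x; apply: addNr. Qed.
HB.instance Definition _ := GRing.isZmodule.Build A
  aend_addA aend_addC aend_add0 aend_addN.

Fact aend_mulA : associative aend_mul. Proof. by move=> f g h; apply: aendP. Qed.
Fact aend_mul1 : left_id aend1 aend_mul. Proof. by move=> f; apply: aendP. Qed.
Fact aend_mulr1 : right_id aend1 aend_mul. Proof. by move=> f; apply: aendP. Qed.
Fact aend_mulDl : left_distributive aend_mul +%R.
Proof. by move=> f g h; apply: aendP => x; apply: (zmod_morphismD (@aendB _ h)). Qed.
Fact aend_mulDr : right_distributive aend_mul +%R.
Proof. by move=> f g h; apply: aendP. Qed.
HB.instance Definition _ := GRing.Zmodule_isPzRing.Build A
  aend_mulA aend_mul1 aend_mulr1 aend_mulDl aend_mulDr.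

Lemma aendBE f g x : (f - g) x = f x - g x. Proof. by []. Qed.
Lemma aendME f g x : (f * g) x = g (f x). Proof. by []. Qed.
Lemma aend_sumE (I : Type) (r : seq I) (F : I -> A) x :
  (\sum_(i <- r) F i) x = \sum_(i <- r) F i x.
Proof. exact: (big_morph (fun f : A => f x)). Qed.
End AdditiveEndomorphisms.

Section InnerIteration.
Variables (L : pzRingType) (S : {pred L}) (E : subPzRingType S).
Implicit Types X Y Z : lmodType L.

(* [isyz] iterated on the inside, so that [jsyz n.+1 X] is convertible to
   [jsyz n (syz E X)]. *)
Fixpoint jsyz n X : lmodType L := if n is k.+1 then jsyz k (syz E X) else X.
Fixpoint jsyz_map n X Y (f : X -> Y) : jsyz n X -> jsyz n Y :=
  if n is k.+1 return jsyz n X -> jsyz n Y then @jsyz_map k _ _ (syz_map E f) else f.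
Arguments jsyz_map n {X Y} f w.

Lemma jsyz_map_linear n X Y (f : X -> Y) : linear f -> linear (jsyz_map n f).
Proof. by elim: n X Y f => //= n IHn X Y f fL; apply/IHn/syz_map_linear. Qed.

Lemma jsyz_map_eq n X Y (f g : X -> Y) w : f =1 g -> jsyz_map n f w = jsyz_map n g w.
Proof. by move=> /funext ->. Qed.

Lemma jsyz_map_id n X (f : X -> X) w : f =1 id -> jsyz_map n f w = w.
Proof.
elim: n X f w => [|n IHn] X f w fid //=; apply: IHn => v.
by rewrite -[RHS]syz_map_id; congr (syz_map E _ v); apply/funext.
Qed.

Lemma jsyz_map_comp n X Y Z (f : X -> Y) (g : Y -> Z) w : linear f -> linear g ->
  jsyz_map n g (jsyz_map n f w) = jsyz_map n (g \o f) w.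
Proof.
elim: n X Y Z f g w => //= n IHn X Y Z f g w fL gL.
rewrite IHn; try exact: syz_map_linear.
by apply: jsyz_map_eq => v; rewrite /= -syz_map_comp //; exact: linear_elinear.
Qed.

Lemma jsyz_map_sum n (I : Type) (r : seq I) X Y (f : I -> X -> Y) w :
  (forall i, linear (f i)) ->
  jsyz_map n (fun x => \sum_(i <- r) f i x) w = \sum_(i <- r) jsyz_map n (f i) w.
Proof.
elim: n X Y f w => //= n IHn X Y f w fL.
rewrite -IHn => [|i]; last exact: syz_map_linear.
by apply: jsyz_map_eq => v; rewrite syz_map_sum // => i; exact: linear_elinear.
Qed.

Lemma jsyz_mapB n X Y (f g : X -> Y) w : linear f -> linear g ->
  jsyz_map n (fun x => f x - g x) w = jsyz_map n f w - jsyz_map n g w.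
Proof.
move=> fL gL; apply/eqP; rewrite eq_sym subr_eq; apply/eqP.
pose h (b : bool) x : Y := if b then f x - g x else g x.
have hL b : linear (h b).
  by case: b => // a x y; rewrite /h fL gL opprD addrACA scalerBr.
transitivity (\sum_(b : bool) jsyz_map n (h b) w); last by rewrite big_bool.
rewrite -jsyz_map_sum //; apply: jsyz_map_eq => x.
by rewrite big_bool /= subrK.
Qed.

(* The two iterations agree up to the transport [jsyz n X = isyz n X]. *)
Lemma jsyz_map_eq0 n X Y (f : X -> Y) :
  (forall w, jsyz_map n f w = 0) -> forall w, isyz_map E n f w = 0.
Proof.
(* Bundling a map with its source and target lets maps between propositionally equal modules be
   compared without transports. *)
pose mor := {X : lmodType L & {Y : lmodType L & X -> Y}}.
pose pack X Y (f : X -> Y) : mor := existT _ X (existT _ Y f).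
pose vanish (m : mor) := forall w, projT2 (projT2 m) w = 0.
have swap k X' Y' (h : X' -> Y') :
    pack _ _ (isyz_map E k (syz_map E h)) = pack _ _ (syz_map E (isyz_map E k h)).
  elim: k => //= k IHk.
  exact: (congr1 (fun m : mor => pack _ _ (syz_map E (projT2 (projT2 m)))) IHk).
elim: n X Y f => [|n IHn] X Y f //= f0.
have : vanish (pack _ _ (isyz_map E n (syz_map E f))) by exact: IHn.
by rewrite swap.
Qed.
End InnerIteration.
Arguments jsyz_map {L S} E n {X Y} f w.

(** * Words in the Leavitt ring *)

Section LeavittWords.
Variables (L : pzRingType) (S : {pred L}) (E : subPzRingType S).
(* [ka] and [kb] identify [M] with [L/E (x)_E L]. *)
Variables (M : bimodType L L) (ka : {linear syz E L^o -> M}).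
Variable kb : {linear M -> syz E L^o}.
Hypotheses (kaK : cancel ka kb) (kbK : cancel kb ka).
Hypothesis kaZr : forall a x b : L,
  ka (stm E a (x * b : L^o)) = ka (stm E a (x : L^o)) :* b.
(* [B] is the Leavitt ring of [M]; with the concrete presentation in its place,
   unification diverges. *)
Variables (B : pzRingType) (ring : L -> B) (mod : M -> B) (dl : dual M -> B).
Hypotheses (ringB : zmod_morphism ring) (ringM : {morph ring : a b / a * b})
  (ring1 : ring 1 = 1) (modB : zmod_morphism mod)
  (modZ : forall a x, mod (a *: x) = ring a * mod x)
  (modZr : forall x a, mod (x :* a) = mod x * ring a)
  (evalE : forall x f, mod x * dl f = ring (f x))
  (casimirE : forall n (a : 'I_n -> M) (a' : 'I_n -> dual M), dual_basis a a' ->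
     \sum_j dl (a' j) * mod (a j) = 1).
Variable homog : int -> B -> Prop.
Hypotheses (homog_ring : forall a, homog 0 (ring a))
  (homog_mod : forall x, homog (-1) (mod x)) (homog_dual : forall f, homog 1 (dl f))
  (homog0 : forall d, homog d 0)
  (homogB : forall d u v, homog d u -> homog d v -> homog d (u - v))
  (homogM : forall d e u v, homog d u -> homog e v -> homog (d + e) (u * v)).
Local Notation d a := (ka (stm E a (1 : L^o))).
Local Notation N k := (isyz E k L^o).

(** The universal derivation, taken on [L/E] because [tlift] supplies classes and not
    representatives. *)
Definition du (u : Lbar E) : M := ka (@tmul E (Lbar E) (restr E L^o) u (1 : L)).
Lemma du_bar a : du (bar E a) = d a. Proof. by []. Qed.
Lemma duD u v : du (u + v) = du u + du v.
Proof. by rewrite /du tmulDl linearD. Qed.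
Lemma duZr u (e : E) : du (u :* e) = du u :* \val e.
Proof.
have [a <-] := bar_surj u; rewrite !du_bar -kaZr mul1r.
have -> : bar E a :* e = bar E (a * \val e) by exact: bar_rscale_bar.
by rewrite du_bar stmA; congr (ka (stm _ _ _)); exact: mulr1.
Qed.

(* [N k] is the [k]-th tensor power of [M]; [lv_word k] maps it to the
   products of [k] elements of [M] in the Leavitt ring. *)
Fixpoint lv_word k : N k -> B :=
  if k is j.+1 return N k -> B then
    tlift (fun (u : Lbar E) (x : restr E (N j)) => mod (du u) * @lv_word j x)
  else ring.
Arguments lv_word k w : clear implicits.

Fact lv_wordP k : [/\ zmod_morphism (lv_word k),
  forall a z, lv_word k (a *: z) = ring a * lv_word k z
  & forall a x, lv_word k.+1 (stm E a x) = mod (d a) * lv_word k x].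
Proof.
have step j : zmod_morphism (lv_word j) ->
    (forall a z, lv_word j (a *: z) = ring a * lv_word j z) ->
    zmod_morphism (lv_word j.+1) /\
    (forall a x, lv_word j.+1 (stm E a x) = mod (d a) * lv_word j x).
  move=> iB iZ.
  have fP : balanced (fun (u : Lbar E) (x : restr E (N j)) => mod (du u) * lv_word j x).
    split=> [u v x|u x y|u e x].
    - by rewrite duD (zmod_morphismD modB) mulrDl.
    - by rewrite (zmod_morphismD iB) mulrDr.
    - rewrite duZr.
      have -> : lv_word j (e *: x) = ring (\val e) * lv_word j x by exact: iZ.
      by rewrite mulrA modZr.
  split; first exact: tlift_is_zmod_morphism.
  by move=> a x; exact: tlift_tmul.
elim: k => [|k [iB iZ iS]].
  have B0 : zmod_morphism (lv_word 0) by move=> a b; exact: (ringB a b).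
  have Z0 a z : lv_word 0 (a *: z) = ring a * lv_word 0 z by exact: (ringM a z).
  by have [] := step 0%N B0 Z0.
have [iB' _] := step k iB iZ.
have iZ' a z : lv_word k.+1 (a *: z) = ring a * lv_word k.+1 z.
  apply: (@syz_ext _ _ E (N k) _ (fun z => lv_word k.+1 (a *: z))
            (fun z => ring a * lv_word k.+1 z)) z => [u v|u v|b x].
  - by rewrite scalerBr iB'.
  - by rewrite iB' mulrBr.
  (* What remains is the Leibniz rule [d (a b) - (d a) b = a (d b)] in [M]. *)
  rewrite stmZ iB' !iS iZ !mulrA -modZ -modZr -mulrBl -modB.
  congr (mod _ * _); rewrite -kaZr mul1r -linearZ_LR stmZ linearB; congr (_ - ka (stm _ _ _)).
  exact: esym (mulr1 _).
by have [_ iS'] := step _ iB' iZ'.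
Qed.

Lemma lv_wordB k : zmod_morphism (lv_word k). Proof. by case: (lv_wordP k). Qed.
Lemma lv_wordZ k a z : lv_word k (a *: z) = ring a * lv_word k z.
Proof. by case: (lv_wordP k). Qed.
Lemma lv_wordS k a x : lv_word k.+1 (stm E a x) = mod (d a) * lv_word k x.
Proof. by case: (lv_wordP k). Qed.
Lemma lv_word_sum k (I : Type) (r : seq I) (f : I -> N k) :
  lv_word k (\sum_(i <- r) f i) = \sum_(i <- r) lv_word k (f i).
Proof.
exact: (big_morph (lv_word k) (zmod_morphismD (@lv_wordB k)) (zmod_morphism0 (@lv_wordB k))).
Qed.

Lemma lv_word_homog k z : homog (- k%:Z) (lv_word k z).
Proof.
elim: k z => [|k IHk] z; first by rewrite oppr0; exact: homog_ring.
apply: (@syz_ind _ _ E (N k) (fun z => homog _ (lv_word k.+1 z))) z => [|u v|a x].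
- by rewrite (zmod_morphism0 (@lv_wordB k.+1)); exact: homog0.
- by rewrite lv_wordB; exact: homogB.
rewrite lv_wordS -addn1 PoszD opprD addrC.
by apply: homogM (IHk x); exact: homog_mod.
Qed.

(** The stand-in for a class in a colimit of the [Hom(N k, N l)]: [h] determines [t] through the
    dual basis of [N k], whereas for [k = l] two such [h] are only shown to agree after a power of
    [F]. *)
Definition represents k l (t : B) (h : N k -> N l) : Prop :=
  forall z, lv_word k z * t = lv_word l (h z).

(** The new letter enters on the left of the word and [t] acts on the right. *)
Lemma representsS k l t (h : N k -> N l) : linear h -> represents t h ->
  represents t (syz_map E h : N k.+1 -> N l.+1).
Proof.
move=> hL rep z.
apply: (@syz_ext _ _ E (N k) _ (fun z => lv_word k.+1 z * t)
  (fun z => lv_word l.+1 (syz_map E h z))) z => [u v|u v|a x].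
- by rewrite lv_wordB mulrBl.
- by rewrite syz_mapB ?lv_wordB //; exact: linear_elinear.
by rewrite syz_mapE ?lv_wordS -?mulrA ?rep //; exact: linear_elinear.
Qed.

Definition rmul (X : lmodType L) (x : X) : L^o -> X := fun a => (a : L) *: x.
Lemma rmul_linear X x : linear (@rmul X x).
Proof. by move=> a b c; rewrite /rmul scalerDl -scalerA. Qed.

Lemma lv_word1 (x : M) : lv_word 1 (kb x) = mod x.
Proof.
rewrite -{2}(kbK x).
apply: (@syz_ext _ _ E L^o _ (lv_word 1) (fun z => mod (ka z))) => [||a b].
- exact: (@lv_wordB 1).
- by move=> u v; rewrite linearB modB.
by rewrite lv_wordS /= -modZr -kaZr mul1r.
Qed.

(** Demanded at all large levels: the target length [k - d] must be nonnegative, a difference needs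
    a common level, and in a product the second factor must act at the level where the first one
    ends. *)
Definition representable (d : int) (t : B) : Prop :=
  exists k0 : nat, forall k, (k0 <= k)%N ->
  exists (l : nat) (h : N k -> N l), [/\ l%:Z = k%:Z - d, linear h & represents t h].

Lemma representable_at (k l : nat) d t (h : N k -> N l) :
  l%:Z = k%:Z - d -> linear h -> represents t h -> representable d t.
Proof.
move=> ld hL rep; exists k => k' /subnKC <-; elim: (k' - k)%N => [|m [l' [h' [ld' hL' rep']]]].
  by rewrite addn0; exists l, h.
rewrite addnS; exists l'.+1, (syz_map E h'); split.
- by rewrite -addn1 PoszD ld' -[(k + m).+1]addn1 [in RHS]PoszD addrAC.
- exact: syz_map_linear.
- exact: representsS.
Qed.

Lemma representable_ring a : representable 0 (ring a).
Proof.
apply: (@representable_at 0 0 _ _ (rmul (a : L^o))); first by rewrite subr0.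
  exact: rmul_linear.
by move=> z; exact: esym (ringM z a).
Qed.

Lemma representable_mod x : representable (-1) (mod x).
Proof.
apply: (@representable_at 0 1 _ _ (rmul (kb x))) => //; first exact: rmul_linear.
by move=> z; rewrite /rmul lv_wordZ lv_word1.
Qed.

Lemma representable_dual f : representable 1 (dl f).
Proof.
apply: (@representable_at 1 0 _ _ (fun z => f (ka z) : L^o)) => //.
  by move=> a y z; rewrite linearP [f _](linearP (dual_linear f)).
by move=> z; rewrite -{1}(kaK z) lv_word1; exact: evalE.
Qed.

Lemma representable0 d : representable d 0.
Proof.
exists `|d|%N => k dk; exists `|(k%:Z - d)%R|%N, (fun _ => 0); split; first by lia.
  by move=> a y z; rewrite scaler0 addr0.
by move=> z; rewrite mulr0 (zmod_morphism0 (@lv_wordB _)).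
Qed.

Lemma representableB d u v :
  representable d u -> representable d v -> representable d (u - v).
Proof.
move=> [k IHu] [k' IHv]; exists (maxn k k') => m; rewrite geq_max => /andP[km k'm].
have [l [h [lE hL rep]]] := IHu _ km; have [l' [h' [lE' hL' rep']]] := IHv _ k'm.
have ell : l' = l by case: (etrans lE' (esym lE)).
subst l'; exists l, (fun z => h z - h' z); split=> //.
  by move=> a y z; rewrite hL hL' opprD addrACA scalerBr.
by move=> z; rewrite mulrBr rep rep' lv_wordB.
Qed.

Lemma representableM d e u v :
  representable d u -> representable e v -> representable (d + e) (u * v).
Proof.
(* From such an [m], the action of [u] leads to length [m - d], which is at least [k'], so [v] can
   act next. *)
move=> [k IHu] [k' IHv]; exists (k + (k' + `|d|))%N => m km.
have [|l [h [lE hL rep]]] := IHu m; first by apply: leq_trans km; rewrite leq_addr.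
have [|l' [h' [lE' hL' rep']]] := IHv l; first by lia.
exists l', (fun z => h' (h z)); split.
- by rewrite lE' lE opprD addrA.
- by move=> a y z; rewrite hL hL'.
- by move=> z; rewrite mulrA rep rep'.
Qed.

Hypothesis basisM : exists (n : nat) (a : 'I_n -> M) (a' : 'I_n -> dual M),
  dual_basis a a'.
Hypothesis ssE : semisimple_ring E.

Lemma lv_word_rmul k (x : N k) w :
  lv_word k.+1 (syz_map E (rmul x) w) = mod (ka w) * lv_word k x.
Proof.
have rE : elinear E (rmul x) by apply: linear_elinear; apply: rmul_linear.
apply: (@syz_ext _ _ E L^o _ (fun w => lv_word k.+1 (syz_map E (rmul x) w))
   (fun w => mod (ka w) * lv_word k x)) w => [u v|u v|a b].
- by rewrite syz_mapB // lv_wordB.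
- by rewrite linearB modB mulrBl.
by rewrite syz_mapE // lv_wordS lv_wordZ mulrA -modZr -kaZr mul1r.
Qed.

(** The dual basis of [M] iterated: [c j] is a product of [k] dual elements in the order opposite to
    the letters of [b j], so right multiplication by it evaluates the coordinate [l j], and the
    nested Casimir sums collapse to [1]. *)
Lemma lv_word_dual_basis k : exists (J : finType) (b : J -> N k) (l : J -> N k -> L)
    (c : J -> B),
  [/\ (forall j, linear (l j : N k -> L^o)) /\ (forall z, z = \sum_j l j z *: b j),
      forall j z, lv_word k z * c j = ring (l j z),
      \sum_j c j * lv_word k (b j) = 1
    & forall j, homog k%:Z (c j)].
Proof.
elim: k => [|k [J [b [l [c [[lL lb] lc cb ch]]]]]].
  exists 'I_1, (fun _ => 1 : L), (fun _ => id), (fun _ => 1); split.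
  - by split=> // z; rewrite big_ord1; exact: esym (mulr1 (z : L)).
  - by move=> _ z; rewrite mulr1.
  - by rewrite big_ord1 mul1r [LHS]ring1.
  - by move=> _; rewrite -ring1; exact: homog_ring.
have [n [a [a' [aE a'E]]]] := basisM.
pose lo j : N k -> L^o := l j.
have lE j : elinear E (lo j) by exact: linear_elinear.
have bE j : elinear E (rmul (b j)) by apply: linear_elinear; apply: rmul_linear.
(* The basis vector is [a i (x) b j], obtained from [a i] by applying [F] to the map [L -> N k] with
   [1] going to [b j]. *)
exists (J * 'I_n)%type, (fun p => syz_map E (rmul (b p.1)) (kb (a p.2))),
  (fun p z => a' p.2 (ka (syz_map E (lo p.1) z))),
  (fun p => c p.1 * dl (a' p.2)); split; first split.
- have loL j : linear (syz_map E (lo j)) by apply: syz_map_linear; exact: lL.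
  by move=> -[j i] d u v /=; rewrite loL linearP; exact: (linearP (dual_linear (a' i))).
- move=> z; rewrite -(pair_bigA _ (fun j i => a' i (ka (syz_map E (lo j) z)) *:
    syz_map E (rmul (b j)) (kb (a i)))) /=.
  have inner j : \sum_i a' i (ka (syz_map E (lo j) z)) *:
      syz_map E (rmul (b j)) (kb (a i)) = syz_map E (rmul (b j) \o lo j) z.
    have [f fE] := linear_exists (syz_map_linear (E := E) (rmul_linear (b j))).
    rewrite [RHS]syz_map_comp // -fE -[in RHS](kaK (syz_map E (lo j) z)).
    rewrite [in RHS](aE (ka _)) !linear_sum; apply: eq_bigr => i _.
    by rewrite !linearZ fE.
  under eq_bigr => j _ do rewrite inner.
  rewrite -syz_map_sum; last by move=> j; apply: linear_elinear => d u v /=;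
    have -> : lo j (d *: u + v) = d *: lo j u + lo j v by [exact: lL]; exact: rmul_linear.
  by rewrite -[LHS]syz_map_id; congr (syz_map E _ z); apply/funext => y; exact: lb.
- move=> [j i] z /=.
  apply: (@syz_ext _ _ E (N k) _ (fun z => lv_word k.+1 z * (c j * dl (a' i)))
    (fun z => ring (a' i (ka (syz_map E (lo j) z))))) z => [u v|u v|x y].
  + by rewrite lv_wordB mulrBl.
  + rewrite syz_mapB // linearB -ringB; congr (ring _).
    exact: (linearB (dual_linear (a' i))).
  rewrite lv_wordS syz_mapE // -mulrA (mulrA (lv_word k y)) lc mulrA -modZr.
  by rewrite -kaZr mul1r evalE.
- rewrite -(pair_bigA _ (fun j i => c j * dl (a' i) *
    lv_word k.+1 (syz_map E (rmul (b j)) (kb (a i))))) -cb.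
  apply: eq_bigr => j _; rewrite -[in RHS](mul1r (lv_word k (b j))).
  rewrite -(casimirE (conj aE a'E)) mulr_suml mulr_sumr; apply: eq_bigr => i _.
  rewrite (lv_word_rmul (b j) (kb (a i))).
  rewrite (kbK (a i)).
  by rewrite !mulrA.
- move=> [j i] /=; rewrite -addn1 PoszD; apply: homogM => //; exact: homog_dual.
Qed.

Lemma leavitt0_regular : (exists n, forall X : lmodType L, projective (isyz E n X)) ->
  forall t : B, representable 0 t -> exists2 s, homog 0 s & t * s * t = t.
Proof.
move=> [n projn] t [k /(_ k (leqnn k)) [l [h [lk hL rep]]]].
have elk : l = k by move: lk; lia.
subst l.
have HN : is_submod (fun v => exists y, h y = v).
  have [f fE] := linear_exists hL.
  split=> [|a u v [x <-] [y <-]]; first by exists 0; rewrite -fE linear0.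
  by exists (a *: x + y); rewrite hL.
pose C := quotm HN.
(* The presentation of [C] climbs one level at a time because [F (N (m + k))] is [N (m.+1 + k)] by
   conversion, whereas [F^m (N k)] equals [N (m + k)] only up to transport. *)
have stage m : exists (h' : N (m + k) -> N (m + k)) (p : N (m + k) -> isyz E m C),
    [/\ linear h', linear p, represents t h', surjective p
      & forall x, p x = 0 <-> exists y, h' y = x].
  elim: m => [|m [h' [p [hL' pL rep' pS kerp]]]].
    exists h, (@quot_proj _ _ _ HN); split=> //; first exact: linearP.
      exact: quot_proj_surj.
    by move=> x; apply: quot_proj_eq0.
  exists (syz_map E h'), (syz_map E p); split.
  - exact: syz_map_linear.
  - exact: syz_map_linear.
  - exact: representsS.
  - by apply: syz_surj => //; apply: linear_elinear.
  - by apply: syz_exact => //; apply: linear_elinear.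
have [h' [p [hL' pL rep' pS kerp]]] := stage n.
have [[f fE] [q qE]] := (linear_exists hL', linear_exists pL).
have [||||g gE] := @linear_regular _ _ _ f q.
- by apply: isyz_projective => //; apply: projective_regular.
- exact: projn.
- by move=> y; have [x <-] := pS y; exists x; rewrite qE.
- by move=> x; rewrite qE kerp; split=> -[y <-]; exists y; rewrite fE.
have [J [b [l [c [[lL lb] lc cb ch]]]]] := lv_word_dual_basis (n + k).
(* The element of degree 0 represented by [g], recovered from the values of [g] on the dual
   basis. *)
pose s := \sum_j c j * lv_word _ (g (b j)).
have rep_s z : lv_word _ z * s = lv_word _ (g z).
  rewrite mulr_sumr [in RHS](lb z) linear_sum lv_word_sum; apply: eq_bigr => j _.
  by rewrite mulrA lc linearZ lv_wordZ.
exists s.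
  rewrite /s; elim/big_ind: _ => [|u v Hu Hv|j _]; first exact: homog0.
    rewrite -[v]opprK -[- v]sub0r; apply: homogB => //; apply: homogB => //; exact: homog0.
  by rewrite -[X in homog X](subrr (n + k)%:Z); apply: homogM => //; exact: lv_word_homog.
(* As the words of the [b j] recombine to [1], it is enough to compare both sides after left
   multiplication by words, where they act as [h' g h'] and [h']. *)
rewrite -[LHS]mul1r -[RHS]mul1r -cb !mulr_suml; apply: eq_bigr => j _.
rewrite -!mulrA; congr (_ * _); rewrite rep' !mulrA rep' rep_s rep'.
by rewrite -!fE gE.
Qed.
(** The relations among the generators only make elements of [B] equal; this bounds what they can
    kill in [L]. *)
Hypothesis ring_ker : forall a, ring a = 0 ->
  exists n0, forall n, (n0 <= n)%N -> forall w, isyz_map E n (rmul (a : L^o)) w = 0.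

Lemma common_bound (J : finType) (P : J -> nat -> Prop) :
  (forall j, exists n0, forall n, (n0 <= n)%N -> P j n) ->
  exists n0, forall n, (n0 <= n)%N -> forall j, P j n.
Proof.
move=> /choice [b bP]; exists (\max_j b j) => n le j; apply: bP.
by apply: leq_trans le; rewrite leq_bigmax.
Qed.

(* Multiplying by the dual basis brings a vanishing word down to degree 0. *)
Lemma lv_word_ker k (h : N k -> N k) : linear h -> (forall z, lv_word k (h z) = 0) ->
  exists n0, forall n, (n0 <= n)%N -> forall w, isyz_map E n h w = 0.
Proof.
move=> hL h0; have [J [b [l [c [[lL lb] lc _ _]]]]] := lv_word_dual_basis k.
pose lo j : N k -> L^o := l j.
have loL j : linear (lo j) by exact: lL.
have [p|n0 n0P] := @common_bound (J * J)%type (fun p n => forall w : N n,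
    isyz_map E n (rmul (lo p.1 (h (b p.2)))) w = 0).
  by apply: ring_ker; rewrite -lc h0 mul0r.
exists n0 => n /n0P zP w.
(* The matrix of [h] in the dual basis has entries [l i (h (b j))], whose images
   [lv_word (h (b j)) * c i] in [B] vanish. High powers of [F] kill the multiplications by these
   entries, and with them [h]. *)
have hE : h = fun z => \sum_(p : J * J) rmul (b p.1) (rmul (lo p.1 (h (b p.2))) (lo p.2 z)).
  apply/funext => z.
  rewrite -(pair_bigA _ (fun i j => rmul (b i) (rmul (lo i (h (b j))) (lo j z)))).
  rewrite exchange_big /= {1}(lb z).
  have [f fE] := linear_exists hL; rewrite -fE linear_sum; apply: eq_bigr => j _.
  rewrite linearZ fE /= {1}(lb (h (b j))) scaler_sumr; apply: eq_bigr => i _.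
  by rewrite /rmul scalerA.
rewrite hE isyz_map_sum => [|p]; last first.
  by move=> a u v; rewrite loL (rmul_linear (lo p.1 (h (b p.2)))) rmul_linear.
apply: big1 => p _.
have pL : linear (fun z => rmul (lo p.1 (h (b p.2))) (lo p.2 z)).
  by move=> a u v; rewrite loL rmul_linear.
rewrite (isyz_map_comp w pL (rmul_linear (b p.1))).
rewrite (isyz_map_comp w (loL p.2) (rmul_linear (lo p.1 (h (b p.2))))) zP.
have [f fE] := linear_exists (isyz_map_linear (E := E) (n := n) (rmul_linear (b p.1))).
by rewrite -fE linear0.
Qed.

Lemma representsG k (a : L) :
  represents (ring a) (isyz_map E k (rmul (a : L^o)) : N k -> N k).
Proof.
elim: k => [|k IHk]; first by move=> z; exact: esym (ringM z a).
by apply: representsS => //; apply: isyz_map_linear; apply: rmul_linear.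
Qed.

(** [eps] represents the local unit. After a power of [F] it fixes the images of the multiplications
    by the [g i], hence the kernel of [pi], and its own image lies in that kernel. So [id - eps']
    descends to a section of [pi], which makes the syzygy of [L/I] a retract of one of [L]. *)
Lemma local_unit_projective m (g : 'I_m -> L) (y : 'I_m -> B) (I : L -> Prop)
    (HI : @is_submod L L^o I) :
  (forall i, I (g i)) ->
  (forall x, I x -> exists c : 'I_m -> L, x = \sum_i c i * g i) ->
  (forall j, representable 0 (y j)) ->
  (forall i, ring (g i) * (\sum_j y j * ring (g j)) = ring (g i)) ->
  exists q, projective (isyz E q (quotm HI)).
Proof.
move=> gI Ig yrep unit; have [k kP] := common_bound yrep.
have /choice [h hP] j : exists h : N k -> N k, linear h /\ represents (y j) h.
  have [l [h [lk hL rep]]] := kP k (leqnn k) j.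
  by have elk : l = k by [move: lk; lia]; subst l; exists h.
pose G i : N k -> N k := isyz_map E k (rmul (g i : L^o)).
have GL i : linear (G i) by apply: isyz_map_linear; apply: rmul_linear.
have hL j : linear (h j) by case: (hP j).
have GhL j : linear (G j \o h j) by move=> a u v; rewrite /= hL GL.
pose eps z := \sum_j (G j \o h j) z.
have epsL : linear eps.
  move=> a u v; rewrite /eps scaler_sumr -big_split; apply: eq_bigr => j _; exact: GhL.
have eps_rep z : lv_word k z * (\sum_j y j * ring (g j)) = lv_word k (eps z).
  rewrite mulr_sumr lv_word_sum; apply: eq_bigr => j _.
  by rewrite mulrA; case: (hP j) => _ ->; rewrite representsG.
(* Both terms represent [ring (g i)], so the words of [dlt i] vanish and a power of [F] kills it,
   although [dlt i] itself may be nonzero. *)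
pose dlt i z := eps (G i z) - G i z.
have dltL i : linear (dlt i).
  by move=> a u v; rewrite /dlt GL epsL scalerBr opprD addrACA.
have [i|n0 n0P] := @common_bound _ (fun i n => forall w, isyz_map E n (dlt i) w = 0).
  apply: lv_word_ker => // z.
  by rewrite lv_wordB -eps_rep -representsG -mulrA unit subrr.
pose n := n0; have n0E := n0P n (leqnn n); clearbody n => {n0P}.
pose G' i := isyz_map E n (G i); pose eps' := isyz_map E n eps.
have G'L i : linear (G' i) by exact: isyz_map_linear.
have eps'L : linear eps' by exact: isyz_map_linear.
have epsG i w : eps' (G' i w) = G' i w.
  rewrite /eps' /G' -isyz_map_comp //.
  pose f (b : bool) : N k -> N k := if b then dlt i else G i.
  have -> : eps \o G i = fun z => \sum_(b : bool) f b z.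
    by apply/funext => z; rewrite big_bool /= /dlt subrK.
  by rewrite isyz_map_sum => [|[]]; rewrite ?big_bool /= ?n0E ?add0r.
pose pr : {linear L^o -> quotm HI} := @quot_proj _ _ _ HI.
have dL : linear (fun c : 'rV[L]_m => \sum_i rmul (g i : L^o) (c 0 i)).
  move=> a u v; rewrite scaler_sumr -big_split; apply: eq_bigr => i _ /=.
  by rewrite !mxE; exact: rmul_linear.
set d := fun c : 'rV[L]_m => _ in dL.
have prL : linear pr by exact: linearP.
have kerpr b : pr b = 0 <-> exists c, d c = b.
  split=> [/quot_proj_eq0 /Ig [c ->]|[c <-]].
    by exists (\row_i c i); apply: eq_bigr => i _; rewrite mxE.
  apply/quot_proj_eq0; apply: (submod_sum HI) => i; exact: idealM.
pose pi := isyz_map E n (isyz_map E k pr).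
have piL : linear pi by do 2 apply: isyz_map_linear.
have piS : surjective pi.
  apply: isyz_surj => //; first exact: isyz_map_linear.
  by apply: isyz_surj => //; exact: quot_proj_surj.
have kerpi w : pi w = 0 -> eps' w = w.
  move=> /(isyz_exact ssE (n := n) (isyz_map_linear dL) (isyz_map_linear prL)
    (isyz_exact ssE (n := k) dL prL kerpr)) [v <-].
  pose co i (c : 'rV[L]_m) : L^o := c 0 i.
  have coL i : linear (co i) by move=> a x z; rewrite /co !mxE.
  have gcoL i : linear (rmul (g i : L^o) \o co i).
    by move=> a x z; rewrite /= coL rmul_linear.
  have -> : isyz_map E k d = fun u => \sum_i (G i \o isyz_map E k (co i)) u.
    apply/funext => u; rewrite -[d]/(fun c => \sum_i (rmul (g i : L^o) \o co i) c).
    rewrite isyz_map_sum //; apply: eq_bigr => i _; exact: isyz_map_comp (rmul_linear _).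
  have cokL i : linear (isyz_map E k (co i)) by exact: isyz_map_linear.
  have GcoL i : linear (G i \o isyz_map E k (co i)).
    by move=> a x z; rewrite /= cokL GL.
  have [f fE] := linear_exists eps'L.
  rewrite isyz_map_sum // -fE linear_sum; apply: eq_bigr => i _.
  by rewrite fE (isyz_map_comp v (cokL i) (GL i)) epsG.
have pi_eps w : pi (eps' w) = 0.
  rewrite /pi /eps' -isyz_map_comp //; last exact: isyz_map_linear.
  rewrite (_ : isyz_map E k pr \o eps = fun _ => 0) ?isyz_map0 //.
  apply/funext => z /=; rewrite /eps.
  have [f fE] := linear_exists (isyz_map_linear (E := E) (n := k) prL).
  rewrite -fE linear_sum big1 // => j _; rewrite fE /= -isyz_map_comp //; last exact: rmul_linear.
  rewrite (_ : pr \o rmul _ = fun _ => 0) ?isyz_map0 //.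
  by apply/funext => a; apply/quot_proj_eq0; apply: idealM.
exists (n + k)%N; rewrite -isyzD.
have [p pE] := linear_exists piL.
have rL : linear (fun w => w - eps' w).
  by move=> a u v; rewrite eps'L scalerBr opprD addrACA.
have [r0 r0E] := linear_exists rL.
have [|w pw0|r rE] := factor_surj (p := p) (f := r0).
- by move=> x; have [w <-] := piS x; exists w; rewrite pE.
- by rewrite r0E kerpi ?subrr // -pE.
apply: (projective_retract (r := p) (i := r)) => [x|].
  have [w <-] := piS x; rewrite -pE rE r0E linearB !pE pi_eps.
  exact: subr0.
by do 2 apply: isyz_projective => //; apply: projective_regular.
Qed.

End LeavittWords.

(** * The action on germs of sequences *)

Lemma rproj_lift (A B : pzRingType) (r : A -> A -> Prop) (h : {rmorphism A -> B}) :
  (forall u v, r u v -> h u = h v) -> forall u v, rproj r u = rproj r v -> h u = h v.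
Proof.
move=> hr u v /rproj_eqP uv; apply/eqP; rewrite -subr_eq0 -rmorphB; apply/eqP.
elim: uv => [x y /hr e||x y _ ex _ ey|a x _ ex|a x _ ex].
- by rewrite rmorphB e subrr.
- by rewrite rmorph0.
- by rewrite rmorphB ex ey subrr.
- by rewrite rmorphM ex mulr0.
- by rewrite rmorphM ex mul0r.
Qed.

Section Germs.
Variable N : nat -> zmodType.

Definition sequences : Type := forall n, N n.
Local Notation Q := sequences.
Implicit Types x y z : Q.
HB.instance Definition _ := gen_eqMixin Q.
HB.instance Definition _ := gen_choiceMixin Q.

Definition seq0 : Q := fun n => 0.
Definition seq_opp x : Q := fun n => - x n.
Definition seq_add x y : Q := fun n => x n + y n.
Lemma seqP x y : (forall n, x n = y n) -> x = y. Proof. exact: functional_extensionality_dep. Qed.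
Fact seq_addA : associative seq_add.
Proof. by move=> x y z; apply: seqP => n; apply: addrA. Qed.
Fact seq_addC : commutative seq_add.
Proof. by move=> x y; apply: seqP => n; apply: addrC. Qed.
Fact seq_add0 : left_id seq0 seq_add.
Proof. by move=> x; apply: seqP => n; apply: add0r. Qed.
Fact seq_addN : left_inverse seq0 seq_opp seq_add.
Proof. by move=> x; apply: seqP => n; apply: addNr. Qed.
HB.instance Definition _ := GRing.isZmodule.Build Q seq_addA seq_addC seq_add0 seq_addN.

Lemma seqBE x y n : (x - y) n = x n - y n. Proof. by []. Qed.

Definition eventually0 x : Prop := exists n0, forall n, (n0 <= n)%N -> x n = 0.
Definition eventually_eq x y : Prop := eventually0 (x - y).
Definition germs : Type := zquot eventually_eq.
HB.instance Definition _ := GRing.Zmodule.on germs.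
Definition germ : Q -> germs := zproj eventually_eq.
HB.instance Definition _ := GRing.isZmodMorphism.Build Q germs germ
  (@zproj_is_zmod_morphism _ eventually_eq).

Lemma germ_surj g : exists x, germ x = g. Proof. exact: zproj_surj. Qed.
Lemma germ_eq0 x : germ x = 0 <-> eventually0 x.
Proof.
split=> [e|ev].
  have /zproj_eqP : zproj eventually_eq x = zproj eventually_eq 0 by rewrite [LHS]e raddf0.
  rewrite subr0; elim=> // [|y z _ [m ym] _ [k zk]]; first by exists 0%N.
  exists (maxn m k) => n; rewrite geq_max => /andP[mn kn].
  by rewrite seqBE ym // zk // subrr.
by rewrite -[RHS](raddf0 germ); apply: zproj_rel; rewrite /eventually_eq subr0.
Qed.
Lemma germ_eq x y : (exists n0, forall n, (n0 <= n)%N -> x n = y n) -> germ x = germ y.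
Proof.
move=> [n0 xy]; apply/eqP; rewrite -subr_eq0 -raddfB; apply/eqP/germ_eq0.
by exists n0 => n /xy e; rewrite seqBE e subrr.
Qed.

Lemma germ_op (f : Q -> Q) : zmod_morphism f -> (forall x, eventually0 x -> eventually0 (f x)) ->
  exists F : aend germs, forall x, F (germ x) = germ (f x).
Proof.
move=> fB fev; pose F : germs -> germs := zlift (fun x => germ (f x)).
have gB : zmod_morphism (fun x => germ (f x)) by move=> x y; rewrite fB raddfB.
have gev x y : eventually_eq x y -> germ (f x) = germ (f y).
  move=> /fev ev; apply/eqP; rewrite -subr_eq0 -raddfB; apply/eqP/germ_eq0.
  by rewrite -fB.
by exists (Aend (zlift_is_zmod_morphism gB gev)) => x; exact: zlift_proj.
Qed.

Lemma germ_ext (F G : aend germs) : (forall x, F (germ x) = G (germ x)) -> F = G.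
Proof. by move=> e; apply: aendP => g; have [x <-] := germ_surj g. Qed.
End Germs.

(** * The Leavitt ring acting on germs *)

Section Action.
Variables (L : pzRingType) (S : {pred L}) (E : subPzRingType S).
Variables (M : bimodType L L) (ka : {linear syz E L^o -> M}).
Variable kb : {linear M -> syz E L^o}.
Hypotheses (kaK : cancel ka kb) (kbK : cancel kb ka).
Hypothesis kaZr : forall a x b : L,
  ka (stm E a (x * b : L^o)) = ka (stm E a (x : L^o)) :* b.

Local Notation N := (fun n => jsyz E n L^o : zmodType).
Local Notation Q := (sequences N).
Local Notation W := (germs N).

Definition act_ring (a : L) (x : Q) : Q := fun n => jsyz_map E n (rmul (a : L^o)) (x n).
(** The letter enters at the inner end, under [F^m], as right multiplication requires; [jsyz] makes
    the target [jsyz m (F L)] convertible to level [m.+1]. Nothing arrives at index 0, and the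
    default value there is what breaks [c = 1]. *)
Definition act_mod (w : M) (x : Q) : Q :=
  fun n => if n is m.+1 return N n then jsyz_map E m (rmul (kb w)) (x m) else 0.
Definition act_dual (f : dual M) (x : Q) : Q :=
  fun n => jsyz_map E n (fun z => f (ka z) : L^o) (x n.+1).

Lemma dual_ka_linear (f : dual M) : linear (fun z => f (ka z) : L^o).
Proof. by move=> a y z; rewrite linearP [f _](linearP (dual_linear f)). Qed.

Lemma linear_zmod (U V : lmodType L) (f : U -> V) : linear f -> zmod_morphism f.
Proof. by move=> fL; have [g gE] := linear_exists fL; move=> x y; rewrite -!gE linearB. Qed.

Let jB n (X Y : lmodType L) (f : X -> Y) : linear f -> zmod_morphism (jsyz_map E n f).
Proof. by move=> fL; apply/linear_zmod/jsyz_map_linear. Qed.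

Fact act_ring_op a : exists F : aend W, forall x, F (germ x) = germ (act_ring a x).
Proof.
apply: germ_op => [x y|x [n0 x0]].
  by apply: seqP => n; rewrite /act_ring !seqBE jB //; exact: rmul_linear.
exists n0 => n /x0 e; rewrite /act_ring e.
exact: zmod_morphism0 (@jB _ _ _ _ (rmul_linear _)).
Qed.
Fact act_mod_op w : exists F : aend W, forall x, F (germ x) = germ (act_mod w x).
Proof.
apply: germ_op => [x y|x [n0 x0]].
  apply: seqP => -[|n]; rewrite seqBE /=; first by rewrite subrr.
  by rewrite !seqBE jB //; exact: rmul_linear.
exists n0.+1 => -[//|n] /x0 e; rewrite /act_mod e.
exact: (zmod_morphism0 (@jB n L^o (syz E L^o) _ (rmul_linear (kb w)))).
Qed.
Fact act_dual_op f : exists F : aend W, forall x, F (germ x) = germ (act_dual f x).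
Proof.
apply: germ_op => [x y|x [n0 x0]].
  by apply: seqP => n; rewrite /act_dual !seqBE jB //; exact: dual_ka_linear.
exists n0 => n le; rewrite /act_dual x0; last exact: leqW.
exact: zmod_morphism0 (@jB _ _ _ _ (dual_ka_linear f)).
Qed.

Lemma ka_syz_map b z : ka (syz_map E (rmul (b : L^o)) z) = ka z :* b.
Proof.
have rE : elinear E (rmul (b : L^o)) by apply/linear_elinear/rmul_linear.
apply: (@syz_ext _ _ E L^o _ (fun z => ka (syz_map E (rmul (b : L^o)) z))
  (fun z => ka z :* b)) z => [u v|u v|a c].
- by rewrite syz_mapB // linearB.
- by rewrite linearB rscaleBl.
by rewrite syz_mapE // -kaZr.
Qed.

Lemma lv_ring_ker a : lv_ring M a = 0 ->
  exists n0, forall n, (n0 <= n)%N -> forall w, isyz_map E n (rmul (a : L^o)) w = 0.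
Proof.
have /choice [Fr FrE] := act_ring_op.
have /choice [Fm FmE] := act_mod_op.
have /choice [Fd FdE] := act_dual_op.
have FrB : zmod_morphism Fr.
  move=> b c; apply: germ_ext => x; rewrite aendBE !FrE -raddfB; congr (germ _).
  apply: seqP => n; rewrite seqBE -jsyz_mapB; try exact: rmul_linear.
  by apply: jsyz_map_eq => z; exact: mulrBr.
have Fr1 : Fr 1 = 1.
  apply: germ_ext => x; rewrite FrE; congr (germ _); apply: seqP => n.
  by apply: jsyz_map_id => z; exact: mulr1.
have FrM : {morph Fr : b c / b * c}.
  move=> b c; apply: germ_ext => x; rewrite aendME !FrE; congr (germ _).
  apply: seqP => n; rewrite [RHS]jsyz_map_comp; try exact: rmul_linear.
  by apply: jsyz_map_eq => z; exact: mulrA.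
have FmB : zmod_morphism Fm.
  move=> v w; apply: germ_ext => x; rewrite aendBE !FmE -raddfB; congr (germ _).
  apply: seqP => -[|n]; rewrite seqBE /=; first by rewrite subrr.
  rewrite -jsyz_mapB; try exact: rmul_linear.
  by apply: jsyz_map_eq => z; rewrite /rmul linearB scalerBr.
have FdB : zmod_morphism Fd.
  move=> f g; apply: germ_ext => x; rewrite aendBE !FdE -raddfB; congr (germ _).
  apply: seqP => n; rewrite seqBE -jsyz_mapB; try exact: dual_ka_linear.
  exact: jsyz_map_eq.
have FmZ b w : Fm (b *: w) = Fr b * Fm w.
  apply: germ_ext => x; rewrite aendME !FmE FrE FmE; congr (germ _).
  apply: seqP => -[|n] //=; rewrite [RHS]jsyz_map_comp; try exact: rmul_linear.
  by apply: jsyz_map_eq => z; rewrite /rmul linearZ scalerA.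
have FmZr w b : Fm (w :* b) = Fm w * Fr b.
  apply: germ_ext => x; rewrite aendME !FmE FrE; congr (germ _).
  apply: seqP => -[|n]; rewrite /act_ring /=.
    by rewrite [RHS](zmod_morphism0 (linear_zmod (rmul_linear _))).
  rewrite jsyz_map_comp; try exact: rmul_linear; last exact/syz_map_linear/rmul_linear.
  apply: jsyz_map_eq => z; apply: (can_inj kaK).
  by rewrite /= ka_syz_map /rmul !linearZ_LR !kbK scalerAr_rscale.
have FdZ b f : Fd (b *: f) = Fr b * Fd f.
  apply: germ_ext => x; rewrite aendME !FdE FrE FdE; congr (germ _); apply: seqP => n.
  rewrite /act_dual /act_ring /= jsyz_map_comp; last exact: dual_ka_linear.
    by apply: jsyz_map_eq => z; rewrite /= ka_syz_map.
  exact/syz_map_linear/rmul_linear.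
have FdZr f b : Fd (f :* b) = Fd f * Fr b.
  apply: germ_ext => x; rewrite aendME !FdE FrE; congr (germ _); apply: seqP => n.
  rewrite /act_dual /act_ring /= jsyz_map_comp //; first exact: dual_ka_linear.
  exact: rmul_linear.
have FmFd w f : Fm w * Fd f = Fr (f w).
  apply: germ_ext => x; rewrite aendME FmE FdE FrE; congr (germ _); apply: seqP => n.
  rewrite /act_dual /act_ring /= jsyz_map_comp; [|exact: rmul_linear|exact: dual_ka_linear].
  apply: jsyz_map_eq => z; rewrite /= /rmul linearZ_LR kbK.
  exact: (linearZ_LR (dual_linear f)).
have FdFm n (b : 'I_n -> M) (b' : 'I_n -> dual M) : dual_basis b b' ->
    \sum_j Fd (b' j) * Fm (b j) = 1.
  move=> [bb' _]; apply: germ_ext => x; rewrite aend_sumE.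
  rewrite (eq_bigr (fun j => germ (act_mod (b j) (act_dual (b' j) x)))); last first.
    by move=> j _; rewrite aendME FdE FmE.
  (* From index 1 on, the dual basis expansion turns the Casimir sum into [F^k] of the identity of
     [F L]; germs forget index 0. *)
  rewrite -raddf_sum; apply: germ_eq; exists 1%N => -[//|k] _.
  have sumE (F : 'I_n -> Q) m : (\sum_j F j) m = \sum_j F j m.
    by rewrite (big_morph (fun y : Q => y m) (id1 := 0) (op1 := +%R)).
  rewrite sumE (eq_bigr (fun j => jsyz_map E k
    (rmul (kb (b j)) \o (fun z => b' j (ka z) : L^o)) (x k.+1))); last first.
    move=> j _; exact: jsyz_map_comp (dual_ka_linear _) (rmul_linear _).
  rewrite -jsyz_map_sum => [|j]; last first.
    by move=> c u v /=; rewrite dual_ka_linear rmul_linear.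
  refine (@jsyz_map_id _ _ E k (syz E L^o) _ _ _) => z.
  apply: (can_inj kaK); rewrite linear_sum [RHS]bb'.
  by apply: eq_bigr => j _; rewrite /= /rmul linearZ_LR kbK.
pose fZ := GRing.isZmodMorphism.Build L (aend W) Fr FrB.
pose fM := GRing.isMonoidMorphism.Build L (aend W) Fr (conj Fr1 FrM).
pose f := HB.pack_for {rmorphism L -> aend W} Fr fZ fM.
pose g0 (p : dual M * M) : aend W := Fd p.1 + Fm p.2.
have g0B : zmod_morphism g0.
  by move=> p q; rewrite /g0 /= FdB FmB opprD addrACA.
pose gZ := GRing.isZmodMorphism.Build (dual M * M)%type (aend W) g0 g0B.
pose g := HB.pack_for {additive (dual M * M)%type -> aend W} g0 gZ.
have [|b p|h [hr hn]] := @tring_lift _ (dual M * M)%type _ f g.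
- by move=> b p; rewrite /g /= /g0 /= FdZ FmZ mulrDr.
- by rewrite /g /= /g0 /= FdZr FmZr mulrDl.
have Fd0 : Fd 0 = 0 by exact: zmod_morphism0.
have Fm0 : Fm 0 = 0 by exact: zmod_morphism0.
have hker u v : leavitt_rel u v -> h u = h v.
  case=> [w k|n b b' /FdFm e].
    by rewrite rmorphM !hn hr /g /= /g0 /= Fd0 Fm0 add0r addr0 FmFd.
  rewrite rmorph1 rmorph_sum -e; apply: eq_bigr => j _.
  by rewrite rmorphM !hn /g /= /g0 /= Fd0 Fm0 add0r addr0.
rewrite -(zmod_morphism0 (@lv_ringB _ M)) => /(rproj_lift hker).
rewrite !hr /f /= (zmod_morphism0 FrB) => Fra0.
(* A worst-case sequence: [x n] is not killed by [a] whenever some element of [N n] is not. If its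
   germ is killed, one bound serves all elements at all higher levels. *)
have exx n : exists x : N n,
    (exists y : N n, jsyz_map E n (rmul (a : L^o)) y <> 0) -> jsyz_map E n (rmul (a : L^o)) x <> 0.
  have [[y ny]|ny] := EM (exists y : N n, jsyz_map E n (rmul (a : L^o)) y <> 0).
    by exists y.
  by exists 0.
pose x : Q := fun n => sval (cid (exx n)); have xP n := svalP (cid (exx n)).
have /germ_eq0 [n0 n0P] : germ (act_ring a x) = 0 by rewrite -FrE Fra0.
exists n0 => n le; apply: jsyz_map_eq0 => w; apply: contrapT => nw.
by apply: (xP n _ (n0P n le)); exists w.
Qed.
End Action.

(** * Regularity of the component of degree 0 *)

Section LeavittDegreeZero.
Variables (L : pzRingType) (S : {pred L}) (E : subPzRingType S).
Variables (M : bimodType L L) (ka : {linear syz E L^o -> M}).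
Variable kb : {linear M -> syz E L^o}.
Hypotheses (kaK : cancel ka kb) (kbK : cancel kb ka).
Hypothesis kaZr : forall a x b : L,
  ka (stm E a (x * b : L^o)) = ka (stm E a (x : L^o)) :* b.
Hypothesis basisM : exists (n : nat) (a : 'I_n -> M) (a' : 'I_n -> dual M),
  dual_basis a a'.
Hypothesis ssE : semisimple_ring E.

Local Notation ring := (@lv_ring L M).
Local Notation mod := (@lv_mod L M).
Let ringB := @lv_ringB L M.
Let ringM := @lv_ringM L M.
Let ring1 := @lv_ring1 L M.
Let modB := @lv_modB L M.
Let modZ := @lv_modZ L M.
Let modZr := @lv_modZr L M.
Let evalE := @lv_eval L M.
Let casimirE := @lv_casimir L M.

Lemma leavitt_representable d t : leavitt_homog d t -> representable ka ring mod d t.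
Proof.
elim=> {d t} [a|x|f|d|d u v _ Hu _ Hv|d e u v _ Hu _ Hv].
- exact: (representable_ring kaZr ringB ringM modB modZ modZr).
- exact: (representable_mod kbK kaZr ringB ringM modB modZ modZr).
- exact: (representable_dual kaK kbK kaZr ringB ringM modB modZ modZr evalE).
- exact: (representable0 kaZr ringB ringM modB modZ modZr).
- exact: (representableB kaZr ringB ringM modB modZ modZr).
- exact: (representableM Hu Hv).
Qed.

Lemma leavitt0_von_neumann :
  (exists n, forall X : lmodType L, projective (isyz E n X)) ->
  von_neumann_regular (leavitt0 M).
Proof.
move=> projn; apply: regular_von_neumann => -[t t0].
have ht : leavitt_homog 0 t by exact/asboolP.
have [s hs tst] := leavitt0_regular kaK kbK kaZr ringB ringM ring1 modB modZ modZr
  evalE casimirE (@homog_ring L M) (@homog_mod L M) (@homog_dual L M) (@homog0 L M)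
  (@homogB L M) (@homogM L M) basisM ssE projn (leavitt_representable ht).
have s0 : s \in @leavitt0_pred L M by exact/asboolP.
by exists (Leavitt0 s0); apply: val_inj; exact: tst.
Qed.

Lemma von_neumann_projective (I : L -> Prop) (HI : @is_submod L L^o I)
    (m : nat) (g : 'I_m -> L) :
  (forall i, I (g i)) ->
  (forall x, I x -> exists c : 'I_m -> L, x = \sum_i c i * g i) ->
  von_neumann_regular (leavitt0 M) -> exists q, projective (isyz E q (quotm HI)).
Proof.
move=> gI Ig vn.
have ring0 a : ring a \in @leavitt0_pred L M by apply/asboolP; exact: homog_ring.
have [y yP] := von_neumann_local_unit (fun i => Leavitt0 (ring0 (g i))) vn.
have ker := lv_ring_ker kaK kbK kaZr.
have lup := local_unit_projective kaK kbK kaZr ringB ringM ring1 modB modZ modZr evalE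
  casimirE (@homog_ring L M) (@homog_dual L M) (@homogM L M) basisM ssE ker.
apply: (lup m g (fun j => leavitt0_val (y j)) I HI gI Ig).
- by move=> j; apply: leavitt_representable; apply/asboolP; case: (y j).
- have valM (u v : leavitt0 M) : leavitt0_val (u * v) = leavitt0_val u * leavitt0_val v by [].
  have valS (F : 'I_m -> leavitt0 M) : leavitt0_val (\sum_j F j) = \sum_j leavitt0_val (F j).
    by elim/big_rec2: _ => [|j u v _ <-].
  by move=> i; have := congr1 (@leavitt0_val L M) (yP i); rewrite valM valS.
Qed.
End LeavittDegreeZero.

Theorem corollary5p9 (Lambda : pzRingType) (S : {pred Lambda})
    (E : subPzRingType S) :
  semisimple_ring E ->
  finitely_generated (res_scalars E) ->
  finite_global_dimension Lambda <->
  von_neumann_regular (leavitt0 (Omega E)).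
Proof.
move=> ssE fgE.
have kaZr a x b : Omega_of_syz E (stm E a (x * b : Lambda^o)) =
    Omega_of_syz E (stm E a (x : Lambda^o)) :* b.
  by rewrite !Omega_of_syzE OmegaZr.
have basis := Omega_dual_basis ssE fgE.
split=> [[n pdn]|vn].
  apply: (leavitt0_von_neumann (@Omega_of_syzK _ _ E) (@syz_of_OmegaK _ _ E) kaZr basis ssE).
  by exists n => X; apply/(proj_dim_isyz ssE).
have [m [g [gJ Jg]]] := ideal_fg ssE fgE (jrad_ideal Lambda).
have [q projq] := von_neumann_projective (@Omega_of_syzK _ _ E) (@syz_of_OmegaK _ _ E)
  kaZr basis ssE (jrad_ideal Lambda) gJ Jg vn.
exists q => X; apply/(proj_dim_isyz ssE).
exact: (top_projective_global ssE fgE projq).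
Qed.
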